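(* Let $N\ge2$ and let $\Omega\subset\mathbb{R}^N$ be a bounded and smooth domain with distance function to the boundary $\rho(x)=\inf_{y\in\partial\Omega}|y-x|$. For each $p>N$ let $u_p$ denote a positive extremal function of $\Lambda_p(\Omega)$ and $x_p$ its unique maximum point. Let $p_n\to\infty$, $x_*\in\Omega$ and $u_\infty\in W_0^{1,\infty}(\Omega)$ be such that: (a) $u_{p_n}\to u_\infty$ weakly in $W_0^{1,r}(\Omega)$ for any $r>N$ and uniformly in $\overline\Omega$; (b) $\|\nabla u_\infty\|_\infty=1/\|\rho\|_\infty$; (c) $0\le u_\infty\le\rho/\|\rho\|_\infty$ a.e. in $\Omega$; (d) $x_{p_n}\to x_*$; (e) $u_\infty(x_* )=1=\|u_\infty\|_\infty$ and $\rho(x_* )=\|\rho\|_\infty$. Then $u_\infty$ is strictly positive in $\Omega$ and attains its maximum value $1$ only at $x_*$.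
   Context: $\|\cdot\|_s$ denotes the norm of $L^s(\Omega)$. For $p>N$, $\Lambda_p(\Omega)=\min\{\|\nabla u\|_p^p:u\in W_0^{1,p}(\Omega),\ \|u\|_\infty=1\}$. A positive extremal function of $\Lambda_p(\Omega)$ is a function $u_p\in W_0^{1,p}(\Omega)$ with $u_p>0$ in $\Omega$, $\|u_p\|_\infty=1$ and $\|\nabla u_p\|_p^p=\Lambda_p(\Omega)$; such functions exist, are continuous on $\overline\Omega$, and have a unique maximum point $x_p\in\Omega$. Data $(p_n),x_*,u_\infty$ satisfying (a)–(e) always exist. *)

(* Defs.v *)
From HB Require Import structures.
From mathcomp Require Import all_boot all_order all_algebra.
From mathcomp Require Import all_classical all_reals all_analysis.

Set Implicit Arguments.
Unset Strict Implicit.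
Unset Printing Implicit Defensive.

Import Order.TTheory GRing.Theory Num.Theory.
Import numFieldNormedType.Exports.

Local Open Scope classical_set_scope.
Local Open Scope ring_scope.

Definition rV_display : measure_display.
Proof. exact: default_measure_display. Qed.

(* As n.-tuple T in the library, 'rV[R]_n carries the product sigma-algebra
   generated by the coordinates, i.e., the Borel sigma-algebra of R^n. *)
Section measurable_rV.
Context {R : realType} (n : nat).

Let coors : 'I_n -> 'rV[R]_n -> measurableTypeR R := fun i x => x ord0 i.

Let rV_set0 : g_sigma_preimage coors set0.
Proof. exact: sigma_algebra0. Qed.

Let rV_setC A : g_sigma_preimage coors A -> g_sigma_preimage coors (~` A).
Proof. exact: sigma_algebraC. Qed.

Let rV_bigcup (F : _^nat) : (forall i, g_sigma_preimage coors (F i)) ->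
  g_sigma_preimage coors (\bigcup_i (F i)).
Proof. exact: sigma_algebra_bigcup. Qed.

HB.instance Definition _ := @isMeasurable.Build rV_display
  'rV[R]_n (g_sigma_preimage coors) rV_set0 rV_setC rV_bigcup.

End measurable_rV.

Section lebesgue_measure_rV.
Context {R : realType}.

Lemma measurable_coord n (i : 'I_n) :
  measurable_fun [set: 'rV[R]_n] (fun x => x ord0 i : measurableTypeR R).
Proof.
move=> _ Y mY; rewrite setTI; apply: sub_sigma_algebra => /=.
rewrite -bigcup_seq/=; exists i => /=; first by rewrite mem_index_enum.
by exists Y => //; rewrite setTI.
Qed.

Lemma measurable_fun_coordP d (T : measurableType d) n (f : T -> 'rV[R]_n) :
  (forall i, measurable_fun [set: T] (fun x => f x ord0 i : measurableTypeR R)) ->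
  measurable_fun [set: T] f.
Proof.
move=> mf _ Y mY; rewrite setTI.
move: Y mY; apply: smallest_sub.
  split=> [|A mA|F mF] /=.
  - by rewrite preimage_set0.
  - by rewrite setTD preimage_setC; exact: measurableC.
  - by rewrite preimage_bigcup; exact: bigcup_measurable.
rewrite -bigcup_seq => A [i _] [B mB <-] /=.
rewrite setTI; have := mf i measurableT B mB.
by rewrite setTI.
Qed.

Definition rV_cons n (p : measurableTypeR R * 'rV[R]_n) : 'rV[R]_n.+1 :=
  \row_i oapp (p.2 ord0) p.1 (unlift ord0 i).

Lemma measurable_rV_cons n : measurable_fun [set: _] (@rV_cons n).
Proof.
apply: measurable_fun_coordP => i; case: (unliftP ord0 i) => [j|] ->.
  apply: (eq_measurable_fun ((fun v : 'rV[R]_n => v ord0 j) \o snd)).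
    by move=> p _; rewrite mxE liftK.
  by apply: measurableT_comp; [exact: measurable_coord|exact: measurable_snd].
apply: (eq_measurable_fun fst); last exact: measurable_fst.
by move=> p _; rewrite mxE unlift_none.
Qed.

Section step.
Context (n : nat) (m : {sigma_finite_measure set 'rV[R]_n -> \bar R}).

Definition lebesgue_cons : set 'rV[R]_n.+1 -> \bar R :=
  pushforward (lebesgue_measure \x m)%E (@rV_cons n).

Let lebesgue_cons0 : lebesgue_cons set0 = 0%E.
Proof. by rewrite /lebesgue_cons /pushforward preimage_set0 measure0. Qed.

Let lebesgue_cons_ge0 A : (0 <= lebesgue_cons A)%E.
Proof. by rewrite /lebesgue_cons /pushforward; exact: measure_ge0. Qed.

Let lebesgue_cons_sigma_additive : semi_sigma_additive lebesgue_cons.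
Proof.
move=> F mF tF mUF; rewrite /lebesgue_cons /pushforward preimage_bigcup.
have mpre (A : set 'rV[R]_n.+1) :
    measurable A -> measurable (@rV_cons n @^-1` A).
  by move=> mA; rewrite -[X in measurable X]setTI; exact: measurable_rV_cons.
apply: measure_semi_sigma_additive.
- by move=> k; exact: mpre.
- apply/trivIsetP => /= i j _ _ ij; rewrite -preimage_setI.
  by move/trivIsetP : tF => /(_ _ _ _ _ ij) ->//; rewrite preimage_set0.
- by rewrite -preimage_bigcup; exact: mpre.
Qed.

HB.instance Definition _ := isMeasure.Build _ _ _ lebesgue_cons
  lebesgue_cons0 lebesgue_cons_ge0 lebesgue_cons_sigma_additive.

Let lebesgue_cons_sigma_finite : sigma_finite setT lebesgue_cons.
Proof.
have [F FT Foo] : sigma_finite setT (lebesgue_measure \x m)%E.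
  have /sigma_finiteP[F [TF ndF Foo]] :=
    sigma_finiteT (@lebesgue_measure R).
  have /sigma_finiteP[G [TG ndG Goo]] := sigma_finiteT m.
  exists (fun k => F k `*` G k).
    rewrite -setXTT TF TG predeqE => -[x y]; split.
      move=> [/= [k _ Fkx] [l _ Gly]]; exists (maxn k l) => //; split.
      - by move: x Fkx; exact/subsetPset/ndF/leq_maxl.
      - by move: y Gly; exact/subsetPset/ndG/leq_maxr.
    by move=> [k _ []/= ? ?]; split; exists k.
  move=> k; have [? ?] := Foo k; have [? ?] := Goo k.
  split; first exact: measurableX.
  by rewrite product_measure1E// lte_mul_pinfty// ge0_fin_numE.
pose uncons (v : 'rV[R]_n.+1) : measurableTypeR R * 'rV[R]_n :=
  (v ord0 ord0, \row_i v ord0 (lift ord0 i)).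
have unconsK p : uncons (rV_cons p) = p.
  case: p => a v; congr pair; first by rewrite mxE unlift_none.
  by apply/rowP => i; rewrite !mxE liftK.
exists (fun k => uncons @^-1` F k).
  by rewrite -preimage_bigcup -FT.
have muncons : measurable_fun setT uncons.
  apply/measurable_fun_pairP; split; first exact: measurable_coord.
  apply: measurable_fun_coordP => i; rewrite /comp /=.
  apply: (eq_measurable_fun (fun v : 'rV[R]_n.+1 => v ord0 (lift ord0 i))).
    by move=> v _; rewrite mxE.
  exact: measurable_coord.
move=> k; have [mFk Fkoo] := Foo k; split.
  by rewrite -[X in measurable X]setTI; exact: muncons.
rewrite /lebesgue_cons /pushforward -comp_preimage.
by rewrite (_ : uncons \o _ = id) //; apply/funext.
Qed.

HB.instance Definition _ := Measure_isSigmaFinite.Build _ _ _ lebesgue_cons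
  lebesgue_cons_sigma_finite.

End step.

Fixpoint lebesgue_rV n : {sigma_finite_measure set 'rV[R]_n -> \bar R} :=
  if n is n'.+1 then lebesgue_cons (lebesgue_rV n') else \d_(0 : 'rV[R]_0).

End lebesgue_measure_rV.

(* The library norm `|x| of 'rV[R]_n is the sup norm. *)
Definition enorm {R : realType} n (x : 'rV[R]_n) : R :=
  Num.sqrt (\sum_i x ord0 i ^+ 2).

Section smoothness.
Context {R : realType} {n : nat}.
Implicit Types (f : 'rV[R]_n -> R) (D : set 'rV[R]_n).

Definition partial (i : 'I_n) f : 'rV[R]_n -> R :=
  fun x => 'D_(delta_mx ord0 i) f x.

Fixpoint class_C (k : nat) f : Prop :=
  continuous f /\
  if k is k'.+1 then
    forall i, (forall x, derivable f x (delta_mx ord0 i)) /\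
              class_C k' (partial i f)
  else True.

Definition smooth f := forall k, class_C k f.

(* C_c^oo(D), its elements being extended by 0 outside D. *)
Definition test_function D f :=
  [/\ smooth f, compact (closure [set x | f x != 0]) &
      closure [set x | f x != 0] `<=` D].

End smoothness.

Definition boundary {T : topologicalType} (D : set T) := closure D `\` D°.

(* Near each boundary point, after relabelling and reorienting the coordinate
   axes, D is the region above the graph of a smooth function of the
   n - 1 other coordinates. *)
Definition smooth_boundary {R : realType} n (D : set 'rV[R]_n) :=
  forall x0, boundary D x0 ->
    exists (i : 'I_n) (b : bool) (h : 'rV[R]_n.-1 -> R), smooth h /\
      \forall x \near x0, D x <-> h (col' i x) < (-1) ^+ b * x ord0 i.

Definition bounded_smooth_domain {R : realType} n (D : set 'rV[R]_n) :=
  [/\ D !=set0, open D, connected D, bounded_set D & smooth_boundary D].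

Definition dist_boundary {R : realType} n (D : set 'rV[R]_n) (x : 'rV[R]_n) : R :=
  inf [set enorm (y - x) | y in boundary D].

Section sobolev.
Context {R : realType} {n : nat}.
Implicit Types (D : set 'rV[R]_n) (u v : 'rV[R]_n -> R) (s : \bar R).

Local Notation mu := (lebesgue_rV n).

Definition norm_L D s u : \bar R := 'N[mu]_s [EFin \o (u \_ D)].

Definition in_L D s u := measurable_fun D u /\ (norm_L D s u < +oo)%E.

Definition in_L1loc D u :=
  forall K, compact K -> K `<=` D -> mu.-integrable K (EFin \o u).

Definition is_weak_gradient D u (g : 'rV[R]_n -> 'rV[R]_n) :=
  in_L1loc D u /\
  forall i, in_L1loc D (fun x => g x ord0 i) /\
    forall phi, test_function D phi ->
      (\int[mu]_(x in D) (u x * partial i phi x)%:E =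
       - \int[mu]_(x in D) (g x ord0 i * phi x)%:E)%E.

(* A representative of the weak gradient of u in D if u has one, else 0. *)
Definition weak_gradient D u : 'rV[R]_n -> 'rV[R]_n :=
  xget (fun=> 0) [set g | is_weak_gradient D u g].

Definition norm_grad D s u : \bar R :=
  norm_L D s (fun x => enorm (weak_gradient D u x)).

Definition W1 D s : set ('rV[R]_n -> R) :=
  [set u | [/\ in_L D s u, is_weak_gradient D u (weak_gradient D u) &
    forall i, in_L D s (fun x => weak_gradient D u x ord0 i)]].

Definition norm_W1 D s u : \bar R := (norm_L D s u + norm_grad D s u)%E.

(* For 1 <= r < +oo: the closure of C_c^oo(D) in W^{1,r}(D). *)
Definition W10 D (r : R) : set ('rV[R]_n -> R) :=
  [set u | W1 D r%:E u /\ exists phi : nat -> 'rV[R]_n -> R,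
    (forall k, test_function D (phi k)) /\
    norm_W1 D r%:E (u \- phi k) @[k --> \oo] --> 0%E].

(* W_0^{1,oo}(D) is not the closure of C_c^oo(D) in W^{1,oo}(D), but the space
   of the functions of W^{1,oo}(D) that vanish on the boundary. *)
Definition W10_oo D : set ('rV[R]_n -> R) := W1 D +oo%E `&` W10 D 1.

(* Elements of the dual of W_0^{1,r}(D); by boundedness the value of l on
   W10 D r only depends on the class of functions modulo a.e. equality. *)
Definition dual_W10 D (r : R) (l : ('rV[R]_n -> R) -> R) :=
  (forall (a : R) u v, W10 D r u -> W10 D r v ->
     l (fun x => a * u x + v x) = a * l u + l v) /\
  exists C : R, forall u, W10 D r u ->
    (`|l u|%:E <= C%:E * norm_W1 D r%:E u)%E.

Definition weak_cvg_W10 D (r : R) (v : nat -> 'rV[R]_n -> R) u :=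
  [/\ \forall k \near \oo, W10 D r (v k), W10 D r u &
      forall l, dual_W10 D r l -> l (v k) @[k --> \oo] --> l u].

Definition Lambda D (p : R) : \bar R :=
  ereal_inf [set (norm_grad D p%:E u `^ p)%E | u in
    [set u | W10 D p u /\ norm_L D +oo%E u = 1%E]].

(* u is the representative that is continuous up to the boundary. *)
Definition positive_extremal D (p : R) u :=
  [/\ W10 D p u, {within closure D, continuous u}, forall x, D x -> 0 < u x,
      norm_L D +oo%E u = 1%E & (norm_grad D p%:E u `^ p)%E = Lambda D p].

End sobolev.

Definition unique_max_point {R : realType} {T : Type} (A : set T) (f : T -> R) x :=
  A x /\ forall y, A y -> y <> x -> f y < f x.

(* Main.v *)
Require Import Defs.
From HB Require Import structures.
From mathcomp Require Import all_boot all_order all_algebra.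
From mathcomp Require Import all_classical all_reals all_analysis.
From mathcomp Require Import measurable_realfun ess_sup_inf ring lra.

Set Implicit Arguments.
Unset Strict Implicit.
Unset Printing Implicit Defensive.

Import Order.TTheory GRing.Theory Num.Theory.
Import numFieldNormedType.Exports.

Local Open Scope classical_set_scope.
Local Open Scope ring_scope.

(** Let [u] minimise [|grad u|^p] among the functions of sup norm at least 1, and let
    [F = exp (- lam p sin u)].  Adding [eta^m F(u) / (lam p)], with [eta >= 0] a cut-off and
    [m ~ p], keeps [u] admissible; the perturbed gradient is a convex combination of
    [grad u] and a multiple of [grad eta], so the convexity of [|.|^p] bounds
    [int eta^m F(u) |grad u|^p] by [(C / lam)^p].  As [p -> oo], this gives a bound on
    the weak gradient of [exp (- lam sin uoo)] that does not depend on [lam], hence a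
    Lipschitz bound.  Letting [lam -> oo], the zero set of [uoo] is open, and by
    connectedness [uoo > 0].

    With [1 - u] in place of [u] and perturbations supported away from the maximum
    point, the same argument shows that [uoo] equals 1 near each of its maximum points
    other than [xstar].  This is impossible: [uoo <= |. - z| / d] for each [z] on the
    boundary, where [d] is the maximum of the distance to the boundary, and points at
    distance less than [d] exist near any given point. *)

(** * Lebesgue measure on boxes *)

(** The factor [p] in the exponent makes [F] the p-th power of h = exp (- lam sin u), so F |grad
    u|^p is comparable to (|grad h| / lam)^p, and the bound (C / lam)^p becomes one on grad h that
    is free of [lam]. The sine, rather than u itself, serves because [F] has to be composed with the
    test functions that approximate u, whose values are not confined to [0, 1]: the sine keeps [F]
    and its derivatives bounded on the whole line, while on [0, 1] it is nonnegative, has derivative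
    at least cos 1 > 0 and vanishes only at 0. Minimality is first established against test
    functions, so eta^m F(u) is never itself a competitor; the inequality for eta^m F(phi_k) passes
    to the limit in L^p. The sign of a perturbation decides where it may live: raising u keeps its
    value at the maximum point at least 1, whereas lowering u demands a support that misses this
    point. As the maximum points of the extremals tend to xstar, the second propagation works near
    every point of the domain but xstar. *)

Section boxes.
Context {R : realType} {n : nat}.
Implicit Types (a b : 'I_n -> R) (x y : 'rV[R]_n) (A : set 'rV[R]_n).

Definition obox a b : set 'rV[R]_n :=
  [set x | forall i, a i < x ord0 i < b i].

Definition cbox a b : set 'rV[R]_n :=
  [set x | forall i, a i <= x ord0 i <= b i].

Lemma sub_obox_cbox a b : obox a b `<=` cbox a b.
Proof. by move=> x xab i; have /andP[/ltW -> /ltW ->] := xab i. Qed.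

Lemma nbhs_rVP x A : nbhs x A <->
  exists2 e, 0 < e & forall y, (forall i, `|x ord0 i - y ord0 i| < e) -> A y.
Proof.
split=> [/nbhs_ballP[e /= e0 xeA]|[e e0 xeA]].
  exists e => // y xy; apply: xeA; split=> // i j.
  by rewrite (ord1 i); exact: xy.
by apply/nbhs_ballP; exists e => //= y [_ xy]; apply: xeA => i; exact: xy.
Qed.

Lemma rV_continuous_coords (T : topologicalType) (f : T -> 'rV[R]_n) :
  (forall i, continuous (fun t => f t ord0 i)) -> continuous f.
Proof.
move=> cf t A /nbhs_rVP[e e0 eA].
have : \forall s \near t, forall i, `|f t ord0 i - f s ord0 i| < e.
  apply: filter_forall => i.
  by have /cvgrPdist_lt/(_ _ e0) := cf i t.
by apply: filterS => s; exact: eA.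
Qed.

Lemma open_obox a b : open (obox a b).
Proof.
rewrite openE => x xab.
apply: (@filter_forall _ _ (fun i (y : 'rV[R]_n) => a i < y ord0 i < b i) (nbhs x)) => i.
have ci := @coord_continuous R 1 n ord0 i x.
have /andP[ax xb] := xab i.
have h1 : nbhs x [set y : 'rV[R]_n | a i < y ord0 i] by exact: (ci [set t | a i < t] (lt_nbhsr ax)).
have h2 : nbhs x [set y : 'rV[R]_n | y ord0 i < b i] by exact: (ci [set t | t < b i] (lt_nbhsl xb)).
by apply: filterS2 h1 h2 => y -> ->.
Qed.

Lemma closed_cbox a b : closed (cbox a b).
Proof.
have -> : cbox a b = \bigcap_i ((fun x => x ord0 i) @^-1` `[a i, b i]%classic).
  apply/seteqP; split=> [x xab i _|x xab i]; first by rewrite /= in_itv/=.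
  by have := xab i I; rewrite /= in_itv.
apply: closed_bigI => i _; apply: preimage_closed => [x _|].
  exact: coord_continuous.
exact: interval_closed.
Qed.

Lemma compact_cbox a b : compact (cbox a b).
Proof.
have : compact [set v : 'rV[R]_n | forall i, `[a i, b i]%classic (v ord0 i)].
  apply: (@rV_compact _ _ (fun i => `[a i, b i]%classic)) => i.
  exact: segment_compact.
by congr compact.
Qed.

Lemma measurable_obox a b : measurable (obox a b).
Proof.
have -> : obox a b = \bigcap_i ((fun x => x ord0 i) @^-1` `]a i, b i[%classic).
  apply/seteqP; split=> [x xab i _|x xab i]; first by rewrite /= in_itv/=.
  by have := xab i I; rewrite /= in_itv.
apply: fin_bigcap_measurable => [|i _]; first exact: finite_finset.
rewrite -[X in measurable X]setTI.
by apply: measurable_coord => //; exact: measurable_itv.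
Qed.

(** The boxes have rational corners, hence are countable, and are enumerated through [unpickle],
    with [q0] for the integers that encode nothing. Asking the closed box to lie in [A] gives
    compact pieces, on which a locally integrable function is integrable. *)
Lemma open_bigcup_obox A : open A ->
  exists (P : set nat) (a b : nat -> 'I_n -> R),
    A = \bigcup_(k in P) obox (a k) (b k) /\
    forall k, P k -> cbox (a k) (b k) `<=` A.
Proof.
move=> oA.
pose q0 : {ffun 'I_n -> rat * rat} := [ffun=> (0, 0)].
pose q k := odflt q0 (unpickle k).
pose a k i : R := ratr (q k i).1; pose b k i : R := ratr (q k i).2.
exists [set k | cbox (a k) (b k) `<=` A], a, b; split=> //.
apply/seteqP; split=> [x Ax|x [k /= kA]]; last first.
  by move/sub_obox_cbox; exact: kA.
have /nbhs_rVP[e e0 eA] : nbhs x A by exact: open_nbhs_nbhs.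
have qP (i : 'I_n) : exists r : rat * rat,
    x ord0 i - e < ratr r.1 /\ ratr r.1 < x ord0 i /\
    x ord0 i < ratr r.2 /\ ratr r.2 < x ord0 i + e.
  have [r1 r1P] : exists r : rat, ratr r \in `]x ord0 i - e, x ord0 i[.
    by apply: rat_in_itvoo; rewrite ltrBlDr ltrDl.
  have [r2 r2P] : exists r : rat, ratr r \in `]x ord0 i, x ord0 i + e[.
    by apply: rat_in_itvoo; rewrite ltrDl.
  exists (r1, r2); move: r1P r2P; rewrite !in_itv/=.
  by move=> /andP[? ?] /andP[? ?].
have [r rP] := choice qP.
exists (pickle [ffun i => r i]).
  move=> y yab; apply: eA => i; have := yab i.
  rewrite /a /b /q pickleK /= ffunE => /andP[ay yb].
  have [? [? [? ?]]] := rP i; rewrite ltr_norml; apply/andP; split; lra.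
move=> i; rewrite /a /b /q pickleK /= ffunE.
by have [_ [-> [-> _]]] := rP i.
Qed.

Lemma measurable_open A : open A -> measurable A.
Proof.
move=> /open_bigcup_obox[P [a [b [-> _]]]].
by apply: bigcup_measurable => k _; exact: measurable_obox.
Qed.

Lemma measurable_closed A : closed A -> measurable A.
Proof.
move=> /closed_openC/measurable_open/measurableC; by rewrite setCK.
Qed.

Lemma measurable_cbox a b : measurable (cbox a b).
Proof. by apply: measurable_closed; exact: closed_cbox. Qed.

Lemma measurable_compact A : compact A -> measurable A.
Proof.
move=> cA; apply: measurable_closed; apply: compact_closed cA.
exact: (@norm_hausdorff R 'rV[R]_n).
Qed.

Lemma continuous_measurable_fun_rV (f : 'rV[R]_n -> R) :
  continuous f -> measurable_fun setT f.
Proof.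
move=> cf; apply: (measurability _ (RGenOInfty.measurableE R)) => _ [_ [x ->] <-].
rewrite setTI; apply: measurable_open.
by apply: open_comp => [y _|]; [exact: cf|exact: rray_open].
Qed.

End boxes.

(** * Volumes of boxes and Tonelli for products of one-variable functions *)

Section lebesgue_rV_theory.
Context {R : realType}.

Lemma ge0_integral_rV_cons n (f : 'rV[R]_n.+1 -> \bar R) :
  measurable_fun setT f -> (forall x, 0 <= f x)%E ->
  (\int[lebesgue_rV n.+1]_x f x =
   \int[lebesgue_measure]_t \int[lebesgue_rV n]_v f (rV_cons (t, v)))%E.
Proof.
move=> mf f0; rewrite /= /lebesgue_cons.
rewrite (ge0_integral_pushforward (@measurable_rV_cons R n))//.
rewrite preimage_setT fubini_tonelli1//; last by move=> x; exact: f0.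
by apply: measurableT_comp => //; exact: measurable_rV_cons.
Qed.

(** Tonelli by induction on the dimension, one coordinate being peeled off at a time. It is used
    with indicators, for the volume of a box, and with unit-mass kernels, for mollification. *)
Lemma ge0_integral_prod_coord n (f : 'I_n -> R -> R) (c : 'I_n -> R) :
  (forall i, measurable_fun setT (f i)) -> (forall i t, 0 <= f i t) ->
  (forall i, \int[lebesgue_measure]_t (f i t)%:E = (c i)%:E)%E ->
  (\int[lebesgue_rV n]_x (\prod_i f i (x ord0 i))%:E = (\prod_i c i)%:E)%E.
Proof.
elim: n f c => [|n IH] f c mf f0 fc.
  under eq_integral do rewrite big_ord0.
  by rewrite big_ord0 /= integral_dirac// diracT mul1e.
have mP k (g : 'I_k -> R -> R) : (forall i, measurable_fun setT (g i)) ->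
    measurable_fun [set: 'rV[R]_k] (fun x => \prod_i g i (x ord0 i)).
  move=> mg; apply: measurable_prod => i _.
  by apply: measurableT_comp => //; exact: measurable_coord.
rewrite ge0_integral_rV_cons; last 2 first.
- by apply/measurable_EFinP; exact: mP.
- by move=> x; rewrite lee_fin prodr_ge0.
transitivity (\int[lebesgue_measure]_t ((\prod_i c (lift ord0 i))%:E * (f ord0 t)%:E))%E.
  apply: eq_integral => t _.
  under eq_integral => v _.
    rewrite big_ord_recl [rV_cons _ _ _]mxE unlift_none /= EFinM.
    under eq_bigr do rewrite mxE liftK /=.
    over.
  rewrite ge0_integralZl//; last 3 first.
  - by apply/measurable_EFinP; exact: (mP n (fun i : 'I_n => f (lift ord0 i))).
  - by move=> v _; rewrite lee_fin prodr_ge0.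
  - by rewrite lee_fin.
  by rewrite (IH (fun i => f (lift ord0 i)) (fun i => c (lift ord0 i)))// muleC.
rewrite ge0_integralZl//; last 3 first.
- by apply/measurable_EFinP; exact: mf.
- by move=> t _; rewrite lee_fin.
- rewrite lee_fin; apply: prodr_ge0 => i _.
  by rewrite -lee_fin -fc; apply: integral_ge0 => t _; rewrite lee_fin.
by rewrite fc big_ord_recl -EFinM mulrC.
Qed.

Context {n : nat}.
Implicit Types (a b : 'I_n -> R).
Local Notation mu := (@lebesgue_rV R n).

Lemma lebesgue_obox a b : (forall i, a i <= b i) ->
  mu (obox a b) = (\prod_i (b i - a i))%:E.
Proof.
move=> ab; rewrite -(ge0_integral_prod_coord (f := fun i => \1_(`]a i, b i[%classic)))//.
- rewrite -[X in mu X]setIT -integral_indic//; last exact: measurable_obox.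
  apply: eq_integral => x _; congr EFin.
  rewrite indicE; have [xab|xab] := boolP (x \in obox a b).
    rewrite big1// => i _; rewrite indicE mem_set//=.
    by move: xab; rewrite inE => /(_ i); rewrite in_itv.
  have : exists i, ~ (a i < x ord0 i < b i).
    by apply/existsNP => h; move/negP: xab; apply; rewrite inE.
  move=> [i xi]; rewrite (bigD1 i)//= indicE memNset ?mul0r//=.
- by move=> i; rewrite integral_indic// setIT [LHS]lebesgue_measure_itv/= lte_fin;
    case: ltP (ab i) => // ba ab'; congr EFin; apply/esym/eqP; rewrite subr_eq0 eq_le ba.
Qed.

Lemma lebesgue_obox_gt0 a b : (forall i, a i < b i) -> (0 < mu (obox a b))%E.
Proof.
move=> ab; rewrite lebesgue_obox => [|i]; last exact: ltW.
by rewrite lte_fin; apply: prodr_gt0 => i _; rewrite subr_gt0.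
Qed.

Lemma lebesgue_cbox_lty a b : (mu (cbox a b) < +oo)%E.
Proof.
(* The maximum keeps the lower corner below the upper one even when [cbox a b] is empty, as
   [lebesgue_obox] demands. *)
pose b' i := Num.max (a i) (b i) + 1.
have sub : cbox a b `<=` obox (fun i => a i - 1) b'.
  move=> x xab i; have /andP[ax xb] := xab i; rewrite /b'.
  apply/andP; split; first by lra.
  by apply: (le_lt_trans xb); apply: ltr_pwDr => //; rewrite le_max lexx orbT.
have mB := @measurable_cbox R n a b.
apply: (@le_lt_trans _ _ (mu (obox (fun i => a i - 1) b'))).
  exact: (le_measure mu (mem_set mB) (mem_set (measurable_obox _ _)) sub).
have ab' i : a i - 1 <= b' i.
  apply: (@le_trans _ _ (a i)); first by lra.
  by apply: ler_wpDr => //; rewrite le_max lexx.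
by rewrite lebesgue_obox// ltry.
Qed.

Lemma open_lebesgue_gt0 (A : set 'rV[R]_n) : open A -> A !=set0 -> (0 < mu A)%E.
Proof.
move=> oA [x Ax]; have /nbhs_rVP[e e0 eA] : nbhs x A by exact: open_nbhs_nbhs.
pose a i := x ord0 i - e; pose b i := x ord0 i + e.
have sub : obox a b `<=` A.
  move=> y yx; apply: eA => i; have /andP[] := yx i; rewrite /a /b => ? ?.
  by rewrite ltr_norml; apply/andP; split; lra.
have mA : measurable A by exact: measurable_open.
apply: (@lt_le_trans _ _ (mu (obox a b))); last first.
  exact: (le_measure mu (mem_set (measurable_obox _ _)) (mem_set mA) sub).
by apply: lebesgue_obox_gt0 => i; rewrite /a /b; lra.
Qed.

Lemma continuous_cbox_integrable (g : 'rV[R]_n -> R) a b : continuous g ->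
  (forall x, ~ cbox a b x -> g x = 0) -> mu.-integrable setT (EFin \o g).
Proof.
move=> cg g0.
have mB := @measurable_cbox R n a b.
have mg := continuous_measurable_fun_rV cg.
have gE : g = g \_ (cbox a b).
  apply/funext => x; rewrite patchE; case: ifPn => // /negP xab.
  by apply: g0 => ?; apply: xab; rewrite inE.
rewrite gE -restrict_EFin; apply/(integrable_mkcond _ mB).1.
apply: measurable_bounded_integrable => //; first exact: lebesgue_cbox_lty.
  exact: measurable_funTS.
have : compact (g @` cbox a b).
  apply: continuous_compact; last exact: compact_cbox.
  exact: continuous_subspaceT.
move=> /compact_bounded[M [Mr HM]]; exists M; split => // y My x xab.
by apply: (HM _ My); exists x.
Qed.

End lebesgue_rV_theory.

Section directional_derivative.
Context {R : realType}.

(* Restriction to a line or to a coordinate subspace: [L] need only be affine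
   in the direction [w]. *)
Lemma is_derive_comp_affine (V W : normedModType R) (f : V -> R) (L : W -> V)
    (v : V) (w x : W) :
  (forall h : R, L (h *: w + x) = h *: v + L x) -> derivable f (L x) v ->
  is_derive x w (f \o L) ('D_v f (L x)).
Proof.
move=> Lh df.
have E : (fun h : R => h^-1 *: (((f \o L) \o shift x) (h *: w) - (f \o L) x)) =
         (fun h : R => h^-1 *: ((f \o shift (L x)) (h *: v) - f (L x))).
  by apply/funext => h /=; rewrite Lh.
by apply: DeriveDef; rewrite /derivable /derive /= E.
Qed.

Lemma derive_notin_closed (n : nat) (f : 'rV[R]_n -> R) (K : set 'rV[R]_n) v x :
  closed K -> (forall y, ~ K y -> f y = 0) -> ~ K x -> 'D_v f x = 0.
Proof.
move=> cK f0 Kx; rewrite -[RHS](derive_cst (0 : R) x v) .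
have [v0|v0] := eqVneq v 0; first by rewrite v0 !derive0.
apply: near_eq_derive => //.
have : nbhs x (~` K) by apply: open_nbhs_nbhs; split => //; exact: closed_openC.
by apply: filterS => y /f0 ->.
Qed.

End directional_derivative.

(** * Partial derivatives of compactly supported functions have integral 0 *)

Section integral_partial.
Context {R : realType}.

Lemma rV_cons_add n (t s : R) (v w : 'rV[R]_n) :
  rV_cons (t + s, v + w) = rV_cons (t, v) + rV_cons (s, w).
Proof.
apply/rowP => i; case: (unliftP ord0 i) => [j|] ->; rewrite !mxE.
  by rewrite liftK /= mxE.
by rewrite unlift_none.
Qed.

Lemma rV_consZ0 n (h : R) : rV_cons (h, 0 : 'rV[R]_n) = h *: delta_mx ord0 ord0.
Proof.
apply/rowP => i; case: (unliftP ord0 i) => [j|] ->; rewrite !mxE.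
  by rewrite liftK /= mxE mulr0.
by rewrite unlift_none /= mulr1.
Qed.

Lemma rV_cons0Z n (h : R) (j : 'I_n) :
  rV_cons (0, h *: delta_mx ord0 j) = h *: delta_mx ord0 (lift ord0 j).
Proof.
apply/rowP => i; case: (unliftP ord0 i) => [k|] ->; rewrite !mxE.
  by rewrite liftK /= !mxE /= (inj_eq lift_inj).
by rewrite unlift_none /= mulr0.
Qed.

Lemma rV_cons_ord0 n (t : R) (v : 'rV[R]_n) : rV_cons (t, v) ord0 ord0 = t.
Proof. by rewrite mxE unlift_none. Qed.

Lemma rV_cons_lift n (t : R) (v : 'rV[R]_n) j :
  rV_cons (t, v) ord0 (lift ord0 j) = v ord0 j.
Proof. by rewrite mxE liftK. Qed.

Lemma continuous_rV_consr n (t : R) :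
  continuous (fun v : 'rV[R]_n => rV_cons (t, v)).
Proof.
apply: rV_continuous_coords => i.
case: (unliftP ord0 i) => [j|] ->.
  have -> : (fun v : 'rV[R]_n => rV_cons (t, v) ord0 (lift ord0 j)) =
            (fun v => v ord0 j) by apply/funext => v; exact: rV_cons_lift.
  exact: coord_continuous.
have -> : (fun v : 'rV[R]_n => rV_cons (t, v) ord0 ord0) = cst t.
  by apply/funext => v; exact: rV_cons_ord0.
exact: cst_continuous.
Qed.

Lemma continuous_rV_consl n (v : 'rV[R]_n) :
  continuous (fun t : R => rV_cons (t, v)).
Proof.
apply: rV_continuous_coords => i.
case: (unliftP ord0 i) => [j|] ->.
  have -> : (fun t : R => rV_cons (t, v) ord0 (lift ord0 j)) = cst (v ord0 j).
    by apply/funext => t; exact: rV_cons_lift.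
  exact: cst_continuous.
have -> : (fun t : R => rV_cons (t, v) ord0 ord0) = id.
  by apply/funext => t; exact: rV_cons_ord0.
by move=> t; exact: cvg_id.
Qed.

Lemma integral_derive1_0 (F f : R -> R) (M : R) :
  continuous f -> (forall t : R, is_derive t (1 : R) F (f t)) ->
  (forall t, M < `|t| -> F t = 0) -> (forall t, M < `|t| -> f t = 0) ->
  (\int[lebesgue_measure]_t (f t)%:E = 0)%E.
Proof.
(* Both ends of the interval then exceed [M] strictly in absolute value, so that [F] vanishes
   there. *)
move=> cf dF F0 f0; pose a := `|M| + 1.
have Ma t : t \notin `[- a, a] -> M < `|t|.
  move=> ta; have : M <= `|M| := ler_norm M.
  have : ~~ (`|t| <= a) by move: ta; rewrite in_itv/= -ler_norml.
  by rewrite -ltNge /a; lra.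
have aa : - a < a by rewrite /a; have := normr_ge0 M; lra.
have cF : continuous F.
  move=> t; apply: differentiable_continuous; apply/derivable1_diffP.
  by have [] := dF t.
have E : (\int[lebesgue_measure]_(t in `[(- a)%R, a]) (f t)%:E =
    \int[lebesgue_measure]_t (f t)%:E)%E.
  rewrite integral_mkcond; apply: eq_integral => t _; rewrite patchE.
  case: ifPn => // /negP ta; rewrite f0//; apply: Ma.
  by apply/negP => ta'; apply: ta; rewrite inE.
rewrite -E (@continuous_FTC2 _ f F)//.
- by rewrite !F0 ?subee// ?normrN /a ger0_norm; have := ler_norm M; have := normr_ge0 M; lra.
- exact: continuous_subspaceT.
- split=> [t _||].
  + by have [] := dF t.
  + exact: cvg_at_right_filter (cF _).
  + exact: cvg_at_left_filter (cF _).
- by move=> t _; rewrite derive1E; have [_ ->] := dF t.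
Qed.

(** Induction on the dimension: once coordinate 0 is split off, Fubini is used in the order that
    puts direction [i] into the inner integral, which vanishes by the fundamental theorem of
    calculus if [i] is coordinate 0 and by induction otherwise. *)
Lemma integral_partial0 n (f : 'rV[R]_n -> R) (i : 'I_n) (a b : 'I_n -> R) :
  continuous f -> (forall x, derivable f x (delta_mx ord0 i)) ->
  continuous (partial i f) -> (forall x, ~ cbox a b x -> f x = 0) ->
  (\int[lebesgue_rV n]_x (partial i f x)%:E = 0)%E.
Proof.
elim: n f i a b => [|n IH] f i a b; first by case: i.
move=> cf df cp f0.
have p0 x : ~ cbox a b x -> partial i f x = 0.
  by apply: derive_notin_closed => //; exact: closed_cbox.
have ip := continuous_cbox_integrable cp p0.
have mp : measurable_fun setT (EFin \o partial i f).
  by apply/measurable_EFinP; exact: continuous_measurable_fun_rV.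
have mc : measurable_fun [set: measurableTypeR R * 'rV[R]_n]
    ((EFin \o partial i f) \o @rV_cons R n).
  by apply: measurableT_comp mp _; exact: measurable_rV_cons.
have ic : (lebesgue_measure \x lebesgue_rV n)%E.-integrable setT
    ((EFin \o partial i f) \o @rV_cons R n).
  apply/integrableP; split => //.
  move/integrableP : ip => [_].
  rewrite /= /lebesgue_cons (ge0_integral_pushforward (@measurable_rV_cons R n))//.
  exact: (measurableT_comp (@abse_measurable R setT) mp).
transitivity (\int[lebesgue_measure \x lebesgue_rV n]_z
    ((EFin \o partial i f) \o @rV_cons R n) z)%E.
  rewrite /= /lebesgue_cons (integral_pushforward (@measurable_rV_cons R n))//.
case: (unliftP ord0 i) => [j ij|i0].
  rewrite -integral12_prod_meas1//; apply: integral0_eq => t _ /=.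
  have dg v : is_derive v (delta_mx ord0 j) (f \o (fun v => rV_cons (t, v)))
      (partial i f (rV_cons (t, v))).
    rewrite /partial ij; apply: is_derive_comp_affine => [h|]; last by rewrite -ij.
    by rewrite -rV_cons0Z -rV_cons_add add0r.
  have ct := @continuous_rV_consr n t.
  have gE : partial j (f \o (fun v => rV_cons (t, v))) =
      (fun v => partial i f (rV_cons (t, v))).
    by apply/funext => v; have [_ <-] := dg v.
  rewrite -[RHS](IH (f \o (fun v => rV_cons (t, v))) j
    (fun k => a (lift ord0 k)) (fun k => b (lift ord0 k))); first by rewrite gE.
  - by move=> v; apply: continuous_comp; [exact: ct|exact: cf].
  - by move=> v; have [] := dg v.
  - rewrite gE => v; apply: (@continuous_comp _ _ _ (fun v => rV_cons (t, v)) (partial i f)).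
      exact: ct.
    exact: cp.
  - move=> v vab; apply: f0 => tvab; apply: vab => k.
    by have := tvab (lift ord0 k); rewrite mxE liftK.
rewrite -integral21_prod_meas1//; apply: integral0_eq => v _ /=.
have ct := @continuous_rV_consl n v.
have out t : Num.max `|a ord0| `|b ord0| < `|t| -> ~ cbox a b (rV_cons (t, v)).
  rewrite gt_max => /andP[ta tb] /(_ ord0); rewrite mxE unlift_none /= => /andP[].
  by case: (lerP 0 t) tb ta => [/ger0_norm|/ltr0_norm] ->;
    move: (ler_norm (b ord0)) (ler_norm (- a ord0)); rewrite normrN; lra.
apply: (@integral_derive1_0 (f \o (fun t => rV_cons (t, v))) _
  (Num.max `|a ord0| `|b ord0|)).
- move=> t; apply: (@continuous_comp _ _ _ (fun t => rV_cons (t, v)) (partial i f)).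
    exact: ct.
  exact: cp.
- move=> t; rewrite /partial i0; apply: is_derive_comp_affine => [h|]; last by rewrite -i0.
  by rewrite -rV_consZ0 -rV_cons_add add0r [_ *: 1]mulr1.
- by move=> t /out; exact: f0.
- by move=> t /out; exact: p0.
Qed.

End integral_partial.

(** * Smooth functions *)

Section chain_rule.
Context {R : realType}.

(** [f] is only known to be derivable in the direction [v], so the one-variable chain rule is
    applied to its restriction [l] to the line through [x] directed by [v]. *)
Lemma is_derive_comp (V : normedModType R) (F : R -> R) (d : R) (f : V -> R) x v :
  is_derive (f x) (1 : R) F d -> derivable f x v ->
  is_derive x v (F \o f) (d * 'D_v f x).
Proof.
move=> [dF dFE] df.
pose l (h : R) := f (h *: v + x).
have l0 : l 0 = f x by rewrite /l scale0r add0r.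
have dl : derivable l 0 1 := (derivable1P f x v).1 df.
have dFl : derivable F (l 0) 1 by rewrite l0.
have dc : derivable (F \o l) 0 1.
  by apply/derivable1_diffP; apply: differentiable_comp; exact/derivable1_diffP.
have lE : 'D_1 l 0 = 'D_v f x.
  rewrite /derive; congr (lim (_ @ 0^')); apply/funext => h /=.
  by rewrite l0 /l addr0 [_ *: 1]mulr1.
apply: DeriveDef; first exact: (derivable1P (F \o f) x v).2 dc.
have FlE : 'D_1 (F \o l) 0 = 'D_v (F \o f) x.
  rewrite /derive; congr (lim (_ @ 0^')); apply/funext => h /=.
  by rewrite l0 /l addr0 [_ *: 1]mulr1.
have := derive1_comp dl dFl; rewrite !derive1E FlE lE => ->.
by rewrite -dFE l0.
Qed.

Lemma is_derive1_continuous (F F' : R -> R) :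
  (forall t, is_derive t (1 : R) F (F' t)) -> continuous F.
Proof.
move=> dF t; apply: differentiable_continuous; apply/derivable1_diffP.
by have [] := dF t.
Qed.

Lemma lipschitz_of_is_derive (f f' : R -> R) (C s t : R) :
  (forall x, is_derive x (1 : R) f (f' x)) -> (forall x, `|f' x| <= C) ->
  `|f s - f t| <= C * `|s - t|.
Proof.
move=> df f'C; have cf := is_derive1_continuous df.
wlog st : s t / s <= t.
  move=> h; have [|/ltW] := leP s t; first exact: h.
  by move/h; rewrite distrC [`|t - s|]distrC.
have [c _ E] := MVT_segment st (fun x _ => df x) (continuous_subspaceT cf).
by rewrite distrC E [`|s - t|]distrC normrM ler_wpM2r.
Qed.

End chain_rule.

Section class_C_theory.
Context {R : realType} {n : nat}.
Implicit Types (f g : 'rV[R]_n -> R) (x : 'rV[R]_n).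

Lemma class_C_continuous k f : class_C k f -> continuous f.
Proof. by case: k => [|k] []. Qed.

Lemma class_C_pred k f : class_C k.+1 f -> class_C k f.
Proof.
elim: k f => [|k IH] f; first by move=> [cf _]; split.
by move=> [cf df]; split=> // i; have [dfi /IH] := df i.
Qed.

Lemma class_C_cst k (c : R) : class_C k (cst c : 'rV[R]_n -> R).
Proof.
elim: k c => [|k IH] c; first by split=> //; exact: cst_continuous.
split=> [|i]; first exact: cst_continuous.
split=> [x|]; first exact: derivable_cst.
have -> : partial i (cst c : 'rV[R]_n -> R) = cst 0.
  by apply/funext => x; rewrite /partial derive_cst.
exact: IH.
Qed.

Lemma class_C_D k f g : class_C k f -> class_C k g ->
  class_C k (fun x => f x + g x).
Proof.
elim: k f g => [|k IH] f g [cf df] [cg dg].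
  by split=> // x; apply: continuousD; [exact: cf|exact: cg].
split=> [x|i]; first by apply: continuousD; [exact: cf|exact: cg].
have [dfi Cfi] := df i; have [dgi Cgi] := dg i.
split=> [x|]; first exact: derivableD.
have -> : partial i (fun x => f x + g x) = fun x => partial i f x + partial i g x.
  by apply/funext => x; rewrite /partial (deriveD (dfi x) (dgi x)).
exact: IH.
Qed.

Lemma partialM i f g x :
  derivable f x (delta_mx ord0 i) -> derivable g x (delta_mx ord0 i) ->
  partial i (fun x => f x * g x) x = f x * partial i g x + partial i f x * g x.
Proof.
by move=> df dg; rewrite /partial (deriveM df dg) /= /GRing.scale/= [g x * _]mulrC.
Qed.

Lemma class_C_M k f g : class_C k f -> class_C k g ->
  class_C k (fun x => f x * g x).
Proof.
elim: k f g => [|k IH] f g Cf Cg.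
  have [cf _] := Cf; have [cg _] := Cg.
  by split=> // x; apply: continuousM; [exact: cf|exact: cg].
have [cf df] := Cf; have [cg dg] := Cg.
split=> [x|i]; first by apply: continuousM; [exact: cf|exact: cg].
have [dfi Cfi] := df i; have [dgi Cgi] := dg i.
split=> [x|]; first exact: derivableM.
have -> : partial i (fun x => f x * g x) =
    fun x => f x * partial i g x + partial i f x * g x.
  by apply/funext => x; exact: partialM.
by apply: class_C_D; apply: IH => //; exact: class_C_pred.
Qed.

Lemma class_C_prod k (I : Type) (s : seq I) (f : I -> 'rV[R]_n -> R) :
  (forall i, class_C k (f i)) -> class_C k (fun x => \prod_(i <- s) f i x).
Proof.
move=> Cf; elim: s => [|i s IH].
  have -> : (fun x => \prod_(i <- [::]) f i x) = cst 1.
    by apply/funext => x; rewrite big_nil.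
  exact: class_C_cst.
have -> : (fun x => \prod_(j <- i :: s) f j x) =
    fun x => f i x * \prod_(j <- s) f j x.
  by apply/funext => x; rewrite big_cons.
exact: class_C_M.
Qed.

Lemma is_derive_coord (j : 'I_n) x v :
  is_derive x v (fun y : 'rV[R]_n => y ord0 j) (v ord0 j).
Proof.
have E : (fun h : R => h^-1 *: (((fun y : 'rV[R]_n => y ord0 j) \o shift x) (h *: v)
    - x ord0 j)) @ 0^' --> v ord0 j.
  apply: cvg_near_cst; near=> h.
  have h0 : h != 0 by near: h; exact: nbhs_dnbhs_neq.
  by rewrite /= !mxE addrK /GRing.scale/= mulrA mulVf// mul1r.
apply: DeriveDef; first by apply/cvg_ex; exists (v ord0 j).
exact: cvg_lim.
Unshelve. all: by end_near. Qed.

Lemma class_C_coord k (j : 'I_n) : class_C k (fun x : 'rV[R]_n => x ord0 j).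
Proof.
case: k => [|k]; first by split=> //; exact: coord_continuous.
split=> [|i]; first exact: coord_continuous.
split=> [x|]; first by have [] := is_derive_coord j x (delta_mx ord0 i).
have -> : partial i (fun x : 'rV[R]_n => x ord0 j) =
    cst ((delta_mx ord0 i : 'rV[R]_n) ord0 j).
  by apply/funext => x; rewrite /partial; have [_ ->] := is_derive_coord j x (delta_mx ord0 i).
exact: class_C_cst.
Qed.

Lemma partial_comp i (F F' : R -> R) f x :
  (forall t, is_derive t (1 : R) F (F' t)) -> derivable f x (delta_mx ord0 i) ->
  partial i (F \o f) x = F' (f x) * partial i f x.
Proof.
by move=> dF df; rewrite /partial; have [_ ->] := is_derive_comp (dF (f x)) df.
Qed.

(** A family [P] stable under differentiation stands for all iterated derivatives of [F], which lets
    the induction on [k] run without a formula for them. It is used for the combinations of sine and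
    cosine, for [expR] and for the functions [flat q]. *)
Lemma class_C_comp (P : set (R -> R)) k (F : R -> R) f :
  (forall G, P G -> exists2 G', P G' & forall t, is_derive t (1 : R) G (G' t)) ->
  P F -> class_C k f -> class_C k (F \o f).
Proof.
move=> HP; elim: k F => [|k IH] F PF Cf; have [F' PF' dF] := HP _ PF.
  split=> // x; apply: continuous_comp; first exact: (class_C_continuous Cf).
  exact: is_derive1_continuous dF _.
split=> [x|i].
  apply: continuous_comp; first exact: (class_C_continuous Cf).
  exact: is_derive1_continuous dF _.
have [_ /(_ i)[dfi Cfi]] := Cf.
split=> [x|]; first by have [] := is_derive_comp (dF (f x)) (dfi x).
have -> : partial i (F \o f) = fun x => (F' \o f) x * partial i f x.
  by apply/funext => x; exact: partial_comp.
by apply: class_C_M => //; apply: IH => //; exact: class_C_pred.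
Qed.

Lemma smooth_sin f : smooth f -> smooth (fun x => sin (f x)).
Proof.
move=> Cf k; apply: (@class_C_comp
  [set G : R -> R | exists a b : R, G = fun t => a * sin t + b * cos t] k sin) => //.
- move=> _ [a [b ->]]; exists (fun t => (- b) * sin t + a * cos t).
    by exists (- b), a.
  move=> t; have dab := is_deriveD (is_deriveZ a (is_derive_sin t))
    (is_deriveZ b (is_derive_cos t)).
  by apply: (is_derive_eq dab); rewrite /GRing.scale/=; ring.
- by exists 1, 0; apply/funext => t; rewrite mul1r mul0r addr0.
Qed.

Lemma smooth_expR f : smooth f -> smooth (fun x => expR (f x)).
Proof.
move=> Cf k; apply: (@class_C_comp [set expR] k expR) => //.
by move=> _ ->; exists expR => // t; exact: is_derive_expR.
Qed.

End class_C_theory.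

(** * The flat function exp (- 1 / t) *)

Section bump.
Context {R : realType}.
Implicit Types (q : {poly R}) (t a b k : R).

(* Written with a polynomial so as to be closed under differentiation. *)
Definition flat q t : R := if 0 < t then q.[t^-1] * expR (- t^-1) else 0.

(** Only the term of degree m + 1 of the exponential series is kept. With s = 1 / t the bound is
    linear in t, which is all that differentiability of [flat q] at 0 requires. *)
Lemma exprM_expRN_le m (s : R) : 0 < s ->
  s ^+ m * expR (- s) <= (m.+1)`!%:R / s.
Proof.
move=> s0; have f0 : (0 : R) < (m.+1)`!%:R by rewrite ltr0n fact_gt0.
have : s ^+ m.+1 / (m.+1)`!%:R <= expR s.
  by apply: le_trans (expR_ge1Dxn m (ltW s0)); rewrite lerDr.
rewrite ler_pdivrMr// => h.
rewrite expRN ler_pdivlMr// mulrAC -exprSr ler_pdivrMr ?expR_gt0//.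
by rewrite mulrC.
Qed.

Lemma flat_le q : exists C : R, forall t, `|flat q t| <= C * `|t|.
Proof.
exists (\sum_(i < size q) `|q`_i| * (i.+1)`!%:R) => t; rewrite /flat.
case: ifPn => [t0|_]; last first.
  by rewrite normr0 mulr_ge0// sumr_ge0// => i _; rewrite mulr_ge0.
rewrite (gtr0_norm t0) normrM (gtr0_norm (expR_gt0 _)) horner_coef.
apply: (@le_trans _ _ (\sum_(i < size q) `|q`_i * t^-1 ^+ i| * expR (- t^-1))).
  by rewrite -mulr_suml ler_wpM2r ?expR_ge0// ler_norm_sum.
rewrite mulr_suml; apply: ler_sum => i _.
have ti0 : 0 < t^-1 by rewrite invr_gt0.
rewrite normrM -!mulrA ler_wpM2l// ger0_norm; last by rewrite exprn_ge0// ltW.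
by have := exprM_expRN_le i ti0; rewrite invrK.
Qed.

(** For t > 0 the derivative of q(1/t) exp (- 1/t) is t^-2 (q - q')(1/t) exp (- 1/t), whence the
    polynomial. At 0 the difference quotient of [flat q] is [flat ('X * q)], which tends to 0 by
    [flat_le]. *)
Lemma is_derive_flat q t :
  is_derive t (1 : R) (flat q) (flat ('X^2 * (q - q^`())) t).
Proof.
have [t0|t0|->] := ltgtP t 0.
- rewrite [X in is_derive _ _ _ X]/flat ltNge (ltW t0)/=.
  apply: (@near_eq_is_derive _ _ _ (cst 0)).
  have : nbhs t [set s | s < 0] by exact: lt_nbhsl.
  by apply: filterS => s /= s0; rewrite /flat ltNge (ltW s0).
- rewrite [X in is_derive _ _ _ X]/flat t0.
  pose G s := q.[s] * expR (- s).
  apply: (@near_eq_is_derive _ _ _ (G \o (@GRing.inv R))).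
    have : nbhs t [set s | 0 < s] by exact: lt_nbhsr.
    by apply: filterS => s /= s0; rewrite /flat s0.
  have dG s : is_derive s (1 : R) G ((q^`() - q).[s] * expR (- s)).
    have dN : is_derive s (1 : R) (fun s : R => expR (- s)) (expR (- s) * - 1).
      have dopp : derivable (-%R : R -> R) s 1 by exact: derivable_opp.
      have := is_derive_comp (is_derive_expR (- s)) dopp.
      by have [_ ->] := is_deriveNid s (1 : R).
    apply: (is_derive_eq (is_deriveM (is_derive_poly q s) dN)).
    by rewrite hornerD hornerN /GRing.scale/=; ring.
  have tn0 : t != 0 by rewrite gt_eqF.
  have dV : derivable (@GRing.inv R) t 1 by exact: (@derivableV _ _ id).
  apply: (is_derive_eq (is_derive_comp (dG _) dV)).
  rewrite (@deriveV _ _ id)// derive_id !hornerE /GRing.scale/= expr2 exprVn.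
  by field.
- have [C HC] := flat_le ('X * q).
  have C0 : 0 <= C by have := HC 1; rewrite normr1 mulr1; exact: le_trans.
  rewrite [X in is_derive _ _ _ X]/flat ltxx.
  have cv : (fun h : R => h^-1 *: ((flat q \o shift 0) (h *: 1) - flat q 0)) @ 0^' --> (0 : R).
    have E : forall h : R, h != 0 ->
        h^-1 *: ((flat q \o shift 0) (h *: 1) - flat q 0) = flat ('X * q) h.
      move=> h h0; rewrite /= addr0 /flat ltxx subr0 [_ *: 1]mulr1.
      case: ifPn => [_|]; last by rewrite scaler0.
      by rewrite hornerM hornerX /GRing.scale/= mulrA.
    apply/cvgr0Pnorm_lt => e e0; near=> h.
    have h0 : h != 0 by near: h; exact: nbhs_dnbhs_neq.
    rewrite E//; apply: (le_lt_trans (HC h)).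
    apply: (@le_lt_trans _ _ ((C + 1) * `|h|)).
      by rewrite ler_wpM2r// lerDl.
    rewrite -ltr_pdivlMl; last by lra.
    near: h; apply: dnbhs0_lt; apply: mulr_gt0 => //; rewrite invr_gt0; lra.
  apply: DeriveDef; first by apply/cvg_ex; exists 0.
  exact: cvg_lim.
Unshelve. all: by end_near. Qed.

Lemma smooth_flat n (f : 'rV[R]_n -> R) : smooth f -> smooth (fun x => flat 1 (f x)).
Proof.
move=> Cf k; apply: (@class_C_comp _ _ [set G | exists q, G = flat q] k (flat 1)) => //.
  move=> _ [q ->]; exists (flat ('X^2 * (q - q^`()))); first by eexists.
  exact: is_derive_flat.
by exists 1.
Qed.

Lemma flat_gt0 t : 0 < t -> 0 < flat 1 t.
Proof. by move=> t0; rewrite /flat t0 hornerC mul1r expR_gt0. Qed.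

Lemma flat_eq0 t : t <= 0 -> flat 1 t = 0.
Proof. by move=> t0; rewrite /flat ltNge t0. Qed.

Lemma flat_ge0 t : 0 <= flat 1 t.
Proof. by have [/flat_eq0 ->//|/flat_gt0/ltW] := leP t 0. Qed.

Lemma flat_le1 t : flat 1 t <= 1.
Proof.
have [/flat_eq0 ->//|t0] := leP t 0.
by rewrite /flat t0 hornerC mul1r expR_le1 oppr_le0 invr_ge0 ltW.
Qed.

Lemma cvg_flat t : 0 < t -> flat 1 (m.+1%:R * t) @[m --> \oo] --> (1 : R).
Proof.
move=> t0.
have -> : (fun m => flat 1 (m.+1%:R * t)) = fun m => expR (- (t^-1 * m.+1%:R^-1)).
  by apply/funext => m; rewrite /flat mulr_gt0// hornerC mul1r invfM mulrC.
rewrite -[X in _ --> X](@expR0 R).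
apply: continuous_cvg; first exact: continuous_expR.
rewrite -oppr0; apply: cvgN; rewrite -[X in _ --> X](mulr0 t^-1).
apply: cvgM; first exact: cvg_cst.
exact: cvg_harmonic.
Qed.

Lemma continuous_flat : continuous (flat 1).
Proof. exact: is_derive1_continuous (is_derive_flat 1). Qed.

End bump.

Section smooth_functions.
Context {R : realType} {n : nat}.
Implicit Types (f g : 'rV[R]_n -> R) (x : 'rV[R]_n) (D : set 'rV[R]_n).
Implicit Types (a b : 'I_n -> R).

Lemma smooth_cst (c : R) : smooth (cst c : 'rV[R]_n -> R).
Proof. by move=> k; exact: class_C_cst. Qed.

Lemma smoothD f g : smooth f -> smooth g -> smooth (fun x => f x + g x).
Proof. by move=> Cf Cg k; exact: class_C_D. Qed.

Lemma smoothM f g : smooth f -> smooth g -> smooth (fun x => f x * g x).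
Proof. by move=> Cf Cg k; exact: class_C_M. Qed.

Lemma smoothN f : smooth f -> smooth (fun x => - f x).
Proof.
move=> Cf; have -> : (fun x => - f x) = fun x => cst (-1) x * f x.
  by apply/funext => x; rewrite mulN1r.
by apply: smoothM => //; exact: smooth_cst.
Qed.

Lemma smooth_coord (i : 'I_n) : smooth (fun x : 'rV[R]_n => x ord0 i).
Proof. by move=> k; exact: class_C_coord. Qed.

Lemma smooth_prod (I : Type) (s : seq I) (f : I -> 'rV[R]_n -> R) :
  (forall i, smooth (f i)) -> smooth (fun x => \prod_(i <- s) f i x).
Proof. by move=> Cf k; apply: class_C_prod => i; exact: Cf. Qed.

Lemma smoothX f m : smooth f -> smooth (fun x => f x ^+ m).
Proof.
move=> Cf; have -> : (fun x => f x ^+ m) = fun x => \prod_(i < m) f x.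
  by apply/funext => x; rewrite prodr_const card_ord.
exact: smooth_prod.
Qed.

Lemma smooth_continuous f : smooth f -> continuous f.
Proof. by move=> /(_ 0%N)[]. Qed.

Lemma smooth_derivable f i x : smooth f -> derivable f x (delta_mx ord0 i).
Proof. by move=> /(_ 1%N)[_ /(_ i)[]]. Qed.

Lemma smooth_partial f i : smooth f -> smooth (partial i f).
Proof. by move=> Cf k; have [_ /(_ i)[]] := Cf k.+1. Qed.

Lemma partialX f i m x : smooth f ->
  partial i (fun x => f x ^+ m) x = m%:R * f x ^+ m.-1 * partial i f x.
Proof.
move=> Cf; have df : derivable f x (delta_mx ord0 i) by exact: smooth_derivable.
have -> : (fun x => f x ^+ m) = f ^+ m.
  by apply/funext => y; elim: m => [//|m IH]; rewrite exprS IH exprS.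
by rewrite /partial deriveX.
Qed.

Lemma test_function_cbox D f a b : smooth f ->
  (forall x, ~ cbox a b x -> f x = 0) -> cbox a b `<=` D -> test_function D f.
Proof.
move=> Cf f0 abD.
have sab : closure [set x | f x != 0] `<=` cbox a b.
  rewrite (closure_id (cbox a b)).1; last exact: closed_cbox.
  by apply: closureS => x /= fx; apply: contrapT => /f0/eqP; exact/negP.
split=> //; last exact: subset_trans abD.
by apply: subclosed_compact sab; [exact: closed_closure|exact: compact_cbox].
Qed.

Lemma test_function0 D f x : test_function D f ->
  ~ closure [set x | f x != 0] x -> f x = 0.
Proof.
move=> _ fx; apply: contrapT => /eqP f0; apply: fx; exact: subset_closure.
Qed.

Lemma test_function_sub D f g : smooth g -> test_function D f ->
  (forall x, ~ closure [set x | f x != 0] x -> g x = 0) -> test_function D g.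
Proof.
move=> Cg [Cf cf fD] g0.
have sub : closure [set x | g x != 0] `<=` closure [set x | f x != 0].
  rewrite [X in _ `<=` X](closure_id _).1; last exact: closed_closure.
  by apply: closureS => x /= gx; apply: contrapT => /g0/eqP; exact/negP.
split=> //; last exact: subset_trans fD.
by apply: subclosed_compact sub => //; exact: closed_closure.
Qed.

Lemma test_functionM D f g : test_function D f -> smooth g ->
  test_function D (fun x => f x * g x).
Proof.
move=> tf Cg; have [Cf _ _] := tf.
apply: (test_function_sub _ tf); first exact: smoothM.
by move=> x /(test_function0 tf) ->; rewrite mul0r.
Qed.

Lemma test_functionZ D f (c : R) : test_function D f ->
  test_function D (fun x => c * f x).
Proof.
move=> tf; have := test_functionM tf (smooth_cst c).
by under eq_fun do rewrite mulrC.
Qed.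

Lemma test_function_partial D f i : test_function D f ->
  test_function D (partial i f).
Proof.
move=> tf; have [Cf _ _] := tf.
apply: (test_function_sub _ tf); first exact: smooth_partial.
move=> x fx; apply: (derive_notin_closed _ _ _ fx); first exact: closed_closure.
by move=> y /(test_function0 tf).
Qed.

Lemma test_functionD D f g : test_function D f -> test_function D g ->
  test_function D (fun x => f x + g x).
Proof.
move=> tf tg; have [Cf cf fD] := tf; have [Cg cg gD] := tg.
set Sf := closure _ in cf fD; set Sg := closure _ in cg gD.
have sub : closure [set x | f x + g x != 0] `<=` Sf `|` Sg.
  rewrite [X in _ `<=` X](closure_id _).1; last by apply: closedU; exact: closed_closure.
  apply: closureS => x /= fgx; apply: contrapT => /not_orP[].
  move=> /(test_function0 tf) fx /(test_function0 tg) gx.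
  by move: fgx; rewrite fx gx addr0 eqxx.
split; first exact: smoothD.
  by apply: subclosed_compact sub; [exact: closed_closure|exact: compactU].
by apply: subset_trans sub _; rewrite subUset.
Qed.

Lemma ler_coord_norm x i : `|x ord0 i| <= `|x|.
Proof.
have /mapP[j Hj ->] : `|x ord0 i| \in [seq `|x k.1 k.2| | k : 'I_1 * 'I_n].
  by apply/mapP; exists (ord0, i) => //=; rewrite mem_enum.
by rewrite [leRHS]/Num.norm /= mx_normrE; apply/bigmax_geP; right => /=; exists j.
Qed.

Lemma test_function_box D f : test_function D f ->
  exists a b, forall x, ~ cbox a b x -> f x = 0.
Proof.
move=> tf; have [_ /compact_bounded[M [_ HM]] _] := tf.
exists (fun=> - (`|M| + 1)), (fun=> `|M| + 1) => x xM; apply: (test_function0 tf) => fx.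
apply: xM => i; rewrite -ler_norml.
apply: (@le_trans _ _ `|x|).
  exact: ler_coord_norm.
by apply: (HM (`|M| + 1)) => //; have := ler_norm M; lra.
Qed.

Lemma test_function_integrable D f : test_function D f ->
  (lebesgue_rV n).-integrable setT (EFin \o f).
Proof.
move=> tf; have [Cf _ _] := tf; have [a [b f0]] := test_function_box tf.
exact: continuous_cbox_integrable (smooth_continuous Cf) f0.
Qed.

Lemma test_function_bounded D f : test_function D f ->
  exists2 M, 0 < M & forall x, `|f x| <= M.
Proof.
move=> tf; have [Cf _ _] := tf; have [a [b f0]] := test_function_box tf.
have : compact (f @` cbox a b).
  apply: continuous_compact; last exact: compact_cbox.
  by apply: continuous_subspaceT; exact: smooth_continuous.
move=> /compact_bounded[M [_ HM]]; exists (`|M| + 1) => [|x].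
  by have := normr_ge0 M; lra.
have [xab|xab] := pselect (cbox a b x); last first.
  by rewrite f0// normr0; have := normr_ge0 M; lra.
by apply: (HM (`|M| + 1)); [have := ler_norm M; lra|exists x].
Qed.

Lemma integral_partial_test D f i : test_function D f ->
  (\int[lebesgue_rV n]_x (partial i f x)%:E = 0)%E.
Proof.
move=> tf; have [Cf _ _] := tf; have [a [b f0]] := test_function_box tf.
apply: (integral_partial0 _ _ _ f0).
- exact: smooth_continuous.
- by move=> x; exact: smooth_derivable.
- exact/smooth_continuous/smooth_partial.
Qed.

(** Two regimes serve: [k] = 1 for a fixed cut-off, and [k] tending to infinity, where the bump
    tends to the indicator of the open box because [flat 1] tends to 1 at infinity and vanishes on
    the nonpositive axis. *)
Definition bump (k : R) a b x :=
  \prod_i flat 1 (k * ((x ord0 i - a i) * (b i - x ord0 i))).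

Lemma smooth_flat_coord (k c d : R) i :
  smooth (fun x => flat 1 (k * ((x ord0 i - c) * (d - x ord0 i)))).
Proof.
apply: smooth_flat; apply: smoothM; first exact: smooth_cst.
apply: smoothM; apply: smoothD; try exact: smooth_cst.
  exact: smooth_coord.
by apply: smoothN; exact: smooth_coord.
Qed.

Lemma smooth_bump k a b : smooth (bump k a b).
Proof. by apply: smooth_prod => i; exact: smooth_flat_coord. Qed.

Lemma bump_ge0 k a b x : 0 <= bump k a b x.
Proof. by apply: prodr_ge0 => i _; exact: flat_ge0. Qed.

Lemma bump_le1 k a b x : bump k a b x <= 1.
Proof.
have -> : (1 : R) = \prod_(i < n) 1 by rewrite big1.
by apply: ler_prod => i _; rewrite flat_ge0 flat_le1.
Qed.

Lemma bump_gt0 k a b x : 0 < k -> obox a b x -> 0 < bump k a b x.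
Proof.
move=> k0 xab; apply: prodr_gt0 => i _; apply: flat_gt0.
by have /andP[? ?] := xab i; rewrite !mulr_gt0// subr_gt0.
Qed.

Lemma bump_eq0 k a b x : 0 < k -> (forall i, a i <= b i) -> ~ obox a b x ->
  bump k a b x = 0.
Proof.
move=> k0 ab xab; have [i xi] : exists i, ~ (a i < x ord0 i < b i) by exact/existsNP.
rewrite /bump (bigD1 i)//= flat_eq0 ?mul0r//.
rewrite pmulr_rle0//; have := ab i; move/negP: xi; rewrite negb_and -!leNgt => /orP[xa|bx] ?.
  by rewrite mulr_le0_ge0// ?subr_le0// subr_ge0 (le_trans xa).
by rewrite mulr_ge0_le0// ?subr_le0// subr_ge0 (le_trans _ bx).
Qed.

Lemma bump_test D k a b : 0 < k -> (forall i, a i <= b i) -> cbox a b `<=` D ->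
  test_function D (bump k a b).
Proof.
move=> k0 ab abD; apply: test_function_cbox abD; first exact: smooth_bump.
by move=> x xab; apply: bump_eq0 => // /sub_obox_cbox.
Qed.

Lemma cvg_bump a b x : (forall i, a i <= b i) ->
  bump m.+1%:R a b x @[m --> \oo] --> (\1_(obox a b) x : R).
Proof.
move=> ab; rewrite indicE; case: (boolP (x \in obox a b)) => xab; last first.
  apply: cvg_near_cst; apply: nearW => m; apply: bump_eq0 => //.
  by move=> h; move/negP: xab; apply; rewrite inE.
rewrite inE in xab.
have -> : (true%:R : R) = \prod_(i < n) 1 by rewrite big1.
rewrite /bump; elim: (index_enum _) => [|i s IH].
  rewrite big_nil; under eq_fun do rewrite big_nil.
  exact: cvg_cst.
rewrite big_cons; under eq_fun do rewrite big_cons.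
apply: cvgM => //; apply: cvg_flat.
by have /andP[? ?] := xab i; rewrite !mulr_gt0// subr_gt0.
Qed.

End smooth_functions.

(** * Smooth steps of one variable *)

Section smooth_step.
Context {R : realType}.
Local Notation lam := (@lebesgue_measure R).

(** The primitive of a bump comes from an integral, without a formula, so its smoothness is read off
    from that of its derivative. *)
Lemma smooth_primitive_coord n (A b : R -> R) (i : 'I_n) :
  (forall t, is_derive t (1 : R) A (b t)) ->
  smooth (fun x : 'rV[R]_n => b (x ord0 i)) ->
  smooth (fun x : 'rV[R]_n => A (x ord0 i)).
Proof.
move=> dA Cb; have cA := is_derive1_continuous dA.
have Ci : smooth (fun x : 'rV[R]_n => x ord0 i) by exact: smooth_coord.
have dAi (x v : 'rV[R]_n) : derivable (fun x : 'rV[R]_n => A (x ord0 i)) x v.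
  have [dx _] := is_derive_coord i x v.
  by have [] := is_derive_comp (dA (x ord0 i)) dx.
have cAi : continuous (fun x : 'rV[R]_n => A (x ord0 i)).
  by move=> x; apply: continuous_comp; [exact: coord_continuous|exact: cA].
case=> [|k]; first by split.
split=> // j; split=> [x|]; first exact: dAi.
have -> : partial j (fun x : 'rV[R]_n => A (x ord0 i)) =
    fun x => b (x ord0 i) * partial j (fun x : 'rV[R]_n => x ord0 i) x.
  apply/funext => x; apply: (partial_comp (f := fun x : 'rV[R]_n => x ord0 i)) => //.
  exact: smooth_derivable.
by apply: class_C_M; [exact: Cb|exact: (smooth_partial _ Ci)].
Qed.

(** [b] is a normalised bump and [A] its primitive. The difference of two such steps has compact
    support and its derivative is a difference of two approximate Dirac masses; this is the test
    function behind [coordinate_lipschitz]. Smoothness is asserted for [b] of a coordinate because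
    [smooth] speaks of functions of row vectors. *)
Lemma exists_smooth_step (lo hi : R) : lo < hi -> exists A b : R -> R,
  [/\ forall t, is_derive t (1 : R) A (b t),
      (forall t, 0 <= b t) /\ (forall t, b t != 0 -> lo < t < hi),
      continuous b /\ (\int[lam]_t (b t)%:E = 1)%E,
      [/\ forall t, t <= lo -> A t = 0, forall t, hi <= t -> A t = 1 &
          forall t, 0 <= A t <= 1] &
      forall n (i : 'I_n), smooth (fun x : 'rV[R]_n => b (x ord0 i))].
Proof.
move=> lohi.
(* The factor 1 only matches the shape of [smooth_flat_coord]. *)
pose b0 t : R := flat 1 (1 * ((t - lo) * (hi - t))).
have b00 t : 0 <= b0 t by exact: flat_ge0.
have b0gt t : lo < t < hi -> 0 < b0 t.
  by move=> /andP[? ?]; apply: flat_gt0; rewrite mul1r mulr_gt0// subr_gt0.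
have b0eq t : ~~ (lo < t < hi) -> b0 t = 0.
  rewrite negb_and -!leNgt => tl; apply: flat_eq0; rewrite mul1r.
  by case/orP: tl => ?; [rewrite mulr_le0_ge0|rewrite mulr_ge0_le0]; rewrite ?subr_le0 ?subr_ge0//; lra.
have cb0 : continuous b0.
  move=> t; apply: (@continuous_comp _ _ _ (fun t => 1 * ((t - lo) * (hi - t))) (flat 1)).
    apply: cvgM; first exact: cvg_cst.
    by apply: cvgM; apply: cvgB; try exact: cvg_cst; exact: cvg_id.
  exact: continuous_flat.
have mb0 : measurable_fun setT b0 by exact: continuous_measurable_fun.
have ib0 : lam.-integrable setT (EFin \o b0).
  have b0E : b0 = b0 \_ (`[lo, hi]%classic).
    apply/funext => t; rewrite patchE; case: ifPn => // /negP tl.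
    apply: b0eq; apply/negP => /andP[l h]; apply: tl.
    by rewrite inE/= in_itv/= !ltW.
  rewrite b0E -restrict_EFin; apply/(integrable_mkcond _ _).1 => //.
  apply: continuous_compact_integrable; first exact: segment_compact.
  exact: continuous_subspaceT.
pose c := fine (\int[lam]_t (b0 t)%:E)%E.
have cE : (\int[lam]_t (b0 t)%:E = c%:E)%E.
  by rewrite fineK//; exact: integrable_fin_num ib0.
(* A null integral would make the nonnegative [b0] vanish almost everywhere, whereas it is positive
   on an interval of positive length. *)
have c0 : 0 < c.
  rewrite lt_neqAle; apply/andP; split; last first.
    by rewrite -lee_fin -cE; apply: integral_ge0 => t _; rewrite lee_fin.
  apply/negP => /eqP c0.
  have /(ae_eq_integral_abs lam measurableT) : (\int[lam]_t `|(b0 t)%:E| = 0)%E.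
    by under eq_integral do rewrite gee0_abs ?lee_fin//; rewrite cE -c0.
  move=> /(_ (measurable_int _ ib0)) /= ae0.
  have : lam.-negligible `]lo, hi[%classic.
    apply: negligibleS ae0 => t /=; rewrite in_itv/= => /b0gt bt h.
    by move: (h I) => -[] /eqP; rewrite gt_eqF.
  move/measure_negligible => /(_ (measurable_itv _)).
  by rewrite [LHS]lebesgue_measure_itv/= lte_fin lohi => -[]; lra.
have ci0 : 0 <= c^-1 by rewrite invr_ge0 ltW.
pose b t := c^-1 * b0 t.
have bge0 t : 0 <= b t by exact: mulr_ge0.
have ib : lam.-integrable setT (EFin \o b).
  by have := integrableZl measurableT c^-1 ib0; apply: eq_integrable.
have mb := measurable_int _ ib.
have b1 : (\int[lam]_t (b t)%:E = 1)%E.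
  under eq_integral do rewrite /b EFinM.
  by rewrite integralZl//= cE -EFinM mulVf// gt_eqF.
have cb : continuous b by move=> t; apply: cvgM; [exact: cvg_cst|exact: cb0].
pose A t := (\int[lam]_(s in `]-oo, t]) b s)%R.
have AE t : (\int[lam]_(s in `]-oo, t]) (b s)%:E = (A t)%:E)%E.
  rewrite /A /Rintegral fineK//; apply: integrable_fin_num => //.
  exact: integrableS ib.
have dA t : is_derive t (1 : R) A (b t).
  have [] := @continuous_FTC1 R b -oo%O t (t + 1) _ _ _ (cb t).
  - by rewrite ltrDl.
  - by apply: integrableS ib.
  - exact: ltNyr.
  - by move=> dAt <-; rewrite derive1E; exact: derivableP.
exists A, b; split=> //.
- split=> // t; apply: contraNT => /b0eq; rewrite /b => ->.
  by rewrite mulr0.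
- split.
  + move=> t tlo; apply/EFin_inj; rewrite -AE integral0_eq// => s /=.
    rewrite in_itv/= => st; rewrite /b b0eq ?mulr0//.
    by rewrite negb_and -leNgt (le_trans st).
  + move=> t hit; apply/EFin_inj; rewrite -AE -b1 [LHS]integral_mkcond.
    apply: eq_integral => s _; rewrite patchE; case: ifPn => // /negP st.
    rewrite /b b0eq ?mulr0// negb_and -!leNgt; apply/orP; right.
    apply: (le_trans hit); rewrite leNgt; apply/negP => st'; apply: st.
    by rewrite inE/= in_itv/= ltW.
  + move=> t; rewrite -2!lee_fin -AE -b1; apply/andP; split.
      by apply: integral_ge0 => s _; rewrite lee_fin.
    by apply: ge0_subset_integral => // s _; rewrite lee_fin.
- move=> n i; have := smoothM (smooth_cst c^-1) (smooth_flat_coord 1 lo hi i).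
  by [].
Qed.

End smooth_step.

(** * Weak gradients and Sobolev functions *)

Section fundamental_lemma.
Context {R : realType} {n : nat}.
Implicit Types (a b : 'I_n -> R) (D : set 'rV[R]_n).
Local Notation mu := (@lebesgue_rV R n).

Definition oboxes : set_system 'rV[R]_n := [set A | exists a b, A = obox a b].

Lemma setI_obox a b a' b' : obox a b `&` obox a' b' =
  obox (fun i => Num.max (a i) (a' i)) (fun i => Num.min (b i) (b' i)).
Proof.
apply/seteqP; split=> [x [xab xab'] i|x xab].
  have /andP[? ?] := xab i; have /andP[? ?] := xab' i.
  by rewrite gt_max lt_min; apply/andP; split; apply/andP.
by split=> i; have := xab i; rewrite gt_max lt_min => /andP[/andP[? ?] /andP[? ?]]; apply/andP.
Qed.

(** Boxes are stable under intersection, so with this equality a Dynkin class that contains them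
    contains every measurable set. Half-spaces are countable unions of boxes, which gives the
    inclusion that is not immediate. *)
Lemma measurable_rVE : @measurable _ 'rV[R]_n = <<s oboxes >>.
Proof.
apply/seteqP; split; last first.
  by apply: smallest_sub => [|_ [a [b ->]]]; [exact: sigma_algebra_measurable|exact: measurable_obox].
apply: smallest_sub; first exact: smallest_sigma_algebra.
have mc (i : 'I_n) : measurable_fun [set: g_sigma_algebraType oboxes]
    (fun x : 'rV[R]_n => x ord0 i : measurableTypeR R).
  apply: (measurability _ (RGenOInfty.measurableE R)) => _ [_ [c ->] <-].
  rewrite setTI.
  have -> : (fun x : 'rV[R]_n => x ord0 i) @^-1` `]c, +oo[%classic =
      \bigcup_m obox (fun j => if j == i then c else - m%:R) (fun=> m%:R).
    apply/seteqP; split=> [x /=|x [m _] /(_ i)]; last first.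
      by rewrite eqxx /= in_itv/= andbT => /andP[].
    rewrite in_itv/= andbT => cx; exists (Num.truncn `|x|).+1 => //= j.
    have : `|x| < (Num.truncn `|x|).+1%:R by exact: truncnS_gt.
    move/(le_lt_trans (ler_coord_norm x j)); rewrite ltr_norml => /andP[l ->].
    by rewrite andbT; case: eqP => // ->.
  apply: bigcup_measurable => m _; apply: sub_sigma_algebra.
  by eexists; eexists.
rewrite -bigcup_seq => A [i _] [B mB <-] /=.
by have := mc i measurableT B mB; rewrite !setTI.
Qed.

(** The bumps of parameter m + 1 are test functions in [D] that are at most 1 and tend to the
    indicator of the box, so dominated convergence applies. *)
Lemma integral_obox_eq0 D (g : 'rV[R]_n -> R) a b :
  (forall psi, test_function D psi ->
    (\int[mu]_(x in D) (g x * psi x)%:E = 0)%E) ->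
  measurable D -> cbox a b `<=` D -> mu.-integrable (cbox a b) (EFin \o g) ->
  (\int[mu]_(x in obox a b) (g x)%:E = 0)%E.
Proof.
move=> g0 mD abD ig.
have [ab|] := pselect (forall i, a i <= b i); last first.
  move=> /existsNP[i /negP]; rewrite -ltNge => ba.
  have -> : obox a b = set0.
    apply/seteqP; split=> // x /(_ i) /andP[h1 h2].
        by have := lt_trans (lt_trans h1 h2) ba; rewrite ltxx.
  by rewrite integral_set0.
have igo : mu.-integrable (obox a b) (EFin \o g).
  apply: (integrableS _ _ _ ig) => //; [exact: measurable_cbox|exact: measurable_obox|].
  exact: sub_obox_cbox.
have mg := measurable_int _ igo.
have mb m : measurable_fun (obox a b) (EFin \o bump m%:R a b).
  apply: measurable_funTS; apply/measurable_EFinP.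
  by apply: continuous_measurable_fun_rV; apply: smooth_continuous; exact: smooth_bump.
pose h_ m x := (g x * bump m.+1%:R a b x)%:E.
have mh m : measurable_fun (obox a b) (h_ m).
  apply: (eq_measurable_fun ((EFin \o g) \* (EFin \o bump m.+1%:R a b))%E).
    by move=> x _; rewrite /h_ EFinM.
  by apply: emeasurable_funM.
have ch : {ae mu, forall x, obox a b x -> h_ ^~ x @ \oo --> (EFin \o g) x}.
  apply: aeW => x xab; apply: cvg_EFin; first by apply: nearW.
  rewrite -[X in _ --> X](mulr1 (g x)); apply: cvgM; first exact: cvg_cst.
  by have := @cvg_bump R n a b x ab; rewrite indicE mem_set.
have dh : {ae mu, forall x m, obox a b x -> (`|h_ m x| <= (abse \o (EFin \o g)) x)%E}.
  apply: aeW => x m xab; rewrite /= lee_fin normrM ler_piMr//.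
  by rewrite ger0_norm ?bump_ge0// bump_le1.
have iag : mu.-integrable (obox a b) (abse \o (EFin \o g)) by exact: integrable_abse.
have [_ _] := dominated_convergence (measurable_obox a b) mh mg ch iag dh.
have E m : (\int[mu]_(x in obox a b) h_ m x = 0)%E.
  rewrite -(g0 (bump m.+1%:R a b)); last exact: bump_test.
  rewrite integral_mkcond [RHS]integral_mkcond; apply: eq_integral => x _.
  rewrite !patchE; case: ifPn => xab.
    rewrite ifT// inE; apply: abD; apply: sub_obox_cbox; rewrite inE in xab; exact: xab.
  by case: ifPn => // _; rewrite bump_eq0 ?mulr0// => h; move/negP: xab; rewrite inE.
rewrite (_ : [sequence _]_n = cst 0%E); last by apply/funext => m; exact: E.
move=> h; apply/esym; apply: cvg_unique h; first exact: ereal_hausdorff.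
exact: cvg_cst.
Qed.

(** Fundamental lemma of the calculus of variations. On each box of a countable cover the integral
    of [g] vanishes over all sub-boxes, hence over all measurable subsets, hence [g] is null almost
    everywhere there. *)
Lemma test_integral_ae_eq0 D (g : 'rV[R]_n -> R) : open D -> in_L1loc D g ->
  (forall psi, test_function D psi ->
    (\int[mu]_(x in D) (g x * psi x)%:E = 0)%E) ->
  {ae mu, forall x, D x -> g x = 0}.
Proof.
move=> oD lg g0; have mD := measurable_open oD.
have [P [a [b [DE abD]]]] := open_bigcup_obox oD.
suff key k : P k -> {ae mu, forall x, obox (a k) (b k) x -> g x = 0}.
  pose N k := [set x | P k /\ ~ (obox (a k) (b k) x -> g x = 0)].
  apply: (@negligibleS _ _ _ mu (\bigcup_k N k)).
    move=> x /= /not_implyP[]; rewrite {1}DE => -[k Pk xk] gx.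
    by exists k => //; split=> // /(_ xk).
  apply: negligible_bigcup => k; have [Pk|Pk] := pselect (P k).
    by apply: negligibleS (key _ Pk) => x [].
  rewrite (_ : N k = set0); first exact: negligible_set0.
  by apply/seteqP; split=> // x [].
move=> Pk; set Q := obox (a k) (b k).
have mQ : measurable Q by exact: measurable_obox.
have ic : mu.-integrable (cbox (a k) (b k)) (EFin \o g).
  by apply: lg; [exact: compact_cbox|exact: abD].
have iQ : mu.-integrable Q (EFin \o g).
  apply: (integrableS _ _ _ ic) => //; [exact: measurable_cbox|].
  exact: sub_obox_cbox.
have boxE a' b' : (\int[mu]_(x in obox a' b' `&` Q) (g x)%:E = 0)%E.
  rewrite setI_obox; set a'' := fun i => _; set b'' := fun i => _.
  have [ab|] := pselect (forall i, a'' i <= b'' i); last first.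
    move=> /existsNP[i /negP]; rewrite -ltNge => ba.
    have -> : obox a'' b'' = set0.
      apply/seteqP; split=> // x /(_ i) /andP[h1 h2].
        by have := lt_trans (lt_trans h1 h2) ba; rewrite ltxx.
    by rewrite integral_set0.
  have sub : cbox a'' b'' `<=` cbox (a k) (b k).
    move=> x xab i; have := xab i; rewrite ge_max le_min.
    by move=> /andP[/andP[_ ->] /andP[_ ->]].
  apply: (integral_obox_eq0 g0 mD); first exact: subset_trans (abD _ Pk).
  apply: (integrableS _ _ sub ic); exact: measurable_cbox.
have QE : (\int[mu]_(x in Q) (g x)%:E = 0)%E by have := boxE (a k) (b k); rewrite setIid.
(* Complements are taken inside [Q], over which the integral of [g] is 0 by [QE]; this makes the
   sets concerned a Dynkin class. *)
have meas A : measurable A -> (\int[mu]_(x in A `&` Q) (g x)%:E = 0)%E.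
  rewrite measurable_rVE; move: A; apply: dynkin_induction.
  - exact: measurable_rVE.
  - by move=> _ _ [a1 [b1 ->]] [a2 [b2 ->]]; rewrite setI_obox; eexists; eexists.
  - by rewrite setTI.
  - by move=> _ [a' [b' ->]]; exact: boxE.
  - move=> S mS S0.
    have : Q = (S `&` Q) `|` (~` S `&` Q) by rewrite -setIUl setUv setTI.
    move=> QU; move: (QE); rewrite {1}QU integral_setU//.
    + by rewrite S0 add0e.
    + exact: measurableI.
    + by apply: measurableI => //; exact: measurableC.
    + by rewrite -QU; exact: measurable_int iQ.
    + by rewrite disj_set2E; apply/eqP; rewrite setIACA setICr set0I.
  - move=> F mF tF F0; rewrite setI_bigcupl integral_bigcup.
    + by apply: eseries0 => k' _ _; exact: F0.
    + by apply: trivIset_setIr.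
    + by move=> k'; exact: measurableI.
    + apply: (integrableS _ _ _ iQ) => //.
        by apply: bigcup_measurable => k' _; exact: measurableI.
      by move=> x [k' _ []].
have [/= ] : ae_eq mu Q (EFin \o g) (cst 0%E).
  apply: integral_ae_eq => // E EQ mE.
  by rewrite integral0 -(setIidl EQ); exact: meas.
move=> B [mB B0 HB]; exists B; split=> // x /= h; apply: HB => /= h'; apply: h => xQ.
by have [] := h' xQ.
Qed.

End fundamental_lemma.

(** * The Euclidean norm *)

Section enorm_theory.
Context {R : realType} {n : nat}.
Implicit Types (x y : 'rV[R]_n).

Lemma enorm_ge0 x : 0 <= enorm x.
Proof. exact: sqrtr_ge0. Qed.

Lemma sqr_enorm x : enorm x ^+ 2 = \sum_i x ord0 i ^+ 2.
Proof. by rewrite sqr_sqrtr// sumr_ge0// => i _; exact: sqr_ge0. Qed.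

Lemma enormZ (c : R) x : enorm (c *: x) = `|c| * enorm x.
Proof.
rewrite /enorm; under eq_bigr do rewrite mxE exprMn.
by rewrite -mulr_sumr sqrtrM ?sqr_ge0// sqrtr_sqr.
Qed.

Lemma enorm0 : enorm (0 : 'rV[R]_n) = 0.
Proof. by rewrite -(scale0r (0 : 'rV[R]_n)) enormZ normr0 mul0r. Qed.

Lemma ler_coord_enorm x i : `|x ord0 i| <= enorm x.
Proof.
rewrite -sqrtr_sqr ler_wsqrtr// (bigD1 i)//= lerDl.
by rewrite sumr_ge0// => j _; exact: sqr_ge0.
Qed.

Lemma enorm_eq0 x : enorm x = 0 -> x = 0.
Proof.
move=> x0; apply/rowP => i; apply/eqP; rewrite mxE -normr_le0 -x0.
exact: ler_coord_enorm.
Qed.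

Lemma cauchy_schwarz x y : \sum_i x ord0 i * y ord0 i <= enorm x * enorm y.
Proof.
have [x0|x0] := eqVneq (enorm x) 0.
  by rewrite x0 mul0r (enorm_eq0 x0) big1// => i _; rewrite mxE mul0r.
have [y0|y0] := eqVneq (enorm y) 0.
  by rewrite y0 mulr0 (enorm_eq0 y0) big1// => i _; rewrite mxE mulr0.
have a0 : 0 < enorm x by rewrite lt_neqAle eq_sym x0 enorm_ge0.
have b0 : 0 < enorm y by rewrite lt_neqAle eq_sym y0 enorm_ge0.
set a := enorm x in a0 *; set b := enorm y in b0 *.
(* Young's inequality coordinate by coordinate; the weights b / a and a / b make both sums equal to
   a b. *)
apply: (@le_trans _ _ (\sum_i (b / a * x ord0 i ^+ 2 + a / b * y ord0 i ^+ 2) / 2)).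
  apply: ler_sum => i _.
  have : 0 <= (b * x ord0 i - a * y ord0 i) ^+ 2 / (a * b).
    by rewrite mulr_ge0 ?sqr_ge0// invr_ge0 mulr_ge0 ?ltW.
  suff -> : (b * x ord0 i - a * y ord0 i) ^+ 2 / (a * b) =
    b / a * x ord0 i ^+ 2 + a / b * y ord0 i ^+ 2 - 2 * (x ord0 i * y ord0 i) by lra.
  by field; rewrite !gt_eqF.
rewrite -mulr_suml big_split/= -!mulr_sumr -!sqr_enorm -/a -/b.
suff -> : (b / a * a ^+ 2 + a / b * b ^+ 2) / 2 = a * b by [].
by field; rewrite !gt_eqF.
Qed.

Lemma ler_enormD x y : enorm (x + y) <= enorm x + enorm y.
Proof.
have xy0 : 0 <= enorm x + enorm y by rewrite addr_ge0 ?enorm_ge0.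
rewrite -(ger0_norm (enorm_ge0 (x + y))) -(ger0_norm xy0) -ler_sqr ?normr_nneg//.
rewrite !real_normK ?num_real// sqr_enorm sqrrD !sqr_enorm.
under eq_bigr do rewrite mxE sqrrD.
rewrite !big_split/= lerD2r lerD2l.
by rewrite mulr2n lerD// cauchy_schwarz.
Qed.

Lemma ler_enorm_sum x : enorm x <= \sum_i `|x ord0 i|.
Proof.
have [->|e0] := eqVneq (enorm x) 0; first exact: sumr_ge0.
have ep : 0 < enorm x by rewrite lt_neqAle eq_sym e0 enorm_ge0.
rewrite -(ler_pM2r ep) -expr2 sqr_enorm mulr_suml; apply: ler_sum => i _.
by rewrite -real_normK ?num_real// expr2 ler_wpM2l// ler_coord_enorm.
Qed.

Lemma continuous_enorm : continuous (@enorm R n).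
Proof.
have cs (s : seq 'I_n) : smooth (fun x : 'rV[R]_n => \sum_(i <- s) x ord0 i ^+ 2).
  elim: s => [|i s IH].
    rewrite (_ : (fun _ => _) = cst 0); first exact: smooth_cst.
    by apply/funext => y; rewrite big_nil.
  rewrite (_ : (fun _ => _) = fun y : 'rV[R]_n => y ord0 i ^+ 2 + \sum_(j <- s) y ord0 j ^+ 2).
    by apply: smoothD => //; apply: smoothX; exact: smooth_coord.
  by apply/funext => y; rewrite big_cons.
move=> x; apply: (@continuous_comp _ _ _ _ Num.sqrt); first exact: smooth_continuous (cs _) _.
exact: sqrt_continuous.
Qed.

Lemma measurable_enorm m (D : set 'rV[R]_m) (f : 'rV[R]_m -> 'rV[R]_n) :
  (forall i, measurable_fun D (fun x : 'rV[R]_m => f x ord0 i)) ->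
  measurable_fun D (fun x : 'rV[R]_m => enorm (f x)).
Proof.
move=> mf; apply: (@measurableT_comp _ _ _ _ _ _ (@Num.sqrt R)).
  by apply: continuous_measurable_fun; exact: sqrt_continuous.
by apply: measurable_sum => i; apply: measurable_funX; exact: mf.
Qed.

End enorm_theory.

(** * L^p norms on a measurable set *)

Section norm_L_theory.
Context {R : realType} {n : nat}.
Variables (D : set 'rV[R]_n) (p : R).
Hypotheses (mD : measurable D) (p1 : 1 <= p).
Implicit Types (f g : 'rV[R]_n -> R).
Local Notation mu := (@lebesgue_rV R n).

Let p0 : 0 < p. Proof. exact: lt_le_trans p1. Qed.

Lemma norm_L_poweR f :
  (norm_L D p%:E f `^ p = \int[mu]_(x in D) (`|f x| `^ p)%:E)%E.
Proof.
have pn0 : p != 0 by rewrite gt_eqF.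
rewrite /norm_L (poweR_Lnorm _ _ pn0) [RHS]integral_mkcond.
apply: eq_integral => x _; rewrite /= !patchE; case: ifPn => // _.
by rewrite normr0 powR0// gt_eqF.
Qed.

Lemma norm_L_ltyP f : (norm_L D p%:E f < +oo)%E <->
  (\int[mu]_(x in D) (`|f x| `^ p)%:E < +oo)%E.
Proof.
rewrite -norm_L_poweR; split; first exact: poweR_lty.
by apply: lty_poweRy; rewrite gt_eqF.
Qed.

Lemma norm_L_ge0 s f : (0 <= norm_L D s f)%E.
Proof. exact: Lnorm_ge0. Qed.

Lemma measurable_norm_powR f : measurable_fun D f ->
  measurable_fun D (fun x => (`|f x| `^ p)%:E).
Proof.
move=> mf; apply/measurable_EFinP.
apply: (@measurableT_comp _ _ _ _ _ _ (fun t : R => t `^ p)).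
  exact: measurable_powR.
exact: measurableT_comp.
Qed.

Lemma le_norm_L f g : measurable_fun D f -> measurable_fun D g ->
  {ae mu, forall x, D x -> `|f x| <= `|g x|} ->
  (norm_L D p%:E f <= norm_L D p%:E g)%E.
Proof.
move=> mf mg fg.
suff : (norm_L D p%:E f `^ p <= norm_L D p%:E g `^ p)%E.
  move=> /(@gt0_ler_poweR _ p^-1).
  rewrite -!poweRrM mulfV ?gt_eqF// !poweRe1 ?norm_L_ge0//; apply.
  - by rewrite invr_ge0 ltW.
  - by rewrite in_itv/= leey andbT poweR_ge0.
  - by rewrite in_itv/= leey andbT poweR_ge0.
rewrite !norm_L_poweR; apply: ae_ge0_le_integral => //.
- exact: measurable_norm_powR.
- exact: measurable_norm_powR.
- apply: filterS fg => x h Dx; rewrite lee_fin.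
  by apply: ge0_ler_powR => //; [exact: ltW|exact: h].
Qed.

Lemma eq_norm_L f g : measurable_fun D f -> measurable_fun D g ->
  {ae mu, forall x, D x -> f x = g x} -> norm_L D p%:E f = norm_L D p%:E g.
Proof.
move=> mf mg fg; apply/eqP; rewrite eq_le; apply/andP; split; apply: le_norm_L => //;
  by apply: filterS fg => x h Dx; rewrite h.
Qed.

Lemma norm_LD f g : measurable_fun D f -> measurable_fun D g ->
  (norm_L D p%:E (fun x => (f x + g x)%R) <= norm_L D p%:E f + norm_L D p%:E g)%E.
Proof.
move=> mf mg.
have := @minkowski_EFin _ _ _ mu (f \_ D) (g \_ D) p.
rewrite /norm_L => /(_ ((measurable_restrictT _ mD).1 mf) ((measurable_restrictT _ mD).1 mg) p1).
congr (_ <= _)%E; congr Lnorm; apply/funext => x /=.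
by rewrite !patchE; case: ifPn => // _; rewrite addr0.
Qed.

Lemma norm_LZ (c : R) f : measurable_fun D f ->
  (norm_L D p%:E (fun x => (c * f x)%R) = `|c|%:E * norm_L D p%:E f)%E.
Proof.
move=> mf.
suff : (norm_L D p%:E (fun x => (c * f x)%R) `^ p = (`|c|%:E * norm_L D p%:E f) `^ p)%E.
  move/(congr1 (fun z => (z `^ p^-1)%E)).
  rewrite -!poweRrM mulfV ?gt_eqF// !poweRe1 ?norm_L_ge0//.
  by rewrite mule_ge0 ?norm_L_ge0.
rewrite poweRM ?norm_L_ge0// !norm_L_poweR poweR_EFin -ge0_integralZl//.
- by apply: eq_integral => x _; rewrite normrM powRM.
- exact: measurable_norm_powR.
Qed.

Lemma norm_L_leP f (e : R) : 0 <= e -> (norm_L D p%:E f <= e%:E)%E <->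
  (\int[mu]_(x in D) (`|f x| `^ p)%:E <= (e `^ p)%:E)%E.
Proof.
move=> e0; rewrite -norm_L_poweR -poweR_EFin; split.
  apply: gt0_ler_poweR; first exact: ltW.
  - by rewrite in_itv/= leey andbT norm_L_ge0.
  - by rewrite in_itv/= leey andbT lee_fin.
move=> /(@gt0_ler_poweR _ p^-1).
rewrite -!poweRrM mulfV ?gt_eqF// !poweRe1 ?norm_L_ge0 ?lee_fin//; apply.
- by rewrite invr_ge0 ltW.
- by rewrite in_itv/= leey andbT ?poweR_ge0 ?lee_fin ?powR_ge0.
- by rewrite in_itv/= leey andbT ?poweR_ge0 ?lee_fin ?powR_ge0.
Qed.

Lemma measurable_norm f : measurable_fun D f -> measurable_fun D (fun x => `|f x|).
Proof. by move=> mf; exact: measurableT_comp. Qed.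

Lemma le_norm_L_add f g (h : 'rV[R]_n -> R) (c d : R) : 0 <= c -> 0 <= d ->
  measurable_fun D f -> measurable_fun D g -> measurable_fun D h ->
  {ae mu, forall x, D x -> `|f x| <= c * `|g x| + d * `|h x|} ->
  (norm_L D p%:E f <= c%:E * norm_L D p%:E g + d%:E * norm_L D p%:E h)%E.
Proof.
move=> c0 d0 mf mg mh fgh.
have mcg : measurable_fun D (fun x => c * `|g x|).
  by apply: measurable_funM => //; exact: measurable_norm.
have mdh : measurable_fun D (fun x => d * `|h x|).
  by apply: measurable_funM => //; exact: measurable_norm.
have nE (k : 'rV[R]_n -> R) : norm_L D p%:E (fun x => `|k x|) = norm_L D p%:E k.
  rewrite /norm_L -[RHS]Lnorm_abse; congr Lnorm; apply/funext => x /=.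
  by rewrite !patchE; case: ifPn => //; rewrite normr0.
apply: (@le_trans _ _ (norm_L D p%:E (fun x => c * `|g x| + d * `|h x|)%R)).
  apply: le_norm_L => //; first exact: measurable_funD.
  by apply: filterS fgh => x h' Dx; rewrite [leRHS]ger0_norm ?h'// addr_ge0// mulr_ge0.
apply: le_trans (norm_LD mcg mdh) _.
rewrite !norm_LZ; try exact: measurable_norm.
by rewrite !nE !ger0_norm.
Qed.

End norm_L_theory.

(** * Weak gradients *)

Section weak_gradient_theory.
Context {R : realType} {n : nat}.
Implicit Types (D : set 'rV[R]_n) (u v phi psi : 'rV[R]_n -> R).
Implicit Types (g h : 'rV[R]_n -> 'rV[R]_n).
Local Notation mu := (@lebesgue_rV R n).

Definition grad phi : 'rV[R]_n -> 'rV[R]_n := fun x => \row_i partial i phi x.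

Lemma integrableM_test D u psi : measurable D -> in_L1loc D u ->
  test_function D psi -> mu.-integrable D (fun x => (u x * psi x)%:E).
Proof.
move=> mD lu tpsi; have [Cpsi cK KD] := tpsi; set K := closure _ in cK KD.
have mK : measurable K by apply: measurable_closed; exact: closed_closure.
have iK := lu K cK KD.
have [M M0 psiM] := test_function_bounded tpsi.
have mpsi : measurable_fun K psi.
  by apply: measurable_funTS; apply: continuous_measurable_fun_rV; exact: smooth_continuous.
have muK : measurable_fun K u by apply/measurable_EFinP; exact: measurable_int iK.
have iKup : mu.-integrable K (fun x => (u x * psi x)%:E).
  apply: (@le_integrable _ _ _ mu K mK _ (fun x => (M%:E * (u x)%:E)%E)).
  - by apply/measurable_EFinP; exact: measurable_funM.
  - move=> x _; rewrite lee_fin !normrM mulrC ler_wpM2r// (ger0_norm (ltW M0)).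
    exact: psiM.
  - exact: integrableZl.
apply/(integrable_mkcond _ mD).
rewrite (_ : _ \_ D = (fun x => (u x * psi x)%:E) \_ K).
  exact/(integrable_mkcond _ mK).
apply/funext => x; rewrite !patchE; case: ifPn => xD.
  case: ifPn => // /negP xK; rewrite (test_function0 tpsi) ?mulr0// => h.
  by apply: xK; rewrite inE.
rewrite ifF//; apply/negbTE; apply: contra xD; rewrite !inE; exact: KD.
Qed.

Lemma test_in_L1loc D phi : test_function D phi -> in_L1loc D phi.
Proof.
move=> tphi K cK KD; apply: (integrableS _ _ (@subsetT _ K)) => //.
  exact: measurable_compact.
exact: test_function_integrable tphi.
Qed.

(** Integration by parts amounts to the vanishing of the integral of the i-th partial derivative of
    phi psi, which is again a test function. *)
Lemma is_weak_gradient_test D phi : measurable D -> test_function D phi ->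
  is_weak_gradient D phi (grad phi).
Proof.
move=> mD tphi; split=> [|i]; first exact: test_in_L1loc.
have tdphi := test_function_partial i tphi.
have gE : (fun x => grad phi x ord0 i) = partial i phi.
  by apply/funext => x; rewrite mxE.
rewrite gE; split=> [|psi tpsi]; first exact: test_in_L1loc.
have [Cphi _ _] := tphi; have [Cpsi _ _] := tpsi.
have tdpsi := test_function_partial i tpsi.
have i1 := integrableM_test mD (test_in_L1loc tphi) tdpsi.
have i2 := integrableM_test mD (test_in_L1loc tdphi) tpsi.
have t12 := test_functionM tphi Cpsi.
have E : (\int[mu]_(x in D) ((phi x * partial i psi x)%:E + (partial i phi x * psi x)%:E) = 0)%E.
  rewrite -(integral_partial_test i t12) integral_mkcond; apply: eq_integral => x _.
  rewrite patchE partialM; try exact: smooth_derivable.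
  case: ifPn => // xD; rewrite (test_function0 tphi) ?(test_function0 tdphi) ?mul0r ?addr0//.
    by move=> h; move/negP: xD; apply; rewrite inE; have [_ _] := tdphi; apply.
  by move=> h; move/negP: xD; apply; rewrite inE; have [_ _] := tphi; apply.
move: E; rewrite integralD//.
have f1 := integrable_fin_num mD i1; have f2 := integrable_fin_num mD i2.
have -> : (\int[mu]_(x in D) (grad phi x ord0 i * psi x)%:E =
    \int[mu]_(x in D) (partial i phi x * psi x)%:E)%E.
  by apply: eq_integral => x _; rewrite mxE.
rewrite -(fineK f1) -(fineK f2) -EFinD -EFinN => -[] h; congr EFin.
by apply/eqP; rewrite -addr_eq0 h.
Qed.

Lemma is_weak_gradient_lin D u v g h (c d : R) : measurable D ->
  is_weak_gradient D u g -> is_weak_gradient D v h ->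
  is_weak_gradient D (fun x => c * u x + d * v x) (fun x => c *: g x + d *: h x).
Proof.
move=> mD [lu ug] [lv vh].
have lin (u1 u2 : 'rV[R]_n -> R) : in_L1loc D u1 -> in_L1loc D u2 ->
    in_L1loc D (fun x => c * u1 x + d * u2 x).
  move=> l1 l2 K cK KD.
  have mK : measurable K.
    exact: measurable_compact.
  have := integrableD mK (integrableZl mK c (l1 K cK KD)) (integrableZl mK d (l2 K cK KD)).
  exact: eq_integrable.
split=> [|i]; first exact: lin.
have [lgi gi] := ug i; have [lhi hi] := vh i.
have E : (fun x => (c *: g x + d *: h x) ord0 i) =
    (fun x => c * g x ord0 i + d * h x ord0 i).
  by apply/funext => x; rewrite !mxE.
rewrite E; split=> [|psi tpsi]; first exact: lin.
have tdpsi := test_function_partial i tpsi.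
have split (u1 u2 w : 'rV[R]_n -> R) : in_L1loc D u1 -> in_L1loc D u2 ->
    test_function D w ->
    (\int[mu]_(x in D) ((c * u1 x + d * u2 x) * w x)%:E =
     c%:E * \int[mu]_(x in D) (u1 x * w x)%:E +
     d%:E * \int[mu]_(x in D) (u2 x * w x)%:E)%E.
  move=> l1 l2 tw.
  have i1 := integrableM_test mD l1 tw; have i2 := integrableM_test mD l2 tw.
  rewrite -!integralZl// -integralD//; try exact: integrableZl.
  by apply: eq_integral => x _; rewrite -!EFinM -EFinD; congr EFin; ring.
rewrite split// (gi _ tpsi) (hi _ tpsi).
under [in RHS]eq_integral => x _.
  rewrite (_ : (c *: g x + d *: h x) ord0 i = c * g x ord0 i + d * h x ord0 i); last by rewrite !mxE.
  over.
rewrite split//.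
have f1 := integrable_fin_num mD (integrableM_test mD lgi tpsi).
have f2 := integrable_fin_num mD (integrableM_test mD lhi tpsi).
rewrite -(fineK f1) -(fineK f2); set X := fine _; set Y := fine _.
have XY : c * - X + d * - Y = - (c * X + d * Y) by ring.
exact: (congr1 EFin XY).
Qed.

Lemma is_weak_gradient_unique D u g h : open D ->
  is_weak_gradient D u g -> is_weak_gradient D u h ->
  {ae mu, forall x, D x -> g x = h x}.
Proof.
move=> oD [lu ug] [_ uh]; have mD := measurable_open oD.
have key i : {ae mu, forall x, D x -> g x ord0 i - h x ord0 i = 0}.
  have [lg gi] := ug i; have [lh hi] := uh i.
  apply: test_integral_ae_eq0 => // [|psi tpsi].
    move=> K cK KD.
    have mK : measurable K.
      exact: measurable_compact.
    by have := integrableB mK (lg K cK KD) (lh K cK KD); exact: eq_integrable.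
  have i1 := integrableM_test mD lg tpsi; have i2 := integrableM_test mD lh tpsi.
  have := gi _ tpsi; rewrite (hi _ tpsi) => /oppe_inj e.
  under eq_integral do rewrite mulrBl EFinB.
  by rewrite integralB// e subee//; exact: integrable_fin_num.
have : {ae mu, forall x, forall i : 'I_n, D x -> g x ord0 i - h x ord0 i = 0}.
  exact: filter_forall.
apply: filterS => x gh Dx; apply/rowP => i; apply/eqP; rewrite -subr_eq0; apply/eqP.
exact: gh.
Qed.

Lemma weak_gradientP D u g : is_weak_gradient D u g ->
  is_weak_gradient D u (weak_gradient D u).
Proof. by move=> ug; apply: (@xgetPex _ _ [set g | is_weak_gradient D u g]); exists g. Qed.

(** Countably many boxes with compact closure in [D] cover it, and integrability on each of them
    carries measurability. *)
Lemma in_L1loc_measurable D u : open D -> in_L1loc D u -> measurable_fun D u.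
Proof.
move=> oD lu; have [P [a [b [DE abD]]]] := open_bigcup_obox oD.
pose E k := if `[< P k >] then obox (a k) (b k) else set0.
have -> : D = \bigcup_k E k.
  rewrite DE; apply/seteqP; split=> [x [k Pk xk]|x [k _]].
    by exists k => //; rewrite /E asboolT.
  by rewrite /E; case: asboolP => // Pk xk; exists k.
apply/measurable_fun_bigcup => k.
  by rewrite /E; case: asboolP => // Pk; exact: measurable_obox.
rewrite /E; case: asboolP => Pk; last exact: measurable_fun_set0.
have := lu _ (@compact_cbox _ _ (a k) (b k)) (abD _ Pk).
move=> /measurable_int/measurable_EFinP; apply: measurable_funS.
  exact: measurable_cbox.
exact: sub_obox_cbox.
Qed.

Lemma is_weak_gradient_measurable D u g : open D -> is_weak_gradient D u g ->
  measurable_fun D (fun x => enorm (g x)).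
Proof.
move=> oD [_ ug]; apply: measurable_enorm => i.
by apply: in_L1loc_measurable => //; have [] := ug i.
Qed.

(** [weak_gradient] is an arbitrary choice made by [xget]; by almost everywhere uniqueness, any
    explicit weak gradient computes the same norm. *)
Lemma norm_gradE D (p : R) u g : open D -> 1 <= p -> is_weak_gradient D u g ->
  norm_grad D p%:E u = norm_L D p%:E (fun x => enorm (g x)).
Proof.
move=> oD p1 ug; have wu := weak_gradientP ug.
apply: eq_norm_L => //; first exact: measurable_open.
- exact: is_weak_gradient_measurable wu.
- exact: is_weak_gradient_measurable ug.
- by have := is_weak_gradient_unique oD wu ug; apply: filterS => x h Dx; rewrite h.
Qed.

End weak_gradient_theory.

(** * Extremals and their competitors *)

Section extremals.
Context {R : realType} {n : nat}.
Implicit Types (D A : set 'rV[R]_n) (f u phi : 'rV[R]_n -> R).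
Local Notation mu := (@lebesgue_rV R n).

Lemma ae_open_exists A (P : 'rV[R]_n -> Prop) : open A -> A !=set0 ->
  {ae mu, forall x, A x -> P x} -> exists2 x, A x & P x.
Proof.
move=> oA A0 aeP; apply: contrapT => nP.
have : mu.-negligible A.
  by apply: negligibleS aeP => x Ax /= h; apply: nP; exists x => //; exact: h.
move=> /measure_negligible => /(_ (measurable_open oA)) muA.
by have := open_lebesgue_gt0 oA A0; rewrite muA ltxx.
Qed.

Let muT : (0 < mu [set: 'rV[R]_n])%E.
Proof. by apply: open_lebesgue_gt0; [exact: openT|exists 0]. Qed.

Lemma norm_LyP D f (C : R) : 0 <= C ->
  (norm_L D +oo f <= C%:E)%E <-> {ae mu, forall x, D x -> `|f x| <= C}.
Proof.
move=> C0; rewrite /norm_L unlock /= muT; split.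
  move/ess_supP; apply: filterS => x /= + Dx.
  by rewrite lee_fin patchE mem_set.
move=> h; apply/ess_supP; apply: filterS h => x /= fx.
by rewrite lee_fin patchE; case: ifPn; rewrite ?inE ?normr0.
Qed.

Lemma norm_LyZ D f (c : R) : 0 <= c ->
  norm_L D +oo (fun x => c * f x) = (c%:E * norm_L D +oo f)%E.
Proof.
move=> c0; rewrite /norm_L unlock /= muT -ess_supZl//.
congr (ess_sup _ _); apply/funext => x /=; rewrite !patchE.
case: ifPn => _; last by rewrite normr0 -EFinM mulr0.
by rewrite normrM (ger0_norm c0) EFinM.
Qed.

Lemma open_within_continuous D f x : open D -> {within closure D, continuous f} ->
  D x -> {for x, continuous f}.
Proof.
move=> oD cf Dx.
have : {within D, continuous f} by apply: continuous_subspaceW cf; exact: subset_closure.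
by rewrite continuous_open_subspace// => /(_ x); apply; rewrite inE.
Qed.

(** If f x > C, then f > C on a nonempty open set, which has positive measure. *)
Lemma ae_le_continuous D f (C : R) x : open D -> D x -> {for x, continuous f} ->
  {ae mu, forall y, D y -> `|f y| <= C} -> f x <= C.
Proof.
move=> oD Dx cf aeC; rewrite leNgt; apply/negP => Cfx.
have nb : nbhs x (D `&` [set y | C < f y]).
  apply: filterI; first exact: open_nbhs_nbhs.
  exact: (cf [set t | C < t] (lt_nbhsr Cfx)).
pose A := (D `&` [set y | C < f y])°.
have oA : open A by exact: open_interior.
have A0 : A !=set0 by exists x.
have aeA : {ae mu, forall y, A y -> `|f y| <= C}.
  by apply: filterS aeC => y h /interior_subset[/h].
have [y Ay] := ae_open_exists oA A0 aeA.
have [_ /= Cfy] := interior_subset Ay.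
by move/(le_trans (ler_norm _)); rewrite leNgt Cfy.
Qed.

Definition cvg_norm_L D (p : R) (f : nat -> 'rV[R]_n -> R) :=
  forall e : R, 0 < e -> \forall k \near \oo, (norm_L D p%:E (f k) <= e%:E)%E.

Lemma is_weak_gradientD_test D u phi g (c d : R) : measurable D ->
  is_weak_gradient D u g -> test_function D phi ->
  is_weak_gradient D (fun x => c * u x + d * phi x)
    (fun x => c *: g x + d *: grad phi x).
Proof.
by move=> mD ug tphi; apply: is_weak_gradient_lin => //; exact: is_weak_gradient_test.
Qed.

Lemma W10_approx D (p : R) u : open D -> 1 <= p -> W10 D p u ->
  exists phi : nat -> 'rV[R]_n -> R, [/\ forall k, test_function D (phi k),
    cvg_norm_L D p (fun k x => u x - phi k x) &
    cvg_norm_L D p (fun k x => enorm (weak_gradient D u x - grad (phi k) x))].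
Proof.
move=> oD p1 [[_ wu _] [phi [tphi cphi]]]; have mD := measurable_open oD.
have E k : norm_W1 D p%:E (u \- phi k) = (norm_L D p%:E (fun x => (u x - phi k x)%R) +
    norm_L D p%:E (fun x => enorm (weak_gradient D u x - grad (phi k) x)%R))%E.
  rewrite /norm_W1; congr (_ + _)%E.
  rewrite (@norm_gradE _ _ _ _ _ (fun x => weak_gradient D u x - grad (phi k) x))//.
  have := is_weak_gradientD_test 1 (-1) mD wu (tphi k).
  congr (is_weak_gradient _ _ _); apply/funext => x /=.
    by rewrite mul1r mulN1r.
  by rewrite scale1r scaleN1r.
have near_le (e : R) : 0 < e -> \forall k \near \oo, (norm_W1 D p%:E (u \- phi k)%R <= e%:E)%E.
  move=> e0; have := cphi [set z | (z <= e%:E)%E].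
  apply; have : nbhs (0 : R) [set r : R | (r%:E <= e%:E)%E].
    by apply: filterS (lt_nbhsl e0) => r /ltW.
  exact.
exists phi; split=> // e e0; apply: filterS (near_le e e0) => k; rewrite E.
  by apply: le_trans; rewrite leeDl// norm_L_ge0.
by apply: le_trans; rewrite leeDr// norm_L_ge0.
Qed.

Lemma norm_L_bounded_lty D (p : R) f (M : R) : measurable D -> 1 <= p ->
  (mu D < +oo)%E -> measurable_fun D f -> (forall x, D x -> `|f x| <= M) ->
  (norm_L D p%:E f < +oo)%E.
Proof.
move=> mD p1 muD mf fM; apply/norm_L_ltyP => //.
apply: (@le_lt_trans _ _ (\int[mu]_(x in D) (M `^ p)%:E)%E).
  apply: ge0_le_integral => //.
  - exact: measurable_norm_powR.
  - move=> x Dx; rewrite lee_fin; apply: ge0_ler_powR; rewrite ?nnegrE ?fM//.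
      by rewrite (le_trans _ p1).
    by rewrite (le_trans _ (fM _ Dx)).
by rewrite integral_cst// lte_mul_pinfty ?lee_fin ?powR_ge0.
Qed.

Lemma norm_L_enorm_lty D (p : R) (g : 'rV[R]_n -> 'rV[R]_n) : measurable D -> 1 <= p ->
  (forall i, in_L D p%:E (fun x => g x ord0 i)) ->
  (norm_L D p%:E (fun x => enorm (g x)) < +oo)%E.
Proof.
move=> mD p1 gi.
have mgi i : measurable_fun D (fun x => `|g x ord0 i|).
  by apply: measurable_norm; have [] := gi i.
have S (s : seq 'I_n) : (norm_L D p%:E (fun x => \sum_(i <- s) `|g x ord0 i|)%R < +oo)%E.
  elim: s => [|i s IH].
    rewrite (_ : (fun _ => _) = cst 0); last by apply/funext => x; rewrite big_nil.
    apply/norm_L_ltyP => //; rewrite integral0_eq// => x _.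
    by rewrite normr0 powR0// gt_eqF// (lt_le_trans _ p1).
  rewrite (_ : (fun _ => _) = fun x => `|g x ord0 i| + \sum_(i <- s) `|g x ord0 i|); last first.
    by apply/funext => x; rewrite big_cons.
  apply: le_lt_trans (norm_LD mD p1 _ _) _; [exact: mgi|exact: measurable_sum|].
  rewrite lte_add_pinfty//; have [mg] := gi i; apply: le_lt_trans.
  apply: (le_norm_L mD p1 (mgi i) mg).
  by apply: aeW => x _; rewrite normr_id.
apply: le_lt_trans (S (index_enum _)); apply: le_norm_L => //.
- by apply: measurable_enorm => i; have [] := gi i.
- exact: measurable_sum.
apply: aeW => x _; rewrite ger0_norm ?enorm_ge0// ger0_norm ?sumr_ge0//.
exact: ler_enorm_sum.
Qed.

Lemma le_norm_L_scale D (p : R) f (c : R) : measurable D -> 1 <= p -> 0 <= c <= 1 ->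
  measurable_fun D f -> (norm_L D p%:E (fun x => (c * f x)%R) <= norm_L D p%:E f)%E.
Proof.
move=> mD p1 /andP[c0 c1] mf; apply: le_norm_L => //; first exact: measurable_funM.
by apply: aeW => x _; rewrite normrM (ger0_norm c0) ler_piMl.
Qed.

(** Produces the competitors for [Lambda]: after a test function has been added, the factor [c] will
    restore sup norm 1, and [c <= 1] ensures that the rescaling does not raise the gradient norm.
    The approximants of the new function are those of [u], shifted by [phi] and multiplied by
    [c]. *)
Lemma W10_scaleD D (p : R) u phi (c : R) : open D -> (mu D < +oo)%E -> 1 <= p ->
  W10 D p u -> test_function D phi -> 0 <= c <= 1 ->
  W10 D p (fun x => c * (u x + phi x)) /\
  (norm_grad D p%:E (fun x => (c * (u x + phi x))%R) <=
   norm_L D p%:E (fun x => enorm (weak_gradient D u x + grad phi x)%R))%E.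
Proof.
move=> oD muD p1 Wu tphi c01; have mD := measurable_open oD.
have [[[mu_ uoo] wu wui] [psi [tpsi cpsi]]] := Wu.
have [Cphi _ _] := tphi.
have mphi : measurable_fun D phi.
  by apply: measurable_funTS; apply: continuous_measurable_fun_rV; exact: smooth_continuous.
have [M M0 phiM] := test_function_bounded tphi.
set w := fun x => c * (u x + phi x).
have ww : is_weak_gradient D w (fun x => c *: (weak_gradient D u x + grad phi x)).
  have := is_weak_gradientD_test c c mD wu tphi.
  congr (is_weak_gradient _ _ _); apply/funext => x /=.
    by rewrite /w mulrDr.
  by rewrite scalerDr.
have mw : measurable_fun D w by apply: measurable_funM => //; exact: measurable_funD.
have mwi i : measurable_fun D (fun x => weak_gradient D u x ord0 i + grad phi x ord0 i).
  apply: measurable_funD; first by have [] := wui i.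
  apply: measurable_funTS; apply: continuous_measurable_fun_rV.
  rewrite (_ : (fun x => grad phi x ord0 i) = partial i phi).
    by apply: smooth_continuous; exact: smooth_partial.
  by apply/funext => x; rewrite mxE.
have gradE : norm_grad D p%:E w =
    norm_L D p%:E (fun x => c * enorm (weak_gradient D u x + grad phi x)).
  rewrite (norm_gradE oD p1 ww); congr norm_L; apply/funext => x.
  by rewrite enormZ ger0_norm//; case/andP: c01.
split; last first.
  rewrite gradE; apply: le_norm_L_scale => //; apply: measurable_enorm => i.
  by under eq_fun do rewrite mxE; exact: mwi.
split.
  split; [|exact: weak_gradientP ww|].
    split=> //; apply: le_lt_trans (le_norm_L_scale mD p1 c01 _) _.
      exact: measurable_funD.
    apply: le_lt_trans (norm_LD mD p1 mu_ mphi) _.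
    rewrite lte_add_pinfty//.
    exact: (norm_L_bounded_lty mD p1 muD mphi (fun x _ => phiM x)).
  move=> i; have mww : measurable_fun D (fun x => weak_gradient D w x ord0 i).
    apply: in_L1loc_measurable => //.
    by have [_ /(_ i)[]] := weak_gradientP ww.
  split=> //.
  rewrite (@eq_norm_L _ _ _ _ mD p1 _ (fun x => c * (weak_gradient D u x ord0 i + grad phi x ord0 i)))//.
  - apply: le_lt_trans (le_norm_L_scale mD p1 c01 (mwi i)) _.
    have [mwu wuoo] := wui i.
    have tdphi := test_function_partial i tphi.
    have mdphi : measurable_fun D (partial i phi).
      apply: measurable_funTS; apply: continuous_measurable_fun_rV.
      by apply: smooth_continuous; exact: smooth_partial.
    have [M' M'0 dphiM] := test_function_bounded tdphi.
    rewrite (_ : (fun _ => _) = fun x => weak_gradient D u x ord0 i + partial i phi x); last first.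
      by apply/funext => x; rewrite [grad _ _ _ _]mxE.
    apply: le_lt_trans (norm_LD mD p1 mwu mdphi) _.
    rewrite lte_add_pinfty//.
    exact: (norm_L_bounded_lty mD p1 muD mdphi (fun x _ => dphiM x)).
  - by apply: measurable_funM => //; exact: mwi.
  - have := is_weak_gradient_unique oD (weak_gradientP ww) ww.
    by apply: filterS => x h Dx; rewrite h// !mxE.
exists (fun k x => c * (psi k x + phi x)); split.
  by move=> k; apply: test_functionZ; exact: test_functionD.
apply: (@squeeze_cvge _ _ _ _ (cst 0%E) _ (fun k => norm_W1 D p%:E (u \- psi k))); last 2 first.
- exact: cvg_cst.
- exact: cpsi.
apply: nearW => k; apply/andP; split.
  by rewrite /cst /norm_W1 adde_ge0 ?norm_L_ge0//; exact: norm_L_ge0.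
have wpsi : is_weak_gradient D (u \- psi k) (fun x => weak_gradient D u x - grad (psi k) x).
  have := is_weak_gradientD_test 1 (-1) mD wu (tpsi k).
  congr (is_weak_gradient _ _ _); apply/funext => x /=.
    by rewrite mul1r mulN1r.
  by rewrite scale1r scaleN1r.
have wE : (w \- (fun x => c * (psi k x + phi x))) = fun x => c * (u x - psi k x).
  by apply/funext => x; rewrite /w /=; ring.
have wwpsi : is_weak_gradient D (fun x => c * (u x - psi k x))
    (fun x => c *: (weak_gradient D u x - grad (psi k) x)).
  have := is_weak_gradientD_test c (- c) mD wu (tpsi k).
  congr (is_weak_gradient _ _ _); apply/funext => x /=; first by ring.
  by rewrite scalerBr scaleNr.
have [Cpsi _ _] := tpsi k.
rewrite wE /norm_W1; apply: leeD.
  apply: le_norm_L_scale => //; apply: measurable_funB => //.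
  by apply: measurable_funTS; apply: continuous_measurable_fun_rV; exact: smooth_continuous.
rewrite (norm_gradE oD p1 wwpsi) (norm_gradE oD p1 wpsi).
under eq_fun do rewrite enormZ ger0_norm ?(andP c01).1//.
apply: le_norm_L_scale => //.
exact: is_weak_gradient_measurable wpsi.
Qed.

Lemma extremal_le1 D (p : R) u x : open D -> positive_extremal D p u -> D x -> u x <= 1.
Proof.
move=> oD [_ cu _ u1 _] Dx; apply: (ae_le_continuous oD Dx).
  exact: open_within_continuous cu Dx.
by apply/norm_LyP => //; rewrite u1.
Qed.

Lemma extremal_max D (p : R) u x : open D -> positive_extremal D p u ->
  unique_max_point D u x -> u x = 1.
Proof.
move=> oD pe [Dx xmax]; apply/eqP; rewrite eq_le (extremal_le1 oD pe Dx)/=.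
have [_ _ u0 u1 _] := pe.
have : (norm_L D +oo u <= (u x)%:E)%E.
  apply/norm_LyP; first exact/ltW/u0.
  apply: aeW => y Dy; rewrite gtr0_norm ?u0//.
  by have [->//|/eqP yx] := eqVneq y x; exact/ltW/xmax.
by rewrite u1 lee_fin.
Qed.

(** The value at the single point [x] forces the sup norm c of u + phi to be at least 1; then (u +
    phi) / c is admissible for [Lambda], and dividing by c does not raise the energy. Minimality
    thus becomes a one-point condition, fit for perturbations of either sign. *)
Lemma extremal_minimal D (p : R) u phi x : open D -> (mu D < +oo)%E -> 1 <= p ->
  positive_extremal D p u -> test_function D phi -> D x -> 1 <= u x + phi x ->
  (norm_L D p%:E (fun x => enorm (weak_gradient D u x)) <=
   norm_L D p%:E (fun x => enorm (weak_gradient D u x + grad phi x)%R))%E.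
Proof.
move=> oD muD p1 pe tphi Dx u1x; have [Wu cu u0 u1 uL] := pe.
have [Cphi _ _] := tphi; have [M M0 phiM] := test_function_bounded tphi.
set v := fun x => u x + phi x.
have cv : {for x, continuous v}.
  apply: continuousD; first exact: open_within_continuous cu Dx.
  exact: smooth_continuous.
have vM : (norm_L D +oo v <= (1 + M)%:E)%E.
  apply/norm_LyP; first lra.
  apply: aeW => y Dy; rewrite (le_trans (ler_normD _ _))// lerD// gtr0_norm ?u0//.
  exact: extremal_le1 oD pe Dy.
have fv : norm_L D +oo v \is a fin_num.
  by rewrite ge0_fin_numE ?norm_L_ge0// (le_lt_trans vM) ?ltry.
pose c := fine (norm_L D +oo v).
have cE : norm_L D +oo v = c%:E by rewrite fineK.
have c0 : 0 <= c by rewrite -lee_fin -cE norm_L_ge0.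
have c1 : 1 <= c.
  apply: (le_trans u1x); apply: (ae_le_continuous oD Dx cv).
  by apply/norm_LyP => //; rewrite cE.
have ci : 0 <= c^-1 <= 1 by rewrite invr_ge0 c0 invf_le1// (lt_le_trans _ c1).
have [Ww wle] := W10_scaleD oD muD p1 Wu tphi ci.
apply: le_trans wle; set w := fun x => c^-1 * (u x + phi x).
have w1 : norm_L D +oo w = 1%E.
  rewrite norm_LyZ ?invr_ge0// [norm_L _ _ _]cE -EFinM mulVf// gt_eqF//.
  exact: lt_le_trans c1.
have : (norm_grad D p%:E u `^ p <= norm_grad D p%:E w `^ p)%E.
  by rewrite uL; apply: ereal_inf_lbound; exists w.
have p0 : 0 < p by exact: lt_le_trans p1.
have pK (r : \bar R) : (0 <= r)%E -> ((r `^ p) `^ p^-1 = r)%E.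
  by move=> r0; rewrite -poweRrM mulfV ?gt_eqF// poweRe1.
have gu : (0 <= norm_grad D p%:E u)%E by exact: norm_L_ge0.
have gw : (0 <= norm_grad D p%:E w)%E by exact: norm_L_ge0.
move=> /(@gt0_ler_poweR _ p^-1); rewrite (pK _ gu) (pK _ gw); apply.
- by rewrite invr_ge0 ltW.
- by rewrite in_itv/= leey andbT poweR_ge0.
- by rewrite in_itv/= leey andbT poweR_ge0.
Qed.

End extremals.

(** * Perturbations of the extremals *)

Section chain_limit.
Context {R : realType} {n : nat}.
Variables (D : set 'rV[R]_n) (p : R).
Hypotheses (oD : open D) (muD : (lebesgue_rV n D < +oo)%E) (p1 : 1 <= p).
Implicit Types (f u phi : 'rV[R]_n -> R).
Local Notation mu := (@lebesgue_rV R n).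

Let mD : measurable D. Proof. exact: measurable_open. Qed.

Let p0 : 0 < p. Proof. exact: lt_le_trans p1. Qed.

(** In [chain_limit] the weak gradient multiplies a difference that is small in L^p but not
    uniformly, so its large values have to be split off at a level [L]. Dominated convergence makes
    their norm small. *)
Lemma norm_L_tail f : measurable_fun D f -> (forall x, 0 <= f x) ->
  (norm_L D p%:E f < +oo)%E -> forall e : R, 0 < e ->
  exists2 L : R, 0 <= L &
    (norm_L D p%:E (fun x => if (L < f x)%R then f x else 0%R) <= e%:E)%E.
Proof.
move=> mf f0 foo e e0.
pose h_ (m : nat) x := (`|if m%:R < f x then f x else 0| `^ p)%:E.
have mfm (m : nat) : measurable_fun D (fun x => if m%:R < f x then f x else 0).
  apply: measurable_fun_if => //.
  - by apply: measurable_fun_ltr => //; exact: measurable_cst.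
  - by apply: measurable_funS mf => // x [].
have mh m : measurable_fun D (h_ m).
  exact: (@measurable_norm_powR _ _ D p _ (mfm m)).
have ch : {ae mu, forall x, D x -> h_ ^~ x @ \oo --> (cst 0%E : 'rV[R]_n -> \bar R) x}.
  apply: aeW => x Dx; apply: cvg_near_cst.
  near=> m; rewrite /h_ /cst.
  suff -> : (m%:R < f x) = false by rewrite normr0 powR0// gt_eqF.
  apply/negbTE; rewrite -leNgt; near: m; exact: nbhs_infty_ger.
have ig : mu.-integrable D (fun x => (`|f x| `^ p)%:E).
  apply/integrableP; split; first exact: measurable_norm_powR.
  move/(norm_L_ltyP D p1) : foo; under [X in _ -> (X < _)%E]eq_integral => x _ do
    rewrite gee0_abs ?lee_fin ?powR_ge0//.
  by [].
have dh : {ae mu, forall x m, D x -> (`|h_ m x| <= (`|f x| `^ p)%:E)%E}.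
  apply: aeW => x m _; rewrite /h_ gee0_abs ?lee_fin ?powR_ge0//.
  by case: ifPn => // _; rewrite normr0 powR0 ?powR_ge0// gt_eqF.
have [_ _] := dominated_convergence mD mh (measurable_cst _) ch ig dh.
rewrite integral0 => /(_ [set z | (z <= (e `^ p)%:E)%E]) h.
have : nbhs (0 : R) [set r : R | (r%:E <= (e `^ p)%:E)%E].
  by apply: filterS (lt_nbhsl (powR_gt0 p e0)) => r /ltW.
move=> /h [m _ /(_ m (leqnn m)) /= hm].
exists m%:R => //; apply/(norm_L_leP D p1 _ (ltW e0)).
exact: hm.
Unshelve. all: by end_near. Qed.

Lemma ler1_powR_add (x : R) : 0 <= x -> x <= 1 + x `^ p.
Proof.
move=> x0; have [x1|/ltW x1] := leP x 1; first by rewrite (le_trans x1)// lerDl powR_ge0.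
by rewrite (le_trans (le1r_powR x1 p1))// lerDr.
Qed.

(** The inequality t <= 1 + t^p at t = |f| / e takes the place of Hoelder's inequality: its two
    terms integrate to at most [mu D] and 1. *)
Lemma norm_L_integral_le f (e : R) : measurable_fun D f -> 0 < e ->
  (norm_L D p%:E f <= e%:E)%E ->
  (\int[mu]_(x in D) `|f x|%:E <= e%:E * (mu D + 1))%E.
Proof.
move=> mf e0 /(norm_L_leP D p1 _ (ltW e0)) fe.
have mfp := @measurable_norm_powR _ _ D p f mf.
have eV : e^-1 `^ p = (e `^ p)^-1.
  by rewrite -powR_inv1 ?(ltW e0)// -powRrM mulN1r powRN.
apply: (@le_trans _ _ (\int[mu]_(x in D) (e%:E * (1%:E + (e `^ p)^-1%:E * (`|f x| `^ p)%:E)))%E).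
  apply: ge0_le_integral => //.
  - by apply/measurable_EFinP; exact: measurableT_comp.
  - apply: measurable_funeM; apply: emeasurable_funD; first exact: measurable_cst.
    exact: measurable_funeM.
  - move=> x _; rewrite (_ : (e%:E * _)%E = (e * (1 + (e `^ p)^-1 * `|f x| `^ p))%:E)//.
    rewrite lee_fin -ler_pdivrMl//.
    have := @ler1_powR_add (e^-1 * `|f x|).
    rewrite mulr_ge0 ?invr_ge0 ?(ltW e0)// => /(_ isT).
    by rewrite powRM ?invr_ge0 ?(ltW e0)// eV.
have ei0 : 0 <= (e `^ p)^-1 by rewrite invr_ge0 powR_ge0.
have mg : measurable_fun D (fun x => (e `^ p)^-1%:E * (`|f x| `^ p)%:E)%E.
  exact: measurable_funeM.
have mg1 : measurable_fun D (fun x => 1%:E + (e `^ p)^-1%:E * (`|f x| `^ p)%:E)%E.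
  by apply: emeasurable_funD => //; exact: measurable_cst.
have g0 x : D x -> (0 <= (e `^ p)^-1%:E * (`|f x| `^ p)%:E)%E.
  by move=> _; rewrite lee_fin mulr_ge0// powR_ge0.
have g10 x : D x -> (0 <= 1%:E + (e `^ p)^-1%:E * (`|f x| `^ p)%:E)%E.
  by move=> Dx; apply: adde_ge0; [rewrite lee_fin|exact: g0].
rewrite (ge0_integralZl mu mD mg1 g10)//; last by rewrite lee_fin ltW.
apply: lee_wpmul2l; first by rewrite lee_fin ltW.
rewrite (ge0_integralD mu mD _ (measurable_cst _) g0 mg)//.
rewrite integral_cst// mul1e leeD2l//.
have fp0 x : D x -> (0 <= (`|f x| `^ p)%:E)%E by rewrite lee_fin powR_ge0.
rewrite (ge0_integralZl mu mD mfp fp0 _)//.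
apply: le_trans (lee_wpmul2l _ fe) _; first by rewrite lee_fin.
by rewrite -EFinM mulVf// gt_eqF// powR_gt0.
Qed.

Lemma norm_L_integrable f : measurable_fun D f -> (norm_L D p%:E f < +oo)%E ->
  mu.-integrable D (EFin \o f).
Proof.
move=> mf foo; apply/integrableP; split; first exact/measurable_EFinP.
have fE : norm_L D p%:E f = (fine (norm_L D p%:E f))%:E.
  by rewrite fineK// ge0_fin_numE ?norm_L_ge0.
have f0 : 0 <= fine (norm_L D p%:E f) by rewrite fine_ge0// norm_L_ge0.
apply: (@le_lt_trans _ _ ((fine (norm_L D p%:E f) + 1)%:E * (mu D + 1))%E).
  apply: norm_L_integral_le => //; first by rewrite ltr_wpDl.
  by rewrite fE lee_fin lerDl.
rewrite lte_mul_pinfty ?lee_fin ?addr_ge0//.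
by rewrite lte_add_pinfty// ltry.
Qed.

Lemma test_function_grad_bounded phi : test_function D phi ->
  exists2 K, 0 < K & forall x, enorm (grad phi x) <= K.
Proof.
move=> tphi.
have /choice[M MP] : forall i, exists M, forall x, `|partial i phi x| <= M.
  by move=> i; have [M _ HM] := test_function_bounded (test_function_partial i tphi); exists M.
exists (\sum_i `|M i| + 1) => [|x]; first by rewrite ltr_wpDl// sumr_ge0.
apply: (le_trans (ler_enorm_sum _)); rewrite (@le_trans _ _ (\sum_i `|M i|))// ?lerDl//.
by apply: ler_sum => i _; rewrite mxE (le_trans (MP i x))// ler_norm.
Qed.

Lemma measurable_test phi : test_function D phi -> measurable_fun D phi.
Proof.
move=> [Cphi _ _].
by apply: measurable_funTS; apply: continuous_measurable_fun_rV; exact: smooth_continuous.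
Qed.

Lemma measurable_grad phi i : test_function D phi ->
  measurable_fun D (fun x => grad phi x ord0 i).
Proof.
move=> tphi; rewrite (_ : (fun x => grad phi x ord0 i) = partial i phi).
  by apply: measurable_test; exact: test_function_partial.
by apply/funext => x; rewrite mxE.
Qed.

Variables (u : 'rV[R]_n -> R) (F F' : R -> R) (C : R) (zeta : 'rV[R]_n -> R).
Hypotheses (Wu : W10 D p u) (dF : forall t, is_derive t (1 : R) F (F' t)).
Hypotheses (sF : forall f, smooth f -> smooth (F \o f)).
Hypotheses (C0 : 0 <= C) (F'C : forall t, `|F' t| <= C).
Hypotheses (F'lip : forall s t, `|F' s - F' t| <= C * `|s - t|).
Hypotheses (tz : test_function D zeta).
Local Notation v := (weak_gradient D u).

(** The gradient that the product and chain rules predict for zeta F(u). It enters as an L^p limit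
    of gradients of test functions, so it never has to be identified with a weak gradient. *)
Definition chain_grad : 'rV[R]_n -> 'rV[R]_n :=
  fun x => (zeta x * F' (u x)) *: v x + F (u x) *: grad zeta x.

Let mu_u : measurable_fun D u. Proof. by have [[[] ]] := Wu. Qed.

Let mF' : measurable_fun D (fun x => F' (u x)).
Proof.
apply: measurableT_comp => //; apply: continuous_measurable_fun => x.
apply/cvgrPdist_lt => e e0; near=> y.
apply: (le_lt_trans (F'lip x y)); apply: (@le_lt_trans _ _ ((C + 1) * `|x - y|)).
  by rewrite ler_wpM2r// lerDl.
rewrite -ltr_pdivlMl; last by rewrite ltr_wpDl.
near: y; apply: cvgr_dist_lt => //; rewrite mulr_gt0// invr_gt0 ltr_wpDl//.
Unshelve. all: by end_near. Qed.

Let mF : measurable_fun D (fun x => F (u x)).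
Proof.
apply: measurableT_comp => //; apply: continuous_measurable_fun.
exact: is_derive1_continuous dF.
Qed.

Let mv i : measurable_fun D (fun x => v x ord0 i).
Proof. by have [[_ _ /(_ i)[]]] := Wu. Qed.

Lemma measurable_chain_grad i : measurable_fun D (fun x => chain_grad x ord0 i).
Proof.
rewrite (_ : (fun _ => _) = fun x => zeta x * F' (u x) * v x ord0 i +
    F (u x) * grad zeta x ord0 i); last by apply/funext => x; rewrite !mxE.
apply: measurable_funD; apply: measurable_funM => //.
  by apply: measurable_funM => //; exact: measurable_test.
exact: measurable_grad.
Qed.

Lemma enorm_weak_gradient_lty : (norm_L D p%:E (fun x => enorm (v x)) < +oo)%E.
Proof. by apply: norm_L_enorm_lty => // i; have [[_ _ ]] := Wu. Qed.

Lemma partial_chain phi x : smooth phi ->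
  grad (fun x => zeta x * F (phi x)) x =
  (zeta x * F' (phi x)) *: grad phi x + F (phi x) *: grad zeta x.
Proof.
move=> Cphi; have [Cz _ _] := tz; apply/rowP => i; rewrite !mxE.
rewrite (@partialM _ _ i zeta (F \o phi)); last 2 first.
- exact: smooth_derivable.
- by apply: smooth_derivable; exact: sF.
rewrite (partial_comp dF (smooth_derivable (i := i) (x := x) Cphi)) mulrA.
by rewrite [partial i zeta x * _]mulrC.
Qed.

(** The gradient of zeta F(phi_k) differs from its limit by three terms. One carries grad phi_k -
    grad u, another F(phi_k) - F(u), and both are small in L^p. The third is F'(phi_k) - F'(u) times
    the weak gradient: the Lipschitz bound on F' controls it where that gradient is at most [L], and
    the bound 2 C on the difference controls it on the tail. *)
Lemma chain_limit : exists phi : nat -> 'rV[R]_n -> R,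
  (forall k, test_function D (fun x => zeta x * F (phi k x))) /\
  cvg_norm_L D p (fun k x =>
    enorm (grad (fun x => zeta x * F (phi k x)) x - chain_grad x)).
Proof.
have [phi [tphi cphi cgrad]] := W10_approx oD p1 Wu.
have Cphi k : smooth (phi k) by have [] := tphi k.
exists phi; split=> [k|e e0].
  by apply: test_functionM => //; apply: sF.
have [M M0 zM] := test_function_bounded tz.
have [K K0 zK] := test_function_grad_bounded tz.
have menv : measurable_fun D (fun x => enorm (v x)) by exact: measurable_enorm.
(* Dominates both M C, the size of zeta F' in front of grad u - grad phi_k, and 2 M C, the size of
   zeta (F'(phi_k) - F'(u)) on the tail; the 1 makes it positive. *)
pose c := 2 * (M * C) + 1.
have c0 : 0 < c by rewrite ltr_wpDl// mulr_ge0// mulr_ge0// ltW.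
have [L L0 HL] := norm_L_tail menv (fun x => enorm_ge0 _) enorm_weak_gradient_lty
  (divr_gt0 (divr_gt0 e0 (ltr0n _ 3)) c0).
set tail := fun x => _ in HL.
(* The coefficient of |u - phi_k|: M C L comes from the Lipschitz bound on F' where |grad u| <= L,
   and C K from that on F against grad zeta. *)
pose c2 := M * C * L + C * K + 1.
have c20 : 0 < c2.
  by rewrite ltr_wpDl// addr_ge0// mulr_ge0// ?mulr_ge0// ltW.
near=> k.
have md : measurable_fun D (fun x => u x - phi k x).
  by apply: measurable_funB => //; exact: measurable_test.
have mdg i : measurable_fun D (fun x => (v x - grad (phi k) x) ord0 i).
  rewrite (_ : (fun _ => _) = fun x => v x ord0 i - grad (phi k) x ord0 i).
    by apply: measurable_funB => //; exact: measurable_grad.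
  by apply/funext => x; rewrite !mxE.
have mtail : measurable_fun D tail.
  apply: measurable_fun_if => //.
  - by apply: measurable_fun_ltr => //; exact: measurable_cst.
  - by apply: measurable_funS menv => // x [].
have mW i : measurable_fun D (fun x =>
    (grad (fun x => zeta x * F (phi k x)) x - chain_grad x) ord0 i).
  have tk : test_function D (fun x => zeta x * F (phi k x)).
    by apply: test_functionM => //; exact: sF.
  have mB := measurable_funB (measurable_grad i tk) (measurable_chain_grad i).
  by apply: eq_measurable_fun mB => x _; rewrite /= [in RHS]mxE [X in _ = _ + X]mxE.
have men1 : measurable_fun D (fun x => enorm (v x - grad (phi k) x)) by exact: measurable_enorm.
pose rest x := c2 * `|u x - phi k x| + c * `|tail x|.
have mrest : measurable_fun D rest.
  by apply: measurable_funD; apply: measurable_funM => //; exact: measurable_norm.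
have pw x : D x -> `|enorm (grad (fun x => zeta x * F (phi k x)) x - chain_grad x)|
    <= c * `|enorm (v x - grad (phi k) x)| + 1 * `|rest x|.
  move=> Dx; rewrite ger0_norm ?enorm_ge0// ger0_norm ?enorm_ge0// mul1r.
  rewrite partial_chain// /chain_grad.
  set a := grad (phi k) x; set b := v x; set s := phi k x; set t := u x.
  have -> : (zeta x * F' s) *: a + F s *: grad zeta x -
      ((zeta x * F' t) *: b + F t *: grad zeta x) =
      (- (zeta x * F' s)) *: (b - a) + ((zeta x * (F' s - F' t)) *: b +
      (F s - F t) *: grad zeta x).
    by apply/rowP => i; rewrite !mxE; ring.
  apply: (le_trans (ler_enormD _ _)); apply: lerD.
    rewrite enormZ normrN normrM ler_wpM2r ?enorm_ge0//.
    apply: (@le_trans _ _ (M * C)); first by rewrite ler_pM.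
    by rewrite /c; have : 0 <= M * C by [rewrite mulr_ge0// ltW]; lra.
  rewrite [leRHS]ger0_norm; last by rewrite addr_ge0// mulr_ge0// ltW.
  apply: (le_trans (ler_enormD _ _)); rewrite !enormZ !normrM.
  have h3 : `|F s - F t| * enorm (grad zeta x) <= C * K * `|t - s|.
    rewrite mulrAC; apply: ler_pM => //; first exact: enorm_ge0.
    by rewrite [`|t - s|]distrC (lipschitz_of_is_derive _ _ dF F'C).
  have b0 : 0 <= enorm b by exact: enorm_ge0.
  have d0 : 0 <= `|t - s| by [].
  have h2 : `|zeta x| * `|F' s - F' t| * enorm b <=
      M * C * L * `|t - s| + 2 * (M * C) * `|tail x|.
    rewrite /tail -/b; case: ifPn => bL.
      rewrite (ger0_norm b0); apply: (@le_trans _ _ (2 * (M * C) * enorm b)).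
        rewrite ler_wpM2r// mulrCA ler_pM//.
        by rewrite (le_trans (ler_normB _ _))// mulr2n mulrDl mul1r lerD.
      by rewrite lerDr !mulr_ge0// ltW.
    rewrite normr0 mulr0 addr0 -leNgt in bL *.
    have -> : M * C * L * `|t - s| = M * (C * `|t - s|) * L by ring.
    apply: ler_pM => //.
    by apply: ler_pM => //; rewrite [`|t - s|]distrC F'lip.
  rewrite /rest -/t -/s /c2 /c.
  have tl0 : 0 <= `|tail x| by [].
  by have := lerD h2 h3; lra.
have N1 := le_norm_L_add mD p1 (ltW c0) ler01 (measurable_enorm mW) men1 mrest (aeW _ pw).
apply: le_trans N1 _.
have N2 : (norm_L D p%:E rest <= c2%:E * norm_L D p%:E (fun x => (u x - phi k x)%R) +
    c%:E * norm_L D p%:E tail)%E.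
  apply: le_norm_L_add (ltW c20) (ltW c0) mrest md mtail _ => //.
  by apply: aeW => x _; rewrite ger0_norm// /rest addr_ge0// mulr_ge0// ltW.
rewrite mul1e; apply: le_trans (leeD2l _ N2) _.
have -> : e = c * (e / 3 / c) + (c2 * (e / 3 / c2) + c * (e / 3 / c)).
  by field; rewrite !gt_eqF.
rewrite !EFinD !EFinM; apply: leeD.
  apply: lee_wpmul2l; first by rewrite lee_fin ltW.
  near: k; apply: cgrad; rewrite !divr_gt0//.
apply: leeD; (apply: lee_wpmul2l; first by rewrite lee_fin ltW) => //.
by near: k; apply: cphi; rewrite !divr_gt0.
Unshelve. all: by end_near. Qed.

End chain_limit.

(** * The exponential of a sine *)

Section real_lemmas.
Context {R : realType}.

Lemma cos_ge_cos1 (s : R) : 0 <= s <= 1 -> cos 1 <= cos s.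
Proof.
move=> /andP[s0 s1]; have pi1 : (1 : R) <= pi by have := pi_ge2 R; lra.
have [->//|s1'] := eqVneq s 1.
by rewrite ltW// ltr_cos ?in_itv/= ?s0 ?ler01 ?(le_trans s1)// lt_neqAle s1'.
Qed.

Lemma sin_ge0_01 (s : R) : 0 <= s <= 1 -> 0 <= sin s.
Proof.
move=> /andP[s0 s1]; apply: sin_ge0_pi; rewrite s0/= (le_trans s1)//.
by have := pi_ge2 R; lra.
Qed.

Lemma powR_convex (p q x y : R) : 1 <= p -> 0 <= q <= 1 -> 0 <= x -> 0 <= y ->
  ((1 - q) * x + q * y) `^ p <= (1 - q) * x `^ p + q * y `^ p.
Proof.
move=> p1 /andP[q0 q1] x0 y0.
have := @convex_powR R p p1 (Itv01 q0 q1) y x.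
rewrite !inE/= !in_itv/= !andbT => /(_ y0 x0).
rewrite !convRE/= => h; rewrite [X in X `^ p]addrC [leRHS]addrC; exact: h.
Qed.

(** [sg] = 1 and [c] = 0 give exp (- q sin s), for the zeros of the limit; [sg] = -1 and [c] = 1
    give exp (- q sin (1 - s)), for its maxima. With q = lam p it is the weight of the energy
    estimate, with q = lam the function whose gradient gets bounded. *)
Definition expsin (sg c q s : R) : R := expR (- (q * sin (c + sg * s))).

Definition expsin' (sg c q s : R) : R :=
  - (q * sg * cos (c + sg * s)) * expsin sg c q s.

Variables (sg c : R).
Hypothesis sg2 : sg ^+ 2 = 1.

Let sg1 : `|sg| = 1.
Proof. by apply/eqP; rewrite -sqrp_eq1// real_normK ?num_real// sg2. Qed.

Let is_derive_affine s : is_derive s (1 : R) (fun s => c + sg * s) sg.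
Proof.
have := is_deriveD (is_derive_cst c s 1) (is_deriveZ sg (is_derive_id s (1 : R))).
by move/is_derive_eq; apply; rewrite add0r [_ *: _]mulr1.
Qed.

Let is_derive_sina q s :
  is_derive s (1 : R) (fun s => - (q * sin (c + sg * s))) (- (q * sg * cos (c + sg * s))).
Proof.
have [da daE] := is_derive_affine s.
have d1 := is_derive_comp (f := fun s => c + sg * s) (is_derive_sin _) da; rewrite daE in d1.
have d2 := is_deriveN (is_deriveZ q d1).
by apply: (is_derive_eq d2); rewrite /GRing.scale/=; ring.
Qed.

Let is_derive_cosa q s :
  is_derive s (1 : R) (fun s => - (q * sg * cos (c + sg * s))) (q * sin (c + sg * s)).
Proof.
have [da daE] := is_derive_affine s.
have d1 := is_derive_comp (f := fun s => c + sg * s) (is_derive_cos _) da; rewrite daE in d1.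
have d2 := is_deriveN (is_deriveZ (q * sg) d1).
apply: (is_derive_eq d2); rewrite /GRing.scale/=.
by transitivity (sg ^+ 2 * (q * sin (c + sg * s))); [ring|rewrite sg2 mul1r].
Qed.

Lemma is_derive_expsin q s : is_derive s (1 : R) (expsin sg c q) (expsin' sg c q s).
Proof.
have [da daE] := is_derive_sina q s.
have d1 := is_derive_comp (f := fun s => - (q * sin (c + sg * s))) (is_derive_expR _) da.
by apply: (is_derive_eq d1); rewrite daE /expsin' /expsin mulrC.
Qed.

Let is_derive_expsin' q s : is_derive s (1 : R) (expsin' sg c q)
  ((- (q * sg * cos (c + sg * s))) * expsin' sg c q s +
   expsin sg c q s * (q * sin (c + sg * s))).
Proof. exact: is_deriveM (is_derive_cosa q s) (is_derive_expsin q s). Qed.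

Lemma smooth_expsin n q (f : 'rV[R]_n -> R) : smooth f -> smooth (expsin sg c q \o f).
Proof.
move=> Cf; apply: (smooth_expR (f := fun x => - (q * sin (c + sg * f x)))).
apply: smoothN; apply: smoothM; first exact: smooth_cst.
apply: (smooth_sin (f := fun x => c + sg * f x)).
apply: smoothD; first exact: smooth_cst.
by apply: smoothM => //; exact: smooth_cst.
Qed.

Lemma expsin_gt0 q s : 0 < expsin sg c q s.
Proof. exact: expR_gt0. Qed.

Lemma expsin_bounds q : 0 <= q -> exists2 C : R, 0 <= C &
  [/\ forall s, `|expsin sg c q s| <= C, forall s, `|expsin' sg c q s| <= C &
      forall s t, `|expsin' sg c q s - expsin' sg c q t| <= C * `|s - t|].
Proof.
(* The constant dominates exp q, q exp q and (q + q^2) exp q, which bound the function and its first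
   two derivatives. *)
move=> q0; pose C := (1 + q + q ^+ 2) * expR q.
have eq0 : 0 <= expR q by exact: expR_ge0.
have b0 s : `|expsin sg c q s| <= expR q.
  rewrite gtr0_norm ?expsin_gt0// ler_expR lerNl.
  apply: (@le_trans _ _ (- (q * 1))); first by rewrite mulr1.
  by rewrite -mulrN ler_wpM2l// sin_geN1.
have b1 s : `|expsin' sg c q s| <= q * expR q.
  rewrite normrM normrN !normrM sg1 mulr1 (ger0_norm q0); apply: ler_pM => //.
    by rewrite mulr_ge0.
  by rewrite -[leRHS]mulr1 ler_wpM2l// cos_max.
exists C; first by rewrite mulr_ge0// !addr_ge0// sqr_ge0.
have q2 : 0 <= q ^+ 2 * expR q by rewrite mulr_ge0 ?sqr_ge0.
have qe : 0 <= q * expR q by rewrite mulr_ge0.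
split=> [s|s|s t].
- by apply: (le_trans (b0 s)); rewrite /C !mulrDl mul1r; lra.
- by apply: (le_trans (b1 s)); rewrite /C !mulrDl mul1r; lra.
- apply: lipschitz_of_is_derive (is_derive_expsin' q) _ => x.
  apply: (le_trans (ler_normD _ _)).
  apply: (@le_trans _ _ (q * (q * expR q) + expR q * q)); last first.
    by rewrite /C !mulrDl mul1r mulrA -expr2 [expR q * q]mulrC; lra.
  apply: lerD; rewrite normrM; apply: ler_pM => //.
    rewrite normrN !normrM sg1 mulr1 (ger0_norm q0) -[leRHS]mulr1.
    by rewrite ler_wpM2l// cos_max.
  by rewrite normrM (ger0_norm q0) -[leRHS]mulr1 ler_wpM2l// sin_max.
Qed.

Lemma expsin_powR q (p : R) s : expsin sg c q s `^ p = expsin sg c (q * p) s.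
Proof. by rewrite /expsin -expRM; congr expR; ring. Qed.

End real_lemmas.

Section pointwise.
Context {R : realType} {n : nat}.

(* The perturbed gradient is a convex combination of [v] and a multiple of the
   gradient [w] of the cut-off, so no Euler-Lagrange equation is needed. *)
Lemma enorm_convex_combination (p e f cs kap lam K : R) (m : nat) (sg : R) (v w : 'rV[R]_n) :
  1 <= p -> 0 < lam -> 0 < kap -> 0 <= K -> p <= m%:R -> (1 < m)%N ->
  sg ^+ 2 = 1 -> 0 <= e <= 1 -> 0 < f <= 1 -> kap <= cs <= 1 -> enorm w <= K ->
  enorm (v + sg *: ((e ^+ m / (lam * p) * (- (lam * p * sg * cs) * f)) *: v +
    f *: ((m%:R * e ^+ m.-1 / (lam * p)) *: w))) `^ p <=
  enorm v `^ p - kap * (e ^+ m * f * enorm v `^ p) + (m%:R * K / (kap * lam * p)) `^ p.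
Proof.
move=> p1 lam0 kap0 K0 pm m1 sg2 /andP[e0 e1] /andP[f0 f1] /andP[kcs cs1] wK.
have p0 : 0 < p by exact: lt_le_trans p1.
have lp0 : 0 < lam * p by exact: mulr_gt0.
have kcs0 : 0 < cs by exact: lt_le_trans kcs.
set G := m%:R * K / (kap * lam * p).
have G0 : 0 <= G by rewrite /G !mulr_ge0// invr_ge0 !mulr_ge0 ?ltW.
(* The weight of the convex combination: the perturbed gradient is (1 - q) v + y, with y a multiple
   of [w]. It is at most 1 as each of e^m, cs and f is. *)
pose q := e ^+ m * (cs * f).
have em0 : 0 <= e ^+ m by exact: exprn_ge0.
have em1 : e ^+ m <= 1 by exact: exprn_ile1.
have csf0 : 0 < cs * f by exact: mulr_gt0.
have csf1 : cs * f <= 1 by rewrite mulr_ile1// ltW.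
have q01 : 0 <= q <= 1.
  by rewrite /q mulr_ge0 ?(ltW csf0)//= mulr_ile1// ltW.
pose y := (sg * f * (m%:R * e ^+ m.-1 / (lam * p))) *: w.
have -> : v + sg *: ((e ^+ m / (lam * p) * (- (lam * p * sg * cs) * f)) *: v +
    f *: ((m%:R * e ^+ m.-1 / (lam * p)) *: w)) = (1 - q) *: v + y.
  rewrite /y scalerDr !scalerA addrA scalerBl scale1r.
  rewrite (_ : sg * (_ * _) = - q); first by rewrite scaleNr.
  rewrite /q; transitivity (- (sg ^+ 2 * (e ^+ m * (cs * f) * ((lam * p) / (lam * p))))).
    by ring.
  by rewrite sg2 mulfV ?gt_eqF// mul1r mulr1.
have sg1 : `|sg| = 1 by apply/eqP; rewrite -sqrp_eq1// real_normK ?num_real// sg2.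
have em10 : 0 <= e ^+ m.-1 by exact: exprn_ge0.
have yle : enorm y <= f * (m%:R * e ^+ m.-1 / (lam * p)) * K.
  rewrite /y enormZ !normrM sg1 mul1r (gtr0_norm f0) (ger0_norm em10) normr_nat.
  rewrite normfV (gtr0_norm lp0) ler_wpM2l//.
  by rewrite !mulr_ge0 ?invr_ge0 ?(ltW lp0) ?(ltW f0).
apply: (@le_trans _ _ (((1 - q) * enorm v + enorm y) `^ p)).
  apply: ge0_ler_powR; rewrite ?nnegrE ?enorm_ge0 ?(ltW p0)//.
    by rewrite addr_ge0 ?enorm_ge0// mulr_ge0 ?enorm_ge0// subr_ge0; case/andP: q01.
  apply: (le_trans (ler_enormD _ _)); rewrite enormZ ger0_norm//.
  by rewrite subr_ge0; case/andP: q01.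
(* The remaining argument divides by q, which vanishes when e = 0; in that case y vanishes too,
   because m - 1 > 0. *)
have [e00|en0] := eqVneq e 0.
  have m0 : (0 < m)%N by exact: ltn_trans m1.
  have m10 : (0 < m.-1)%N by case: m m1 {pm G G0 q em0 em1 q01 y em10 yle m0} => [|[]].
  have y0 : enorm y = 0.
    apply/eqP; rewrite eq_le enorm_ge0 andbT (le_trans yle)//.
    by rewrite e00 expr0n gtn_eqF//= mulr0 !mul0r mulr0 mul0r.
  rewrite y0 /q e00 expr0n gtn_eqF//= !mul0r mulr0 !subr0 mul1r addr0.
  by rewrite lerDl powR_ge0.
have egt0 : 0 < e by rewrite lt_neqAle eq_sym en0.
have emgt0 : 0 < e ^+ m by exact: exprn_gt0.
have qgt0 : 0 < q by exact: mulr_gt0.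
have -> : enorm y = q * (enorm y / q) by rewrite mulrCA mulfV ?mulr1 ?gt_eqF.
have yq0 : 0 <= enorm y / q by rewrite divr_ge0 ?enorm_ge0// ltW.
apply: (le_trans (powR_convex p1 q01 (enorm_ge0 _) yq0)).
apply: lerD.
  rewrite mulrBl mul1r lerD2l lerN2 -mulrA mulrCA mulrA /q.
  rewrite -[leRHS]mulrA [leRHS]mulrCA; 
  have := powR_ge0 (enorm v) p; set A := _ `^ p => A0.
  have : 0 <= (cs - kap) * (e ^+ m * f * A) by rewrite !mulr_ge0 ?subr_ge0// ltW.
  by lra.
have yqG : enorm y / q <= G / e.
  rewrite ler_pdivrMr//; apply: (le_trans yle).
  have -> : e ^+ m.-1 = e ^+ m / e.
    have m0 : (0 < m)%N by exact: ltn_trans m1.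
    by rewrite -[in RHS](prednK m0) exprSr mulfK.
  have -> : G / e * q = f * (m%:R * (e ^+ m / e) / (lam * p)) * K * (cs / kap).
    by rewrite /G /q; field; rewrite !gt_eqF.
  by rewrite ler_peMr// ?ler_pdivlMr ?mul1r// !mulr_ge0// ?invr_ge0 ?mulr_ge0 ?ltW.
(* Dividing by q costs a factor e^-1 inside the power p; the weight e^m absorbs it since p <= m and
   e <= 1, which is why the cut-off is raised to the power [m]. *)
apply: (@le_trans _ _ (e ^+ m * (G / e) `^ p)).
  apply: ler_pM; rewrite ?powR_ge0 ?(ltW qgt0)//.
    by rewrite /q ler_piMr.
  by apply: ge0_ler_powR; rewrite ?nnegrE ?(ltW p0)// divr_ge0.
rewrite powRM// ?invr_ge0// mulrCA ler_piMr ?powR_ge0//.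
rewrite -powR_inv1// -powRrM mulN1r powRN ler_pdivrMr ?powR_gt0// mul1r.
by rewrite -powR_mulrn//; apply: ger_powR => //; rewrite egt0.
Qed.

End pointwise.

Section caccioppoli.
Context {R : realType} {n : nat}.
Variables (D : set 'rV[R]_n) (p : R) (u : 'rV[R]_n -> R).
Hypotheses (oD : open D) (muD : (lebesgue_rV n D < +oo)%E) (p1 : 1 <= p).
Hypothesis Wu : W10 D p u.
Local Notation mu := (@lebesgue_rV R n).
Local Notation v := (weak_gradient D u).
Local Notation V := (fine (mu D)).

Let mD : measurable D. Proof. exact: measurable_open. Qed.

Let p0 : 0 < p. Proof. exact: lt_le_trans p1. Qed.

Let muDE : mu D = V%:E.
Proof. by rewrite fineK// ge0_fin_numE. Qed.

Let V0 : 0 <= V. Proof. by rewrite fine_ge0. Qed.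

Let menv : measurable_fun D (fun x => enorm (v x)).
Proof. by apply: measurable_enorm => i; have [[_ _ /(_ i)[]]] := Wu. Qed.

Let mu_u : measurable_fun D u. Proof. by have [[[]]] := Wu. Qed.

Lemma poweR_norm_L_enorm (g : 'rV[R]_n -> 'rV[R]_n) :
  (norm_L D p%:E (fun x => enorm (g x)) `^ p =
   \int[mu]_(x in D) (enorm (g x) `^ p)%:E)%E.
Proof.
rewrite (norm_L_poweR _ p1); apply: eq_integral => x _.
by rewrite ger0_norm ?enorm_ge0.
Qed.

Section chain.
Variables (F F' : R -> R) (C : R) (zeta : 'rV[R]_n -> R).
Hypotheses (dF : forall t, is_derive t (1 : R) F (F' t)).
Hypotheses (sF : forall f : 'rV[R]_n -> R, smooth f -> smooth (F \o f)).
Hypotheses (C0 : 0 <= C) (FC : forall t, `|F t| <= C) (F'C : forall t, `|F' t| <= C).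
Hypotheses (F'lip : forall s t, `|F' s - F' t| <= C * `|s - t|).
Hypotheses (tz : test_function D zeta).
Local Notation W := (chain_grad D u F F' zeta).

Let mW i : measurable_fun D (fun x => W x ord0 i).
Proof. exact: (measurable_chain_grad Wu dF C0 F'lip tz). Qed.

Let menW : measurable_fun D (fun x => enorm (W x)).
Proof. exact: measurable_enorm. Qed.

Lemma norm_L_chain_lty : (norm_L D p%:E (fun x => enorm (W x)) < +oo)%E.
Proof.
have [M M0 zM] := test_function_bounded tz.
have [K K0 zK] := test_function_grad_bounded tz.
have MC0 : 0 <= M * C by rewrite mulr_ge0// ltW.
have CK0 : 0 <= C * K by rewrite mulr_ge0// ltW.
have m1 : measurable_fun D (cst 1 : 'rV[R]_n -> R) by exact: measurable_cst.
have := @le_norm_L_add R n D p mD p1 (fun x => enorm (W x)) (fun x => enorm (v x))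
  (cst 1) (M * C) (C * K) MC0 CK0 menW menv m1.
move=> h; apply: le_lt_trans (h _) _.
  apply: aeW => x _; rewrite ger0_norm ?enorm_ge0// ger0_norm ?enorm_ge0//.
  rewrite normr1 mulr1; apply: (le_trans (ler_enormD _ _)); rewrite !enormZ normrM.
  apply: lerD; apply: ler_pM; rewrite ?enorm_ge0//.
  by apply: ler_pM.
rewrite lte_add_pinfty// lte_mul_pinfty ?lee_fin//.
  exact: (enorm_weak_gradient_lty oD p1 Wu).
by apply: (@norm_L_bounded_lty _ _ D p (cst 1) 1) => // x _; rewrite normr1.
Qed.

Let iW i : mu.-integrable D (fun x => (W x ord0 i)%:E).
Proof.
apply: (norm_L_integrable oD muD p1) => //.
apply: le_lt_trans norm_L_chain_lty; apply: le_norm_L => //.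
apply: aeW => x _; rewrite [leRHS]ger0_norm ?enorm_ge0//.
exact: ler_coord_enorm.
Qed.

(** Integration by parts for zeta F(u): partial derivatives of test functions have integral 0, and
    this survives convergence in L^p, which is stronger than convergence in L^1 on a set of finite
    measure. *)
Lemma integral_chain_grad i : (\int[mu]_(x in D) (W x ord0 i)%:E = 0)%E.
Proof.
have [phi [tphi cphi]] := chain_limit oD p1 Wu dF sF C0 F'C F'lip tz.
apply/eqP; rewrite -abse_eq0 eq_le abse_ge0 andbT.
apply/lee_addgt0Pr => e e0; rewrite add0e.
have V10 : 0 < V + 1 by rewrite ltr_wpDl.
have [k _ /(_ k (leqnn k)) /= hk] := cphi _ (divr_gt0 e0 V10).
set Phi := fun x => zeta x * F (phi k x).
have tPhi : test_function D Phi by exact: tphi.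
have tdPhi := test_function_partial i tPhi.
have iPhi : mu.-integrable D (fun x => (partial i Phi x)%:E).
  apply: (integrableS _ _ (@subsetT _ D) (test_function_integrable tdPhi)) => //.
have Phi0 : (\int[mu]_(x in D) (partial i Phi x)%:E = 0)%E.
  rewrite -(integral_partial_test i tPhi) integral_mkcond; apply: eq_integral => x _.
  rewrite patchE; case: ifPn => // xD; rewrite (test_function0 tdPhi)// => h.
  by move/negP: xD; apply; rewrite inE; have [_ _] := tdPhi; apply.
have md : measurable_fun D (fun x => enorm (grad Phi x - W x)).
  apply: measurable_enorm => j.
  have mB := measurable_funB (measurable_grad j tPhi) (mW j).
  by apply: eq_measurable_fun mB => x _; rewrite /= [in RHS]mxE [X in _ = _ + X]mxE.
have -> : (\int[mu]_(x in D) (W x ord0 i)%:E =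
    \int[mu]_(x in D) ((W x ord0 i)%:E - (partial i Phi x)%:E))%E.
  by rewrite integralB//= Phi0 sube0.
apply: le_trans (le_abse_integral mu mD _) _.
  apply: emeasurable_funB; [exact: measurable_int (iW i)|exact: measurable_int iPhi].
apply: (@le_trans _ _ (\int[mu]_(x in D) `|enorm (grad Phi x - W x)|%:E)%E).
  apply: ge0_le_integral => //.
  - apply: measurableT_comp => //.
    apply: emeasurable_funB; [exact: measurable_int (iW i)|exact: measurable_int iPhi].
  - by apply/measurable_EFinP; exact: measurableT_comp.
  - move=> x _; rewrite -EFinB abse_EFin lee_fin [leRHS]ger0_norm ?enorm_ge0//.
    have := ler_coord_enorm (grad Phi x - W x) i.
    by rewrite [X in `|X| <= _]mxE [X in `|X + _|]mxE [X in `|_ + X|]mxE distrC.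
apply: le_trans (norm_L_integral_le oD p1 md (divr_gt0 e0 V10) hk) _.
by rewrite muDE -EFinD -EFinM lee_fin divfK// gt_eqF.
Qed.

(** Minimality is assumed against test functions of the form zeta F(phi); the approximation of
    [chain_limit] carries it over to u itself. *)
Lemma minimal_chain (sg : R) : `|sg| = 1 ->
  (forall phi, test_function D (fun x => zeta x * F (phi x)) ->
   (norm_L D p%:E (fun x => enorm (v x)) <= norm_L D p%:E
      (fun x => enorm (v x + sg *: grad (fun x => zeta x * F (phi x)) x)%R))%E) ->
  (norm_L D p%:E (fun x => enorm (v x)) <=
   norm_L D p%:E (fun x => enorm (v x + sg *: W x)%R))%E.
Proof.
move=> sg1 hmin.
have [phi [tphi cphi]] := chain_limit oD p1 Wu dF sF C0 F'C F'lip tz.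
apply/lee_addgt0Pr => e e0.
have [k _ /(_ k (leqnn k)) /= hk] := cphi _ e0.
set Phi := fun x => zeta x * F (phi k x).
have tPhi : test_function D Phi by exact: tphi.
have mv i : measurable_fun D (fun x => v x ord0 i) by have [[_ _ /(_ i)[]]] := Wu.
have ms (g : 'rV[R]_n -> 'rV[R]_n) : (forall i, measurable_fun D (fun x => g x ord0 i)) ->
    measurable_fun D (fun x => enorm (v x + sg *: g x)).
  move=> mg; apply: measurable_enorm => i.
  have mB : measurable_fun D (fun x => v x ord0 i + sg * g x ord0 i).
    by apply: measurable_funD => //; exact: measurable_funM.
  by apply: eq_measurable_fun mB => x _; rewrite [in RHS]mxE [X in _ = _ + X]mxE.
have md : measurable_fun D (fun x => enorm (grad Phi x - W x)).
  apply: measurable_enorm => j.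
  have mB := measurable_funB (measurable_grad j tPhi) (mW j).
  by apply: eq_measurable_fun mB => x _; rewrite /= [in RHS]mxE [X in _ = _ + X]mxE.
apply: le_trans (hmin _ (tphi k)) _; rewrite -/Phi.
have mgPhi i : measurable_fun D (fun x => grad Phi x ord0 i) by exact: measurable_grad.
have := @le_norm_L_add R n D p mD p1 (fun x => enorm (v x + sg *: grad Phi x))
  (fun x => enorm (v x + sg *: W x)) (fun x => enorm (grad Phi x - W x)) 1 1
  ler01 ler01 (ms _ mgPhi) (ms _ mW) md.
rewrite !mul1e => h; apply: le_trans (h _) _; last exact: leeD2l.
apply: aeW => x _; rewrite !mul1r !ger0_norm ?enorm_ge0//.
have -> : v x + sg *: grad Phi x = (v x + sg *: W x) + sg *: (grad Phi x - W x).
  by rewrite scalerBr -addrA [sg *: W x + _]addrC subrK.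
by apply: (le_trans (ler_enormD _ _)); rewrite enormZ sg1 mul1r.
Qed.

End chain.

(** * Energy and gradient estimates for a fixed exponent *)

Variables (sg c lam K kap : R) (m : nat) (eta : 'rV[R]_n -> R).
Hypotheses (sg2 : sg ^+ 2 = 1) (lam0 : 0 < lam) (kap0 : 0 < kap).
Hypotheses (pm : p <= m%:R) (m2p : m%:R <= 2 * p) (m1 : (1 < m)%N).
Hypotheses (teta : test_function D eta) (eta01 : forall x, 0 <= eta x <= 1).
Hypotheses (etaK : forall x, enorm (grad eta x) <= K) (K0 : 0 < K).
Hypothesis ucos : forall x, D x -> kap <= cos (c + sg * u x).
Hypothesis usin : forall x, D x -> 0 <= sin (c + sg * u x).
Hypothesis hmin : forall phi, test_function D phi -> (forall x, 0 <= phi x) ->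
  (forall x, eta x = 0 -> phi x = 0) ->
  (norm_L D p%:E (fun x => enorm (v x)) <=
   norm_L D p%:E (fun x => enorm (v x + sg *: grad phi x)%R))%E.

Let sg1 : `|sg| = 1.
Proof. by apply/eqP; rewrite -sqrp_eq1// real_normK ?num_real// sg2. Qed.

Let X x := eta x ^+ m * expsin sg c (lam * p) (u x) * enorm (v x) `^ p.

Let X0 x : 0 <= X x.
Proof.
have /andP[e0 _] := eta01 x.
by rewrite /X !mulr_ge0 ?powR_ge0 ?exprn_ge0// ltW// expsin_gt0.
Qed.

Let mexpsin q : measurable_fun D (fun x => expsin sg c q (u x)).
Proof.
apply: measurableT_comp => //; apply: continuous_measurable_fun.
apply: (@is_derive1_continuous _ _ (expsin' sg c q)) => s.
exact: is_derive_expsin.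
Qed.

Let mX : measurable_fun D X.
Proof.
apply: measurable_funM; first apply: measurable_funM => //.
  by apply: measurable_funX; exact: measurable_test teta.
exact: (@measurableT_comp _ _ _ _ _ _ (fun t : R => t `^ p)).
Qed.

(** When [enorm_convex_combination] is integrated and combined with minimality, the energy of [u]
    cancels: only [kap] times the weighted energy and the integral of a constant remain. *)
Lemma caccioppoli : (\int[mu]_(x in D) (X x)%:E <=
  ((m%:R * K / (kap * lam * p)) `^ p / kap * V)%:E)%E.
Proof.
set B := (m%:R * K / (kap * lam * p)) `^ p.
have lp0 : 0 < lam * p by exact: mulr_gt0.
have lpi0 : 0 <= (lam * p)^-1 by rewrite invr_ge0 ltW.
have [C C0 [FC F'C F'lip]] := expsin_bounds c sg2 (ltW lp0).
pose F := expsin sg c (lam * p); pose F' := expsin' sg c (lam * p).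
have dF t : is_derive t (1 : R) F (F' t) by exact: is_derive_expsin.
have sF (f : 'rV[R]_n -> R) : smooth f -> smooth (F \o f) by exact: smooth_expsin.
have [Ceta _ _] := teta.
pose zeta x := eta x ^+ m / (lam * p).
have m0 : (0 < m)%N by exact: ltn_trans m1.
have tzeta : test_function D zeta.
  apply: (test_function_sub _ teta).
    by apply: smoothM; [exact: smoothX|exact: smooth_cst].
  by move=> x /(test_function0 teta) e0; rewrite /zeta e0 expr0n gtn_eqF// mul0r.
have gzeta x : grad zeta x = (m%:R * eta x ^+ m.-1 / (lam * p)) *: grad eta x.
  apply/rowP => i; rewrite !mxE.
  rewrite (@partialM _ _ i (fun x => eta x ^+ m) (cst (lam * p)^-1)); last 2 first.
  - by apply: smooth_derivable; exact: smoothX.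
  - exact: derivable_cst.
  rewrite {1}/partial derive_cst mulr0 add0r partialX// /cst; ring.
have hm := minimal_chain dF sF C0 F'C F'lip tzeta sg1.
have {}hm : (norm_L D p%:E (fun x => enorm (v x)) <=
    norm_L D p%:E (fun x => enorm (v x + sg *: chain_grad D u F F' zeta x)%R))%E.
  apply: hm => phi tphi; apply: hmin => // x.
    rewrite mulr_ge0 ?(ltW (expsin_gt0 _ _ _ _))// /zeta mulr_ge0// exprn_ge0//.
    by have /andP[] := eta01 x.
  by move=> e0; rewrite /zeta e0 expr0n gtn_eqF//= !mul0r.
have pw x : D x -> enorm (v x + sg *: chain_grad D u F F' zeta x) `^ p <=
    enorm (v x) `^ p - kap * X x + B.
  move=> Dx; have f1 : 0 < F (u x) <= 1.
    by rewrite expsin_gt0/= expR_le1 oppr_le0 mulr_ge0 ?(ltW lp0) ?usin.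
  have cs : kap <= cos (c + sg * u x) <= 1 by rewrite ucos// cos_le1.
  have := enorm_convex_combination (v x) p1 lam0 kap0 (ltW K0) pm m1 sg2
    (eta01 x) f1 cs (etaK x).
  by rewrite /chain_grad gzeta.
have mE : measurable_fun D (fun x => (enorm (v x) `^ p)%:E).
  have := measurable_norm_powR p menv; apply: eq_measurable_fun => x _.
  by rewrite ger0_norm ?enorm_ge0.
have mW i := measurable_chain_grad Wu dF C0 F'lip tzeta i.
have mE' : measurable_fun D
    (fun x => (enorm (v x + sg *: chain_grad D u F F' zeta x) `^ p)%:E).
  apply/measurable_EFinP; apply: (@measurableT_comp _ _ _ _ _ _ (fun t : R => t `^ p)).
    exact: measurable_powR.
  apply: measurable_enorm => i.
  have mB : measurable_fun D (fun x => v x ord0 i + sg * chain_grad D u F F' zeta x ord0 i).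
    by apply: measurable_funD; [have [[_ _ /(_ i)[]]] := Wu|exact: measurable_funM].
  by apply: eq_measurable_fun mB => x _; rewrite [in RHS]mxE [X in _ = _ + X]mxE.
have {}hm : (\int[mu]_(x in D) (enorm (v x) `^ p)%:E <=
    \int[mu]_(x in D) (enorm (v x + sg *: chain_grad D u F F' zeta x) `^ p)%:E)%E.
  move: hm => /(@gt0_ler_poweR _ p (ltW p0)).
  rewrite !in_itv/= !leey !norm_L_ge0 => /(_ isT isT).
  by rewrite (poweR_norm_L_enorm v) (poweR_norm_L_enorm (fun x => v x + sg *: _)).
have mkX : measurable_fun D (fun x => (kap * X x)%:E).
  by apply/measurable_EFinP; exact: measurable_funM.
have kX0 x : 0 <= kap * X x by rewrite mulr_ge0 ?(ltW kap0).
have B0 : 0 <= B by exact: powR_ge0.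
pose A x := enorm (v x) `^ p.
pose A' x := enorm (v x + sg *: chain_grad D u F F' zeta x) `^ p.
have A0 x : D x -> (0 <= (A x)%:E)%E by rewrite lee_fin powR_ge0.
have A'0 x : D x -> (0 <= (A' x)%:E)%E by rewrite lee_fin powR_ge0.
have kX0' x : D x -> (0 <= (kap * X x)%:E)%E by rewrite lee_fin.
have cB0 x : D x -> (0 <= (cst B%:E : 'rV[R]_n -> \bar R) x)%E by rewrite lee_fin.
have s1 := @ge0_integralD _ _ _ mu D mD (EFin \o A') (fun x => (kap * X x)%:E)
  A'0 mE' kX0' mkX.
have s2 := @ge0_integralD _ _ _ mu D mD (EFin \o A) (cst B%:E) A0 mE cB0 (measurable_cst _).
have sum : (\int[mu]_(x in D) (A' x)%:E + \int[mu]_(x in D) (kap * X x)%:E <=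
    \int[mu]_(x in D) (A x)%:E + \int[mu]_(x in D) B%:E)%E.
  apply: (@le_trans _ _ (\int[mu]_(x in D) ((A' x)%:E + (kap * X x)%:E))%E).
    by rewrite s1.
  apply: (@le_trans _ _ (\int[mu]_(x in D) ((A x)%:E + B%:E))%E); last by rewrite s2.
  apply: ge0_le_integral => //.
  - by move=> x Dx; apply: adde_ge0; [exact: A'0|exact: kX0'].
  - exact: emeasurable_funD.
  - by apply: emeasurable_funD => //; exact: measurable_cst.
  - by move=> x Dx; rewrite -!EFinD lee_fin; have := pw x Dx; rewrite /A /A'; lra.
(* The energy can be cancelled from an inequality in the extended reals because it is finite. *)
have Efin : (\int[mu]_(x in D) (enorm (v x) `^ p)%:E)%E \is a fin_num.
  rewrite ge0_fin_numE; last exact: integral_ge0 A0.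
  rewrite -(poweR_norm_L_enorm v); apply: poweR_lty.
  exact: (enorm_weak_gradient_lty oD p1 Wu).
have : (\int[mu]_(x in D) (kap * X x)%:E <= \int[mu]_(x in D) B%:E)%E.
  by rewrite -(leeD2lE _ _ Efin); apply: le_trans sum; exact: leeD2r.
have -> : (\int[mu]_(x in D) B%:E = (B * V)%:E)%E.
  by rewrite integral_cst// EFinM -muDE.
have X0' x : D x -> (0 <= (X x)%:E)%E by rewrite lee_fin.
have mX' : measurable_fun D (EFin \o X) by apply/measurable_EFinP.
have kapE : (0 <= kap%:E)%E by rewrite lee_fin ltW.
rewrite (@ge0_integralZl _ _ _ mu D mD (EFin \o X) mX' kap%:E X0' kapE).
rewrite -lee_pdivlMl// -EFinM.
by rewrite (_ : B / kap * V = kap^-1 * (B * V))//; ring.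
Qed.

(** Young's inequality in the form b <= 1 + b^p / p. It is applied with [h] the value of exp (- lam
    sin (c + sg u)) and [A] that of |grad u|: then h^p is the weight of [caccioppoli], and lam h A
    bounds the gradient of that exponential. *)
Lemma log_gradient_pointwise (z M c0 e A h : R) :
  `|z| <= M -> 0 < c0 <= 1 -> (z != 0 -> c0 <= e) -> 0 <= e -> 0 <= A -> 0 < h ->
  `|z| * (lam * h * A) <= 2 * K / (kap * c0 ^+ 2) *
    (`|z| + M / p * (kap * lam / (2 * K)) `^ p * (e ^+ m * h `^ p * A `^ p)).
Proof.
move=> zM /andP[c00 c01] ze e0 A0 h0.
have M0 : 0 <= M by exact: le_trans zM.
have K2 : 0 < 2 * K / (kap * c0 ^+ 2) by rewrite divr_gt0 ?mulr_gt0// exprn_gt0.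
have [->|z0] := eqVneq z 0.
  rewrite normr0 mul0r add0r mulr_ge0 ?(ltW K2)// !mulr_ge0 ?powR_ge0 ?exprn_ge0//.
  by rewrite invr_ge0 ltW.
(* The factor kap lam / (2 K) is chosen against the constant of [caccioppoli], as m K / (kap lam p)
   <= 2 K / (kap lam). The factor c0^2 yields the cut-off after the power p, by c0^(2 p) <= c0^m <=
   e^m, since m <= 2 p. *)
pose b := kap * lam / (2 * K) * (c0 ^+ 2 * (h * A)).
have b0 : 0 <= b.
  by rewrite /b !mulr_ge0 ?exprn_ge0 ?invr_ge0 ?mulr_ge0 ?(ltW kap0) ?(ltW lam0) ?(ltW K0) ?(ltW c00) ?(ltW h0).
have -> : lam * h * A = 2 * K / (kap * c0 ^+ 2) * b.
  by rewrite /b; field; rewrite !gt_eqF.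
rewrite mulrCA ler_wpM2l ?(ltW K2)//.
have young : b <= 1 + b `^ p / p.
  (* The conjugate exponent p / (p - 1) makes sense for p > 1 only. *)
  have [->|pn1] := eqVneq p 1; first by rewrite powRr1// divr1 lerDr.
  have pg1 : 1 < p by rewrite lt_neqAle eq_sym pn1.
  have p10 : 0 < p - 1 by rewrite subr_gt0.
  have := @conjugate_powR R b 1 p (p / (p - 1)) b0 ler01 p0.
  rewrite divr_gt0// mulr1 powR1 => /(_ isT) h1.
  apply: le_trans (h1 _) _; first by field; rewrite !gt_eqF.
  rewrite addrC lerD2r mul1r invf_le1 ?divr_gt0// ler_pdivlMr// mul1r; lra.
apply: (@le_trans _ _ (`|z| * (1 + b `^ p / p))); first by rewrite ler_wpM2l.
rewrite mulrDr mulr1 lerD2l.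
have bp : b `^ p <= (kap * lam / (2 * K)) `^ p * (e ^+ m * h `^ p * A `^ p).
  rewrite /b powRM; last 2 first.
  - by rewrite !mulr_ge0 ?invr_ge0 ?mulr_ge0 ?(ltW kap0) ?(ltW lam0) ?(ltW K0).
  - by rewrite !mulr_ge0 ?exprn_ge0 ?(ltW c00) ?(ltW h0).
  rewrite ler_wpM2l ?powR_ge0//.
  rewrite powRM ?exprn_ge0 ?(ltW c00) ?mulr_ge0 ?(ltW h0)//.
  rewrite powRM ?(ltW h0)// mulrA ler_wpM2r ?powR_ge0// ler_wpM2r ?powR_ge0//.
  rewrite -powR_mulrn ?(ltW c00)// -powRrM.
  apply: (@le_trans _ _ (c0 `^ m%:R)).
    by apply: ger_powR => //; rewrite c00.
  rewrite powR_mulrn ?(ltW c00)//; apply: lerXn2r; rewrite ?nnegrE ?(ltW c00)//.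
  exact: ze.
have pi0 : 0 <= p^-1 by rewrite invr_ge0 ltW.
have zPQ := ler_pM (normr_ge0 z) (powR_ge0 b p) zM bp.
rewrite [leLHS](_ : _ = p^-1 * (`|z| * b `^ p)); last by ring.
rewrite [leRHS](_ : _ = p^-1 * (M * ((kap * lam / (2 * K)) `^ p * (e ^+ m * h `^ p * A `^ p)))); last by ring.
by rewrite ler_wpM2l.
Qed.

(** Up to sign, by [integral_chain_grad], the integral on the left is that of zeta H'(u) times a
    component of the gradient, and |H'| <= lam H. Then [log_gradient_pointwise] and [caccioppoli]
    meet: the p-th powers of their constants cancel, and the only trace of p is a term of order 1 /
    p. *)
Lemma log_estimate zeta i (M c0 : R) : test_function D zeta ->
  (forall x, `|zeta x| <= M) -> 0 < c0 <= 1 ->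
  (forall x, zeta x != 0 -> c0 <= eta x) ->
  (`|\int[mu]_(x in D) (expsin sg c lam (u x) * partial i zeta x)%:E| <=
   (2 * K / (kap * c0 ^+ 2))%:E *
   (\int[mu]_(x in D) `|zeta x|%:E + (M * V / (kap * p))%:E))%E.
Proof.
move=> tzeta zM c001 zeta0; have /andP[c00 c01] := c001.
have M0 : 0 <= M by exact: le_trans (zM 0).
have lp0 : 0 < lam * p by exact: mulr_gt0.
set K2 := 2 * K / (kap * c0 ^+ 2).
have K20 : 0 < K2 by rewrite divr_gt0 ?mulr_gt0// exprn_gt0.
have [C C0 [HC H'C H'lip]] := expsin_bounds c sg2 (ltW lam0).
pose H := expsin sg c lam; pose H' := expsin' sg c lam.
have dH t : is_derive t (1 : R) H (H' t) by exact: is_derive_expsin.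
have sH (f : 'rV[R]_n -> R) : smooth f -> smooth (H \o f) by exact: smooth_expsin.
have W0 := integral_chain_grad dH sH C0 HC H'C H'lip tzeta i.
have tdz := test_function_partial i tzeta.
have [M' M'0 dzM] := test_function_bounded tdz.
pose a1 x := zeta x * H' (u x) * v x ord0 i.
pose a2 x := H (u x) * partial i zeta x.
have mv : measurable_fun D (fun x => v x ord0 i) by have [[_ _ /(_ i)[]]] := Wu.
have cH' : continuous H'.
  move=> t; apply/cvgrPdist_lt => e e0; near=> y.
  apply: (le_lt_trans (H'lip t y)); apply: (@le_lt_trans _ _ ((C + 1) * `|t - y|)).
    by rewrite ler_wpM2r// lerDl.
  rewrite -ltr_pdivlMl; last by rewrite ltr_wpDl.
  near: y; apply: cvgr_dist_lt => //; rewrite mulr_gt0// invr_gt0 ltr_wpDl//.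
have ma1 : measurable_fun D a1.
  apply: measurable_funM => //; apply: measurable_funM; first exact: measurable_test.
  by apply: measurableT_comp => //; exact: continuous_measurable_fun.
have ma2 : measurable_fun D a2.
  by apply: measurable_funM; [exact: mexpsin|exact: measurable_test].
have ia2 : mu.-integrable D (EFin \o a2).
  apply: measurable_bounded_integrable => //.
  exists (C * M'); split; first exact: num_real.
  move=> r rC x Dx; apply: (le_trans _ (ltW rC)); rewrite normrM.
  exact: (ler_pM (normr_ge0 _) (normr_ge0 _) (HC _) (dzM _)).
have ia1 : mu.-integrable D (EFin \o a1).
  apply: (norm_L_integrable oD muD p1) => //.
  apply: (@le_lt_trans _ _ (norm_L D p%:E (fun x => M * C * enorm (v x)))).
    apply: le_norm_L => //; first exact: measurable_funM.
    apply: aeW => x Dx; rewrite /a1 [in leRHS]normrM (normrM (zeta x * H' (u x))) (normrM (zeta x)) (normrM M).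
    rewrite [`|enorm _|]ger0_norm ?enorm_ge0// (ger0_norm M0) (ger0_norm C0).
    apply: ler_pM; rewrite ?mulr_ge0//; last exact: ler_coord_enorm.
    exact: (ler_pM (normr_ge0 _) (normr_ge0 _) (zM x) (H'C _)).
  rewrite (norm_LZ mD p1)// lte_mul_pinfty ?lee_fin//.
  exact: (enorm_weak_gradient_lty oD p1 Wu).
have E : (\int[mu]_(x in D) (a1 x)%:E + \int[mu]_(x in D) (a2 x)%:E = 0)%E.
  rewrite -integralD// -W0; apply: eq_integral => x _.
  by rewrite -EFinD /chain_grad !mxE.
have f1 := integrable_fin_num mD ia1; have f2 := integrable_fin_num mD ia2.
have -> : (`|\int[mu]_(x in D) (a2 x)%:E| = `|\int[mu]_(x in D) (a1 x)%:E|)%E.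
  move: E; rewrite -(fineK f1) -(fineK f2) -EFinD => -[] /eqP.
  by rewrite addr_eq0 => /eqP ->; rewrite !abse_EFin normrN.
apply: le_trans (le_abse_integral mu mD (measurable_int _ ia1)) _.
pose Q := M / p * (kap * lam / (2 * K)) `^ p.
have Q0 : 0 <= Q by rewrite /Q mulr_ge0 ?powR_ge0// mulr_ge0// invr_ge0 ltW.
have mz : measurable_fun D (fun x => `|zeta x|%:E).
  by apply/measurable_EFinP; apply: measurable_norm; exact: measurable_test.
have mXE : measurable_fun D (EFin \o X) by apply/measurable_EFinP.
have mQX : measurable_fun D (fun x => Q%:E * (X x)%:E)%E by exact: measurable_funeM.
have QX0 x : D x -> (0 <= Q%:E * (X x)%:E)%E by rewrite lee_fin mulr_ge0.
have z0 x : D x -> (0 <= `|zeta x|%:E)%E by rewrite lee_fin.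
have s1 := @ge0_integralD _ _ _ mu D mD (fun x => `|zeta x|%:E)
  (fun x => Q%:E * (X x)%:E)%E z0 mz QX0 mQX.
have mS : measurable_fun D (fun x => `|zeta x|%:E + Q%:E * (X x)%:E)%E.
  exact: emeasurable_funD.
have S0 x : D x -> (0 <= `|zeta x|%:E + Q%:E * (X x)%:E)%E.
  by move=> Dx; apply: adde_ge0; [exact: z0|exact: QX0].
have K2E : (0 <= K2%:E)%E by rewrite lee_fin ltW.
apply: (@le_trans _ _ (\int[mu]_(x in D) (K2%:E * (`|zeta x|%:E + Q%:E * (X x)%:E)))%E).
  apply: ge0_le_integral => //.
  - by apply: measurableT_comp => //; exact/measurable_EFinP.
  - exact: measurable_funeM.
  - move=> x Dx; rewrite abse_EFin; change ((`|a1 x|)%:E <= (K2 * (`|zeta x| + Q * X x))%:E)%E.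
    rewrite lee_fin; have /andP[e0 _] := eta01 x.
    have := @log_gradient_pointwise (zeta x) M c0 (eta x) (enorm (v x)) (H (u x))
      (zM x) c001 (zeta0 x) e0 (enorm_ge0 _) (expsin_gt0 _ _ _ _).
    rewrite /H expsin_powR -/K2 -/Q => h; apply: le_trans h.
    rewrite /a1 (normrM (zeta x * H' (u x))) (normrM (zeta x)) -mulrA ler_wpM2l//; apply: ler_pM => //; last exact: ler_coord_enorm.
    rewrite /H' /expsin' normrM normrN !normrM sg1 mulr1 (gtr0_norm lam0).
    rewrite (gtr0_norm (expsin_gt0 _ _ _ _)) ler_wpM2r ?(ltW (expsin_gt0 _ _ _ _))//.
    by rewrite -[leRHS]mulr1 ler_wpM2l ?cos_max// ltW.
rewrite (@ge0_integralZl _ _ _ mu D mD _ mS K2%:E S0 K2E).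
apply: lee_wpmul2l => //; rewrite s1; apply: leeD2l.
have X0' x : D x -> (0 <= (X x)%:E)%E by rewrite lee_fin.
have QE : (0 <= Q%:E)%E by rewrite lee_fin.
rewrite (@ge0_integralZl _ _ _ mu D mD (EFin \o X) mXE Q%:E X0' QE).
apply: le_trans (lee_wpmul2l QE caccioppoli) _.
rewrite -EFinM lee_fin /Q.
have KK : 0 <= kap * lam / (2 * K).
  by rewrite !mulr_ge0 ?invr_ge0 ?mulr_ge0 ?(ltW kap0) ?(ltW lam0) ?(ltW K0).
have mm : 0 <= m%:R * K / (kap * lam * p).
  by rewrite !mulr_ge0 ?invr_ge0 ?mulr_ge0 ?(ltW kap0) ?(ltW lam0) ?(ltW K0) ?(ltW p0).
set s := (_ / (2 * K)) `^ p; set t := (m%:R * K / _) `^ p.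
(* The product is (m / (2 p))^p: [lam], [kap] and [K] cancel, and m <= 2 p gives the bound. *)
have st : s * t <= 1.
  have p11 : 1 `^ p = 1 :> R by rewrite powR1.
  rewrite /s /t -powRM// -[leRHS]p11; apply: ge0_ler_powR; rewrite ?nnegrE ?(ltW p0)//.
    exact: mulr_ge0.
  rewrite [leLHS](_ : _ = m%:R / (2 * p)); last by field; rewrite !gt_eqF.
  by rewrite ler_pdivrMr ?mul1r// mulr_gt0.
have MVk : 0 <= M * V / (kap * p).
  by rewrite !mulr_ge0 ?invr_ge0 ?mulr_ge0 ?(ltW kap0) ?(ltW p0).
have -> : M / p * s * (t / kap * V) = (s * t) * (M * V / (kap * p)).
  by field; rewrite !gt_eqF.
by rewrite ler_piMl.
Unshelve. all: by end_near. Qed.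

End caccioppoli.

(** * The limit [p -> oo] *)

Lemma uniform_cvgP {R : realType} n (D : set 'rV[R]_n) (u : nat -> 'rV[R]_n -> R) v :
  {uniform D, u k @[k --> \oo] --> v} ->
  forall e, 0 < e -> \forall k \near \oo, forall x, D x -> `|v x - u k x| < e.
Proof.
move=> cu e e0.
have : nbhs (v : {uniform` D -> R}) [set h | forall x, D x -> `|v x - (h : 'rV[R]_n -> R) x| < e].
  apply/uniform_nbhs; exists [set xy | `|xy.1 - xy.2| < e]; split=> //.
  exact: (entourage_ball (R : pseudoMetricType R) (PosNum e0)).
move=> /cu; exact.
Qed.

Section log_limit.
Context {R : realType} {n : nat}.
Variables (D : set 'rV[R]_n) (p : nat -> R) (u : nat -> 'rV[R]_n -> R).
Variable uoo : 'rV[R]_n -> R.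
Hypotheses (oD : open D) (muD : (lebesgue_rV n D < +oo)%E).
Hypotheses (p1 : forall k, 1 <= p k) (poo : p k @[k --> \oo] --> +oo).
Hypothesis Wu : forall k, W10 D (p k) (u k).
Hypothesis cvu : {uniform D, u k @[k --> \oo] --> uoo}.
Hypothesis muoo : measurable_fun D uoo.
Variables (sg c K kap : R) (eta : 'rV[R]_n -> R).
Hypotheses (sg2 : sg ^+ 2 = 1) (kap0 : 0 < kap).
Hypotheses (teta : test_function D eta) (eta01 : forall x, 0 <= eta x <= 1).
Hypotheses (etaK : forall x, enorm (grad eta x) <= K) (K0 : 0 < K).
Hypothesis ucos : forall k x, D x -> kap <= cos (c + sg * u k x).
Hypothesis usin : forall k x, D x -> 0 <= sin (c + sg * u k x).
Hypothesis hmin : \forall k \near \oo, forall phi, test_function D phi ->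
  (forall x, 0 <= phi x) -> (forall x, eta x = 0 -> phi x = 0) ->
  (norm_L D (p k)%:E (fun x => enorm (weak_gradient D (u k) x)) <=
   norm_L D (p k)%:E (fun x => enorm (weak_gradient D (u k) x + sg *: grad phi x)%R))%E.
Local Notation mu := (@lebesgue_rV R n).
Local Notation V := (fine (mu D)).

(** In [log_estimate] the left side converges, because exp (- lam sin) is Lipschitz and the
    convergence to [uoo] is uniform, and the term of order 1 / p disappears. What matters in the
    result is that its constant does not involve [lam]. *)
Lemma log_limit lam zeta i (c0 : R) : 0 < lam -> test_function D zeta ->
  0 < c0 <= 1 -> (forall x, zeta x != 0 -> c0 <= eta x) ->
  (`|\int[mu]_(x in D) (expsin sg c lam (uoo x) * partial i zeta x)%:E| <=
   (2 * K / (kap * c0 ^+ 2))%:E * \int[mu]_(x in D) `|zeta x|%:E)%E.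
Proof.
move=> lam0 tzeta c001 zeta0; have /andP[c00 c01] := c001.
have mD : measurable D := measurable_open oD.
have muDE : mu D = V%:E by rewrite fineK// ge0_fin_numE.
have V0 : 0 <= V by rewrite fine_ge0.
set K2 := 2 * K / (kap * c0 ^+ 2).
have K20 : 0 < K2 by rewrite divr_gt0 ?mulr_gt0// exprn_gt0.
have [M M0 zM] := test_function_bounded tzeta.
have tdz := test_function_partial i tzeta.
have [M' M'0 dzM] := test_function_bounded tdz.
have [C C0 [HC H'C _]] := expsin_bounds c sg2 (ltW lam0).
have Hlip s t : `|expsin sg c lam s - expsin sg c lam t| <= C * `|s - t|.
  by apply: lipschitz_of_is_derive H'C => x; exact: is_derive_expsin.
have mH : measurable_fun setT (expsin sg c lam).
  apply: continuous_measurable_fun; apply: (@is_derive1_continuous _ _ (expsin' sg c lam)) => s.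
  exact: is_derive_expsin.
have iH (v : 'rV[R]_n -> R) : measurable_fun D v ->
    mu.-integrable D (fun x => (expsin sg c lam (v x) * partial i zeta x)%:E).
  move=> mv; apply: measurable_bounded_integrable => //.
    by apply: measurable_funM; [exact: measurableT_comp|exact: measurable_test].
  exists (C * M'); split; first exact: num_real.
  move=> r rC x Dx; apply: (le_trans _ (ltW rC)); rewrite normrM.
  exact: (ler_pM (normr_ge0 _) (normr_ge0 _) (HC _) (dzM _)).
apply/lee_addgt0Pr => e e0.
(* A uniform distance [d] changes the integral by at most C M' V d <= e / 2; the 1 keeps the
   denominator positive. *)
pose d := e / 2 / (C * M' * V + 1).
have CMV : 0 <= C * M' * V by rewrite !mulr_ge0// ltW.
have CMV1 : 0 < C * M' * V + 1 by rewrite ltr_wpDl.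
have d0 : 0 < d by rewrite !divr_gt0.
have nu := uniform_cvgP cvu d0.
have np : \forall k \near \oo, K2 * (M * V / kap) / (e / 2) <= p k.
  by move/cvgryPge : poo; exact.
have [k [hk pk uk]] : exists k, [/\ forall phi, test_function D phi ->
  (forall x, 0 <= phi x) -> (forall x, eta x = 0 -> phi x = 0) ->
  (norm_L D (p k)%:E (fun x => enorm (weak_gradient D (u k) x)) <=
   norm_L D (p k)%:E (fun x => enorm (weak_gradient D (u k) x + sg *: grad phi x)%R))%E,
  K2 * (M * V / kap) / (e / 2) <= p k & forall x, D x -> `|uoo x - u k x| < d].
  apply: (@filter_ex _ \oo); near=> k; split; [near: k|near: k|near: k].
  - exact: hmin.
  - exact: np.
  - exact: nu.
have p0 : 0 < p k by exact: lt_le_trans (p1 k).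
(* An integer between p and 2 p that exceeds 1, all because p >= 1. *)
pose m := (Num.truncn (p k)).+1.
have pm : p k <= m%:R by rewrite ltW// truncnS_gt.
have m1 : (1 < m)%N by rewrite ltnS truncn_gt0.
have m2p : m%:R <= 2 * p k.
  rewrite /m -natr1; have := p1 k.
  have : (Num.truncn (p k))%:R <= p k by rewrite truncn_le ltW.
  lra.
have := log_estimate oD muD (p1 k) (Wu k) sg2 lam0 kap0 pm m2p m1 teta eta01 etaK K0
  (ucos k) (usin k) hk i tzeta zM c001 zeta0.
rewrite -/K2 => est.
have mvk : measurable_fun D (u k) by have [[[]]] := Wu k.
have ik := iH _ mvk; have ioo := iH _ muoo.
have -> : (\int[mu]_(x in D) (expsin sg c lam (uoo x) * partial i zeta x)%:E =
   \int[mu]_(x in D) (expsin sg c lam (u k x) * partial i zeta x)%:E +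
   \int[mu]_(x in D) ((expsin sg c lam (uoo x) - expsin sg c lam (u k x)) * partial i zeta x)%:E)%E.
  rewrite -integralD//; first by apply: eq_integral => x _; rewrite -EFinD; congr EFin; ring.
  have := integrableB mD ioo ik; apply: eq_integrable => // x _.
  by rewrite -EFinB mulrBl.
apply: le_trans (lee_abs_add _ _) _.
have e2 : (e%:E = (e / 2)%:E + (e / 2)%:E)%E by rewrite -EFinD -splitr.
rewrite e2 addeA; apply: leeD.
  apply: le_trans est _.
  rewrite muleDr//.
  apply: leeD2l; rewrite -EFinM lee_fin.
  move: pk; rewrite ler_pdivrMr ?divr_gt0// => pk.
  rewrite [leLHS](_ : _ = K2 * (M * V / kap) / p k); last by rewrite invfM; ring.
  by rewrite ler_pdivrMr// [leRHS]mulrC.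
  rewrite ge0_adde_def// inE ?lee_fin; first exact: integral_ge0.
  by rewrite !mulr_ge0 ?invr_ge0 ?mulr_ge0 ?(ltW kap0) ?(ltW p0) ?(ltW M0).
have mB : measurable_fun D (fun x => ((expsin sg c lam (uoo x) - expsin sg c lam (u k x)) *
    partial i zeta x)%:E).
  have := measurable_int _ (integrableB mD ioo ik); apply: eq_measurable_fun => x _.
  by rewrite -EFinB mulrBl.
apply: le_trans (le_abse_integral mu mD mB) _.
apply: (@le_trans _ _ (\int[mu]_(x in D) (C * d * M')%:E)%E).
  apply: ge0_le_integral => //.
  - exact: measurableT_comp.
  - move=> x Dx; rewrite abse_EFin lee_fin normrM.
    apply: ler_pM => //; apply: (le_trans (Hlip _ _)).
    by rewrite ler_wpM2l// ltW// uk.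
rewrite [X in (X <= _)%E](_ : _ = (C * d * M' * V)%:E); last first.
  by rewrite integral_cst// [RHS]EFinM -muDE.
rewrite lee_fin.
rewrite (_ : C * d * M' * V = (C * M' * V) / (C * M' * V + 1) * (e / 2)); last by rewrite /d; ring.
by rewrite ler_piMl ?divr_ge0 ?(ltW e0)// ler_pdivrMr// mul1r lerDl.
Unshelve. all: by end_near. Qed.

End log_limit.

(** * From a weak derivative bound to a Lipschitz bound *)

Section coordinate_lipschitz.
Context {R : realType} {n : nat}.
Local Notation mu := (@lebesgue_rV R n).

Lemma partial_indep (P : 'rV[R]_n -> R) i x :
  (forall t, P (t *: delta_mx ord0 i + x) = P x) -> partial i P x = 0.
Proof.
move=> Pi; rewrite /partial /derive.
rewrite (_ : (fun h => _) = cst 0); first by rewrite lim_cst.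
by apply/funext => h; rewrite /= Pi subrr scaler0.
Qed.

Lemma ge0_integral_prod_coord1 (g : R -> R) (w : 'I_n -> R -> R) i (c : R) :
  measurable_fun setT g -> (forall t, 0 <= g t) ->
  (\int[lebesgue_measure]_t (g t)%:E = c%:E)%E ->
  (forall j, [/\ measurable_fun setT (w j), forall t, 0 <= w j t &
    (\int[lebesgue_measure]_t (w j t)%:E = 1%:E)%E]) ->
  (\int[mu]_x (g (x ord0 i) * \prod_(j | j != i) w j (x ord0 j))%:E = c%:E)%E.
Proof.
move=> mg g0 gc Hw; pose f j := if j == i then g else w j.
have pc : \prod_j (if j == i then c else 1) = c.
  by rewrite (bigD1 i)//= eqxx big1 ?mulr1 => // j /negbTE ->.
rewrite -[in RHS]pc -(ge0_integral_prod_coord (f := f)).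
- apply: eq_integral => x _; rewrite [in RHS](bigD1 i)//= /f eqxx; congr (_ * _)%:E.
  by apply: eq_bigr => j /negbTE ->.
- by move=> j; rewrite /f; case: eqP => // _; have [] := Hw j.
- by move=> j; rewrite /f; case: eqP => // _; have [] := Hw j.
- by move=> j; rewrite /f; case: eqP => // _; have [] := Hw j.
Qed.

Lemma local_mean (D : set 'rV[R]_n) (h B : 'rV[R]_n -> R) x (e : R) : measurable D ->
  measurable_fun D h -> measurable_fun setT B -> (forall z, 0 <= B z) ->
  (\int[mu]_z (B z)%:E = 1%:E)%E -> 0 <= e ->
  (forall z, B z != 0 -> D z /\ `|h x - h z| <= e) ->
  mu.-integrable D (fun z => (h z * B z)%:E) /\
  (`|\int[mu]_(z in D) (h z * B z)%:E - (h x)%:E| <= e%:E)%E.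
Proof.
move=> mD mh mB B0 B1 e0 Be.
have mBD : measurable_fun D B by exact: measurable_funTS.
have BD : (\int[mu]_(z in D) (B z)%:E = 1%:E)%E.
  rewrite -B1 integral_mkcond; apply: eq_integral => z _; rewrite patchE.
  case: ifPn => // zD; rewrite [in RHS](_ : B z = 0)//.
  by apply/eqP; apply: contraNT zD => /Be[Dz _]; rewrite inE.
have iB : mu.-integrable D (fun z => (B z)%:E).
  apply/integrableP; split; first exact/measurable_EFinP.
  under eq_integral do rewrite /= ger0_norm//.
  by rewrite BD ltry.
have icB (c : R) : mu.-integrable D (fun z => (c * B z)%:E) by exact: (integrableZl mD c iB).
have cB (c : R) : (\int[mu]_(z in D) (c * B z)%:E = c%:E)%E.
  by under eq_integral do rewrite EFinM; rewrite integralZl// BD mule1.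
have mhB : measurable_fun D (fun z => (h z * B z)%:E).
  by apply/measurable_EFinP; exact: measurable_funM.
have ihB : mu.-integrable D (fun z => (h z * B z)%:E).
  apply: (le_integrable mD mhB _ (icB (`|h x| + e))) => z Dz.
  rewrite !abse_EFin lee_fin !normrM.
  have [->|Bz] := eqVneq (B z) 0; first by rewrite normr0 !mulr0.
  rewrite ler_wpM2r// [leRHS]ger0_norm ?addr_ge0//.
  have [_ hz] := Be _ Bz; rewrite -[h z](subrK (h x)) addrC.
  by apply: (le_trans (ler_normD _ _)); rewrite lerD2l distrC.
split=> //; rewrite -[X in (_ - X)%E](cB (h x)) -integralB//.
have E z : ((h z * B z)%:E - (h x * B z)%:E = ((h z - h x) * B z)%:E)%E.
  by rewrite -EFinB mulrBl.
under eq_integral do rewrite E.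
have mhB' : measurable_fun D (fun z => ((h z - h x) * B z)%:E).
  by apply/measurable_EFinP; apply: measurable_funM => //; exact: measurable_funB.
apply: le_trans (le_abse_integral mu mD mhB') _.
rewrite -[leRHS](cB e); apply: ge0_le_integral => //.
- exact: measurableT_comp.
- exact: measurable_int (icB e).
- move=> z Dz; rewrite abse_EFin lee_fin normrM [`|B z|]ger0_norm//.
  have [->|Bz] := eqVneq (B z) 0; first by rewrite !mulr0.
  by rewrite ler_wpM2r//; have [_] := Be _ Bz; rewrite distrC.
Qed.

(** The test function is (A1 - A2)(z_i) P(z), whose i-th derivative is a unit-mass kernel near x
    minus one near y: the weak bound then compares averages of [h] near the two points, and the
    integral of |psi| is at most y_i - x_i + 2 r. A single factor P suits both kernels because x and
    y agree in the other coordinates. *)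
Lemma coordinate_lipschitz (D : set 'rV[R]_n) (a b : 'I_n -> R) (h : 'rV[R]_n -> R)
    (K : R) i (x y : 'rV[R]_n) : open D -> cbox a b `<=` D -> measurable_fun D h ->
  (forall z, D z -> {for z, continuous h}) -> 0 <= K ->
  (forall psi, test_function D psi -> (forall z, ~ cbox a b z -> psi z = 0) ->
    (`|\int[mu]_(z in D) (h z * partial i psi z)%:E| <=
     K%:E * \int[mu]_(z in D) `|psi z|%:E)%E) ->
  obox a b x -> obox a b y -> (forall j, j != i -> x ord0 j = y ord0 j) ->
  x ord0 i <= y ord0 i -> `|h x - h y| <= K * (y ord0 i - x ord0 i).
Proof.
move=> oD abD mh ch K0 hK abx aby xy xyi; have mD := measurable_open oD.
apply/ler_addgt0Pr => e e0.
have K1 : 0 < 2 * (1 + K) by rewrite mulr_gt0// ltr_wpDr.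
(* The two averages cost e1 each, and the excess length 2 r costs 2 K r <= 2 K e1: together e. *)
pose e1 := e / (2 * (1 + K)).
have e10 : 0 < e1 by rewrite divr_gt0.
have room (z : 'rV[R]_n) : obox a b z -> exists2 r, 0 < r & forall w : 'rV[R]_n,
    (forall j, `|z ord0 j - w ord0 j| < r) -> obox a b w /\ `|h z - h w| <= e1.
  move=> abz; apply/nbhs_rVP; apply: filterI.
    by apply: open_nbhs_nbhs; split; [exact: open_obox|].
  have /cvgrPdist_le := ch z (abD _ (sub_obox_cbox abz)); exact.
have [rx rx0 Hx] := room x abx; have [ry ry0 Hy] := room y aby.
pose r := Num.min (Num.min rx ry) e1 / 2.
have m0 : 0 < Num.min (Num.min rx ry) e1 by rewrite !lt_min rx0 ry0.
have r0 : 0 < r by rewrite divr_gt0.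
have rm : r < Num.min (Num.min rx ry) e1 by rewrite /r ltr_pdivrMr//; lra.
have [rrx rry re1] : [/\ r < rx, r < ry & r < e1].
  by move: rm; rewrite !lt_min => /andP[/andP[]].
(* The cubes of half-side [r] about the two points stay inside the box, which will confine the
   support of [psi] to it. *)
have edge (z : 'rV[R]_n) (rz : R) : obox a b z -> r < rz ->
    (forall w : 'rV[R]_n, (forall j, `|z ord0 j - w ord0 j| < rz) -> obox a b w /\ `|h z - h w| <= e1) ->
    forall j, a j < z ord0 j - r /\ z ord0 j + r < b j.
  move=> abz rrz Hz j; split.
    have [|+ _] := Hz (\row_k (z ord0 k - r)).
      by move=> k; rewrite mxE opprB addrC subrK gtr0_norm.
    by move=> /(_ j); rewrite mxE => /andP[].
  have [|+ _] := Hz (\row_k (z ord0 k + r)).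
    by move=> k; rewrite mxE opprD addrA subrr sub0r normrN gtr0_norm.
  by move=> /(_ j); rewrite mxE => /andP[].
have edx := edge x rx abx rrx Hx; have edy := edge y ry aby rry Hy.
have lohi (t : R) : t - r < t + r by rewrite ltrBlDr -addrA ltrDl addr_gt0.
have [A1 [b1 [dA1 [b10 s1] [cb1 ib1] [A1lo A1hi A101] sm1]]] :=
  exists_smooth_step (lohi (x ord0 i)).
have [A2 [b2 [dA2 [b20 s2] [cb2 ib2] [A2lo A2hi A201] sm2]]] :=
  exists_smooth_step (lohi (y ord0 i)).
have /choice[w Hw] : forall j, exists wj : R -> R,
    [/\ forall t, 0 <= wj t, forall t, wj t != 0 -> x ord0 j - r < t < x ord0 j + r,
     continuous wj, (\int[lebesgue_measure]_t (wj t)%:E = 1%:E)%E &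
     smooth (fun z : 'rV[R]_n => wj (z ord0 j))].
  move=> j; have [A [wj [_ [w0 sw] [cw iw] _ sm]]] := exists_smooth_step (lohi (x ord0 j)).
  by exists wj; split=> //; exact: sm.
have mc (f : R -> R) : continuous f -> measurable_fun setT f.
  exact: continuous_measurable_fun.
have Hw' j : [/\ measurable_fun setT (w j), forall t, 0 <= w j t &
    (\int[lebesgue_measure]_t (w j t)%:E = 1%:E)%E].
  by have [w0 _ cw iw _] := Hw j; split=> //; exact: mc.
pose P (z : 'rV[R]_n) := \prod_(j | j != i) w j (z ord0 j).
have P0 z : 0 <= P z by apply: prodr_ge0 => j _; have [] := Hw j.
have sP : smooth P.
  rewrite (_ : P = fun z => \prod_(j <- [seq j <- index_enum 'I_n | j != i]) w j (z ord0 j)).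
    by apply: smooth_prod => j; have [] := Hw j.
  by apply/funext => z; rewrite big_filter.
have Pneq z j : j != i -> P z != 0 -> x ord0 j - r < z ord0 j < x ord0 j + r.
  move=> ji; rewrite /P (bigD1 j)//= mulf_eq0 negb_or => /andP[wz _].
  by have [_ + _ _ _] := Hw j; apply.
have Pi z t : P (t *: delta_mx ord0 i + z) = P z.
  by apply: eq_bigr => j ji; rewrite !mxE eqxx (negbTE ji) mulr0 add0r.
(* A smooth version of the indicator of the segment from x_i to y_i: it rises near x_i, falls near
   y_i and vanishes outside [x_i - r, y_i + r]. *)
pose S t := A1 t - A2 t.
have dS t : is_derive t (1 : R) S (b1 t - b2 t) by exact: is_deriveB.
have sS : smooth (fun z : 'rV[R]_n => S (z ord0 i)).
  apply: (smooth_primitive_coord dS (i := i)).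
  by apply: smoothD; [exact: sm1|apply: smoothN; exact: sm2].
have S1 t : `|S t| <= \1_(`[x ord0 i - r, y ord0 i + r]%classic) t.
  rewrite indicE; have [|] := boolP (_ \in _).
    move=> _; have /andP[? ?] := A101 t; have /andP[? ?] := A201 t.
    rewrite (_ : true%:R = 1 :> R)// /S ler_norml; apply/andP; split; lra.
  rewrite notin_setE/= in_itv/= => /negP; rewrite negb_and -!ltNge => /orP[tx|ty].
    by rewrite /S A1lo ?A2lo ?subrr ?normr0//; lra.
  by rewrite /S A1hi ?A2hi ?subrr ?normr0//; lra.
pose psi (z : 'rV[R]_n) := S (z ord0 i) * P z.
have spsi : smooth psi by exact: smoothM.
have psi0 z : ~ cbox a b z -> psi z = 0.
  move=> abz; apply/eqP; apply: contraT; rewrite mulf_eq0 negb_or => /andP[Sz Pz].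
  exfalso; apply: abz => j; have [ji|ji] := eqVneq j i.
    have := S1 (z ord0 i); rewrite ji indicE; have [|_] := boolP (_ \in _).
      rewrite inE/= in_itv/= => /andP[zx zy] _.
      have [ax _] := edx i; have [_ yb] := edy i.
      by rewrite (le_trans (ltW ax))//= (le_trans zy)// ltW.
    by rewrite /= normr_le0 (negbTE Sz).
  have [ax xb] := edx j; have /andP[zx zy] := Pneq z j ji Pz.
  by rewrite !ltW// ?(lt_trans ax)// (lt_trans zy).
have tpsi : test_function D psi by exact: test_function_cbox spsi psi0 abD.
have dpsi z : partial i psi z = b1 (z ord0 i) * P z - b2 (z ord0 i) * P z.
  rewrite (@partialM _ _ i (fun z => S (z ord0 i)) P); last 2 first.
  - exact: smooth_derivable.
  - exact: smooth_derivable.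
  rewrite (@partial_indep P)// mulr0 add0r -mulrBl; congr (_ * _).
  have dz := is_derive_coord i z (delta_mx ord0 i).
  rewrite (@partial_comp _ _ i S _ (fun z : 'rV[R]_n => z ord0 i) z dS); last by case: dz.
  by rewrite /partial; case: dz => _ ->; rewrite mxE !eqxx mulr1.
have mcoord (f : R -> R) : continuous f -> measurable_fun setT (fun z : 'rV[R]_n => f (z ord0 i) * P z).
  move=> cf; apply: measurable_funM.
    by apply: (measurableT_comp (mc _ cf)); exact: measurable_coord.
  by apply: continuous_measurable_fun_rV; exact: smooth_continuous.
have B1 : (\int[mu]_z (b1 (z ord0 i) * P z)%:E = 1%:E)%E.
  by apply: ge0_integral_prod_coord1 => //; exact: mc.
have B2 : (\int[mu]_z (b2 (z ord0 i) * P z)%:E = 1%:E)%E.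
  by apply: ge0_integral_prod_coord1 => //; exact: mc.
have near (z w0 : 'rV[R]_n) : (forall j, j != i -> x ord0 j = w0 ord0 j) ->
   w0 ord0 i - r < z ord0 i < w0 ord0 i + r -> P z != 0 ->
   forall j, `|w0 ord0 j - z ord0 j| < r.
  move=> xw zi Pz j; have [->|ji] := eqVneq j i; first by rewrite distrC ltr_distl.
  by rewrite -xw// distrC ltr_distl Pneq.
have [i1 m1] : mu.-integrable D (fun z => (h z * (b1 (z ord0 i) * P z))%:E) /\
  (`|\int[mu]_(z in D) (h z * (b1 (z ord0 i) * P z))%:E - (h x)%:E| <= e1%:E)%E.
  apply: local_mean => //; [exact: mcoord|by move=> z; rewrite mulr_ge0|exact: ltW|].
  move=> z; rewrite mulf_eq0 negb_or => /andP[bz Pz].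
  have [|/sub_obox_cbox/abD] := Hx z; last by [].
  by move=> j; apply: lt_trans rrx; apply: near => //; exact: s1.
have [i2 m2] : mu.-integrable D (fun z => (h z * (b2 (z ord0 i) * P z))%:E) /\
  (`|\int[mu]_(z in D) (h z * (b2 (z ord0 i) * P z))%:E - (h y)%:E| <= e1%:E)%E.
  apply: local_mean => //; [exact: mcoord|by move=> z; rewrite mulr_ge0|exact: ltW|].
  move=> z; rewrite mulf_eq0 negb_or => /andP[bz Pz].
  have [|/sub_obox_cbox/abD] := Hy z; last by [].
  by move=> j; apply: lt_trans rry; apply: near => //; exact: s2.
pose d := y ord0 i + r - (x ord0 i - r).
have d0 : 0 <= d by rewrite /d; lra.
have psid : (\int[mu]_(z in D) `|psi z|%:E <= d%:E)%E.
  have itv : (\int[lebesgue_measure]_t (\1_(`[x ord0 i - r, y ord0 i + r]%classic) t)%:E = d%:E)%E.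
    rewrite integral_indic// setIT [LHS]lebesgue_measure_itv/= lte_fin ifT//.
    by lra.
  rewrite -(ge0_integral_prod_coord1 (w := w) i _ _ itv Hw')//.
  have mpsi : measurable_fun setT (fun z : 'rV[R]_n => `|psi z|%:E).
    apply/measurable_EFinP; apply: measurable_norm.
    by apply: continuous_measurable_fun_rV; exact: smooth_continuous.
  apply: (@le_trans _ _ (\int[mu]_z `|psi z|%:E)%E).
    by apply: ge0_subset_integral.
  apply: ge0_le_integral => //.
  - apply/measurable_EFinP; apply: measurable_funM.
      by apply: (measurableT_comp (measurable_indic (measurable_itv _))); exact: measurable_coord.
    by apply: continuous_measurable_fun_rV; exact: smooth_continuous.
  - by move=> z _; rewrite lee_fin normrM (ger0_norm (P0 z)) ler_wpM2r.
have := hK psi tpsi psi0.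
rewrite (eq_integral (fun z => (h z * (b1 (z ord0 i) * P z))%:E - (h z * (b2 (z ord0 i) * P z))%:E)%E);
  last by move=> z _; rewrite dpsi mulrBr EFinB.
rewrite integralB//.
have f1 := integrable_fin_num mD i1; have f2 := integrable_fin_num mD i2.
move: m1 m2; rewrite -(fineK f1) -(fineK f2); set I1 := fine _; set I2 := fine _.
rewrite -!EFinB !abse_EFin !lee_fin => m1 m2 est.
have {}est : `|I1 - I2| <= K * d.
  by rewrite -lee_fin; apply: le_trans est _; rewrite EFinM lee_wpmul2l.
have -> : h x - h y = (I1 - I2) - (I1 - h x) + (I2 - h y) by ring.
apply: (le_trans (ler_normD _ _)); apply: (@le_trans _ _ (K * d + e1 + e1)).
  by apply: lerD => //; apply: (le_trans (ler_normB _ _)); exact: lerD.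
have eE : e = 2 * (1 + K) * e1 by rewrite /e1 mulrC divfK// gt_eqF.
have : K * r <= K * e1 by rewrite ler_wpM2l// ltW.
rewrite eE /d; lra.
Qed.

End coordinate_lipschitz.

(** * The limit [lam -> oo] *)

Section propagation.
Context {R : realType} {n : nat}.

Lemma lipschitz_along_coordinates (h : 'rV[R]_n -> R) (a b : 'I_n -> R) (K d : R) y z :
  0 <= K ->
  (forall i x x', obox a b x -> obox a b x' ->
    (forall j, j != i -> x ord0 j = x' ord0 j) -> x ord0 i <= x' ord0 i ->
    `|h x - h x'| <= K * (x' ord0 i - x ord0 i)) ->
  obox a b y -> obox a b z -> (forall j, `|y ord0 j - z ord0 j| <= d) ->
  `|h y - h z| <= n%:R * (K * d).
Proof.
move=> K0 hL aby abz yz.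
(* A path that changes the coordinates of [y] into those of [z] one at a time: consecutive points
   differ in a single coordinate, and all of them stay in the box. *)
pose w k : 'rV[R]_n := \row_j (if (j < k)%N then z ord0 j else y ord0 j).
have abw k : obox a b (w k) by move=> j; rewrite mxE; case: ifP.
have L (i : 'I_n) (x x' : 'rV[R]_n) : obox a b x -> obox a b x' ->
    (forall j, j != i -> x ord0 j = x' ord0 j) -> `|x ord0 i - x' ord0 i| <= d ->
    `|h x - h x'| <= K * d.
  move=> abx abx' xx' xd; have [xi|/ltW xi] := leP (x ord0 i) (x' ord0 i).
    apply: (le_trans (hL i x x' abx abx' xx' xi)); rewrite ler_wpM2l//.
    by apply: le_trans xd; rewrite distrC ler_norm.
  rewrite distrC; apply: (le_trans (hL i x' x abx' abx _ xi)).
    by move=> j ji; rewrite xx'.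
  by rewrite ler_wpM2l//; apply: le_trans xd; rewrite ler_norm.
have S k : (k <= n)%N -> `|h y - h (w k)| <= k%:R * (K * d).
  elim: k => [_|k IH kn].
    rewrite (_ : w 0%N = y) ?subrr ?normr0 ?mul0r//.
    by apply/rowP => j; rewrite mxE.
  have -> : h y - h (w k.+1) = (h y - h (w k)) + (h (w k) - h (w k.+1)) by ring.
  apply: (le_trans (ler_normD _ _)); rewrite -natr1 mulrDl mul1r.
  apply: lerD; first exact/IH/ltnW.
  apply: (L (Ordinal kn)) => //.
    move=> j jk; rewrite !mxE [in RHS]ltnS [in RHS]leq_eqVlt.
    by rewrite (_ : (nat_of_ord j == k) = false)//; apply/negbTE; apply: contra jk => /eqP jk; apply/eqP/val_inj.
  by rewrite !mxE/= ltnn ltnSn.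
have -> : z = w n by apply/rowP => j; rewrite mxE ltn_ord.
exact: S.
Qed.

Variables (D : set 'rV[R]_n) (p : nat -> R) (u : nat -> 'rV[R]_n -> R).
Variable uoo : 'rV[R]_n -> R.
Hypotheses (oD : open D) (muD : (lebesgue_rV n D < +oo)%E).
Hypotheses (p1 : forall k, 1 <= p k) (poo : p k @[k --> \oo] --> +oo).
Hypothesis Wu : forall k, W10 D (p k) (u k).
Hypothesis cvu : {uniform D, u k @[k --> \oo] --> uoo}.
Hypothesis muoo : measurable_fun D uoo.
Hypothesis cuoo : forall x, D x -> {for x, continuous uoo}.
Variables (sg c : R).
Hypothesis sg2 : sg ^+ 2 = 1.
Hypothesis u01 : forall k x, D x -> 0 <= c + sg * u k x <= 1.
Hypothesis uoo01 : forall x, D x -> 0 <= c + sg * uoo x <= 1.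

(** The function exp (- lam sin (c + sg uoo)) equals 1 at [y] and is Lipschitz near [y] with a
    constant free of [lam]. If the sine were positive at a nearby point, taking its inverse for
    [lam] would make the function drop to exp (- 1) there, which is too steep within a distance [d]
    fixed beforehand. *)
Lemma vanish_near a b y : cbox a b `<=` D -> obox a b y ->
  (\forall k \near \oo, forall phi, test_function D phi ->
    (forall x, 0 <= phi x) -> (forall x, ~ obox a b x -> phi x = 0) ->
    (norm_L D (p k)%:E (fun x => enorm (weak_gradient D (u k) x)) <=
     norm_L D (p k)%:E (fun x => enorm (weak_gradient D (u k) x + sg *: grad phi x)%R))%E) ->
  sin (c + sg * uoo y) = 0 -> \forall z \near y, sin (c + sg * uoo z) = 0.
Proof.
move=> abD aby hmin0 uy0.
have ab i : a i <= b i by have /andP[ay yb] := aby i; exact: ltW (lt_trans ay yb).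
pose eta := bump 1 a b.
have teta : test_function D eta by exact: bump_test.
have eta01 x : 0 <= eta x <= 1 by rewrite bump_ge0 bump_le1.
have [K K0 etaK] := test_function_grad_bounded teta.
have kap0 : 0 < cos 1 :> R by exact: cos1_gt0.
have ucos k x : D x -> cos 1 <= cos (c + sg * u k x).
  by move=> Dx; apply: cos_ge_cos1; exact: u01.
have usin k x : D x -> 0 <= sin (c + sg * u k x).
  by move=> Dx; apply: sin_ge0_01; exact: u01.
have hmin : \forall k \near \oo, forall phi, test_function D phi ->
    (forall x, 0 <= phi x) -> (forall x, eta x = 0 -> phi x = 0) ->
    (norm_L D (p k)%:E (fun x => enorm (weak_gradient D (u k) x)) <=
     norm_L D (p k)%:E (fun x => enorm (weak_gradient D (u k) x + sg *: grad phi x)%R))%E.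
  apply: filterS hmin0 => k hk phi tphi phi0 ephi; apply: hk => // x abx.
  by apply: ephi; exact: bump_eq0.
(* [eta] exceeds c0 on a smaller box about [y], which provides the lower bound on the cut-off that
   [log_limit] asks for. *)
pose c0 := eta y / 2.
have ey0 : 0 < eta y by exact: bump_gt0.
have c00 : 0 < c0 by rewrite divr_gt0.
have c01 : 0 < c0 <= 1.
  by rewrite c00/=; have /andP[_ e1] := eta01 y; rewrite /c0; lra.
have [Ceta _ _] := teta.
have [r r0 Hr] : exists2 r, 0 < r & forall w : 'rV[R]_n,
    (forall j, `|y ord0 j - w ord0 j| < r) -> obox a b w /\ c0 < eta w.
  apply/nbhs_rVP; apply: filterI.
    by apply: open_nbhs_nbhs; split; [exact: open_obox|].
  have cy := smooth_continuous Ceta.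
  by apply: (cy y [set t | c0 < t]); apply: lt_nbhsr; rewrite /c0; lra.
pose a' i := y ord0 i - r / 2; pose b' i := y ord0 i + r / 2.
have in' w : cbox a' b' w -> obox a b w /\ c0 < eta w.
  move=> abw; apply: Hr => j; have := abw j; rewrite /a' /b' => /andP[h1 h2].
  by rewrite distrC ltr_distl; apply/andP; split; lra.
have abD' : cbox a' b' `<=` D by move=> w /in'[/sub_obox_cbox/abD].
pose K2 := 2 * K / (cos 1 * c0 ^+ 2).
have K20 : 0 <= K2 by apply/ltW; rewrite divr_gt0 ?mulr_gt0 ?exprn_gt0.
have Lip lam i x x' : 0 < lam -> obox a' b' x -> obox a' b' x' ->
    (forall j, j != i -> x ord0 j = x' ord0 j) -> x ord0 i <= x' ord0 i ->
    `|expsin sg c lam (uoo x) - expsin sg c lam (uoo x')| <= K2 * (x' ord0 i - x ord0 i).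
  move=> lam0 abx abx' xx' xi.
  have cH : continuous (expsin sg c lam).
    by apply: (@is_derive1_continuous _ _ (expsin' sg c lam)) => s; exact: is_derive_expsin.
  apply: (coordinate_lipschitz (D := D) (a := a') (b := b') (h := expsin sg c lam \o uoo)) => //.
  - by apply: measurableT_comp => //; exact: continuous_measurable_fun.
  - by move=> z Dz; apply: continuous_comp; [exact: cuoo|exact: cH].
  - move=> psi tpsi psi0.
    apply: (log_limit oD muD p1 poo Wu cvu muoo sg2 kap0 teta eta01 etaK K0 ucos usin hmin
      i lam0 tpsi c01) => x0 /eqP px0.
    by have /in'[_ /ltW] : cbox a' b' x0 by apply: contrapT => /psi0.
(* The bound r / 4 keeps [z] inside the box of half-side r / 2; the other one makes the Lipschitz
   variation at most 1 / 2, which is less than 1 - exp (- 1). *)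
pose d := Num.min (r / 4) (2 * (n%:R * K2 + 1))^-1.
have nK : 0 < 2 * (n%:R * K2 + 1) by rewrite mulr_gt0// ltr_wpDl// mulr_ge0.
have d0 : 0 < d by rewrite lt_min invr_gt0 nK divr_gt0.
apply/nbhs_rVP; exists d => // z yz.
have [dr dK] : d <= r / 4 /\ d <= (2 * (n%:R * K2 + 1))^-1 by rewrite /d !ge_min !lexx orbT.
have aby' : obox a' b' y by move=> j; rewrite /a' /b'; apply/andP; split; lra.
have abz' : obox a' b' z.
  move=> j; have := yz j; rewrite distrC ltr_distl /a' /b' => /andP[h1 h2].
  by apply/andP; split; lra.
have Dz : D z by apply/abD'/sub_obox_cbox.
have G0 : 0 <= sin (c + sg * uoo z) by apply: sin_ge0_01; exact: uoo01.
apply/eqP; rewrite eq_le G0 andbT leNgt; apply/negP => G1.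
pose lam := (sin (c + sg * uoo z))^-1.
have lam0 : 0 < lam by rewrite invr_gt0.
have := lipschitz_along_coordinates (h := expsin sg c lam \o uoo) K20
  (fun i x x' abx abx' => @Lip lam i x x' lam0 abx abx') aby' abz'
  (fun j => ltW (yz j)).
rewrite /= /expsin uy0 mulr0 oppr0 expR0 mulVf ?gt_eqF// expRN => est.
have e2 : 2 < expR 1 :> R.
  by have := @expR_gt1Dx R 1 (oner_neq0 _); rewrite (_ : 1 + 1 = 2).
have ei : (expR 1)^-1 < 2^-1 :> R by rewrite ltf_pV2 ?posrE ?expR_gt0.
have nKd : n%:R * (K2 * d) <= 2^-1.
  apply: (@le_trans _ _ ((n%:R * K2 + 1) * d)); first by rewrite mulrA mulrDl mul1r lerDl ltW.
  by move: dK; rewrite -(ler_pM2l nK) divff ?gt_eqF//; lra.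
have h1 : 1 - (expR 1)^-1 <= `|1 - (expR 1)^-1 : R| by exact: ler_norm.
lra.
Qed.

End propagation.

(** * Distance to the boundary *)

Section distance.
Context {R : realType} {n : nat}.
Implicit Types (D : set 'rV[R]_n) (f : 'rV[R]_n -> R).

Lemma nbhs_cbox (y : 'rV[R]_n) A : nbhs y A ->
  exists a b, cbox a b `<=` A /\ obox a b y.
Proof.
move=> /nbhs_rVP[e e0 eA]; exists (fun i => y ord0 i - e / 2), (fun i => y ord0 i + e / 2).
split=> [w abw|i].
  apply: eA => i; have /andP[h1 h2] := abw i.
  by rewrite distrC ltr_distl; apply/andP; split; lra.
by apply/andP; split; lra.
Qed.

Lemma gradN (phi : 'rV[R]_n -> R) : smooth phi ->
  forall x, grad (fun x => - phi x) x = - 1 *: grad phi x.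
Proof.
move=> Cphi x; apply/rowP => i; rewrite !mxE mulN1r /partial.
have := @deriveN _ _ _ phi x (delta_mx ord0 i) (smooth_derivable Cphi); exact.
Qed.

Lemma bounded_lebesgue_lty D : measurable D -> bounded_set D -> (lebesgue_rV n D < +oo)%E.
Proof.
move=> mD [M [_ HM]].
have sub : D `<=` cbox (fun=> - (`|M| + 1)) (fun=> `|M| + 1).
  move=> x Dx i; rewrite -ler_norml; apply: (le_trans (ler_coord_norm x i)).
  by apply: HM => //; rewrite (le_lt_trans (ler_norm _))// ltrDl.
apply: le_lt_trans (lebesgue_cbox_lty (fun=> - (`|M| + 1)) (fun=> `|M| + 1)).
by apply: le_measure => //; rewrite inE//; exact: measurable_cbox.
Qed.

Lemma connected_gt0 D f x : open D -> connected D ->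
  (forall z, D z -> {for z, continuous f}) -> (forall z, D z -> 0 <= f z) ->
  (forall z, D z -> f z = 0 -> \forall w \near z, f w = 0) ->
  D x -> 0 < f x -> forall z, D z -> 0 < f z.
Proof.
move=> oD cD cf f0 fz Dx fx.
have oP : open (D `&` [set z | 0 < f z]).
  rewrite openE => z [Dz fz0]; apply: filterI; first exact: open_nbhs_nbhs.
  exact: (cf z Dz [set t | 0 < t] (lt_nbhsr fz0)).
have oZ : open (D `&` [set z | f z = 0]).
  rewrite openE => z [Dz fz0]; apply: filterI; first exact: open_nbhs_nbhs.
  exact: fz.
have E : D `&` [set z | 0 < f z] = D.
  apply: cD; first by exists x.
    by exists (D `&` [set z | 0 < f z]) => //; rewrite setIA setIid.
  exists (~` (D `&` [set z | f z = 0])); first exact: open_closedC.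
  apply/seteqP; split=> z /= [Dz].
    by move=> fz0; split=> // -[_ fz1]; rewrite fz1 ltxx in fz0.
  move=> nz; split=> //; rewrite lt_neqAle f0// andbT eq_sym.
  by apply/eqP => fz0; exact: nz.
by move=> z; rewrite -{1}E => -[].
Qed.

Lemma dist_boundary_ge0 D x : 0 <= dist_boundary D x.
Proof.
rewrite /dist_boundary; set S := [set _ | _ in _].
have [->|S0] := eqVneq S set0; first by rewrite inf0.
apply: lb_le_inf; first exact/set0P.
by move=> _ [y _ <-]; exact: enorm_ge0.
Qed.

Lemma dist_boundary_le D x z : boundary D z -> dist_boundary D x <= enorm (z - x).
Proof.
move=> bz; apply: ge_inf; last by exists z.
by exists 0 => _ [y _ <-]; exact: enorm_ge0.
Qed.

Lemma dist_boundary_lt D x e : boundary D !=set0 -> dist_boundary D x < e ->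
  exists2 z, boundary D z & enorm (z - x) < e.
Proof.
move=> [z0 bz0] /inf_lt[|_ [z bz <-] ze]; last by exists z.
by exists (enorm (z0 - x)); exists z0.
Qed.

Lemma continuous_enormB (z : 'rV[R]_n) : continuous (fun x : 'rV[R]_n => enorm (z - x)).
Proof.
move=> x; apply: (@continuous_comp _ _ _ (fun x : 'rV[R]_n => z - x) (@enorm R n)).
  by apply: continuousB; [exact: cst_continuous|move=> ?].
exact: continuous_enorm.
Qed.

(** For a fixed boundary point [z], the quotient |z - x| / d is continuous in x and dominates the
    bound by the distance, so the inequality extends from almost every x to every x. *)
Lemma le_enorm_boundary D f (d : R) z x : open D -> 0 < d ->
  (forall x, D x -> {for x, continuous f}) ->
  {ae lebesgue_rV n, forall x, D x -> f x <= dist_boundary D x / d} ->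
  boundary D z -> D x -> f x <= enorm (z - x) / d.
Proof.
move=> oD d0 cf aef bz Dx; rewrite leNgt; apply/negP => lt.
pose g x := f x - enorm (z - x) / d.
have cg w : D w -> {for w, continuous g}.
  move=> Dw; apply: continuousB; first exact: cf.
  by apply: continuousM; [exact: continuous_enormB|exact: cst_continuous].
have oA : open (D `&` [set w | 0 < g w]).
  rewrite openE => w [Dw gw]; apply: filterI; first exact: open_nbhs_nbhs.
  exact: (cg w Dw [set t | 0 < t] (lt_nbhsr gw)).
have [||w [Dw gw] fw] := @ae_open_exists _ _ _ (fun w => f w <= dist_boundary D w / d) oA.
- by exists x; split=> //=; rewrite subr_gt0.
- by apply: filterS aef => w fw [Dw _]; exact: fw.
move: gw; rewrite /g /= subr_gt0 ltNge => /negP; apply; apply: (le_trans fw).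
by rewrite ler_wpM2r ?invr_ge0 ?(ltW d0)// dist_boundary_le.
Qed.

(** The bound tends to 0 as x tends to [z], and [z] is a limit of points of [D], along which [f]
    tends to f z. *)
Lemma le0_boundary D f (d : R) z : open D -> 0 < d -> {within closure D, continuous f} ->
  (forall x, D x -> f x <= enorm (z - x) / d) -> boundary D z -> f z <= 0.
Proof.
move=> oD d0 cf fd [cz _]; rewrite leNgt; apply/negP => fz0.
have n1 : \forall x \near z, closure D x -> f z / 2 < f x.
  move: cf => /subspace_continuousP/(_ z cz).
  move=> h; apply: (h [set t | f z / 2 < t]); apply: lt_nbhsr.
  by rewrite ltr_pdivrMr// ltr_pMr// ltr1n.
have n2 : \forall x \near z, enorm (z - x) < d * (f z / 2).
  have := @continuous_enormB z z [set t | t < d * (f z / 2)]; apply.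
  by apply: lt_nbhsl; rewrite subrr enorm0 mulr_gt0// divr_gt0.
have [x [Dx [h1 h2]]] := cz _ (filterI n1 n2).
have := fd x Dx; rewrite ler_pdivlMr// mulrC => h3.
have := h1 (subset_closure Dx); rewrite /= -(ltr_pM2l d0) => h4.
by move: (lt_trans (le_lt_trans h3 h2) h4); rewrite ltxx.
Qed.

(* Moving from a point at distance at most [d] a little towards a nearest
   boundary point leads to a point at distance less than [d]. *)
Lemma not_locally_max D f (d : R) y : 0 < d -> open D -> D y -> boundary D !=set0 ->
  {ae lebesgue_rV n, forall x, D x -> dist_boundary D x <= d} ->
  (forall z x, boundary D z -> D x -> f x <= enorm (z - x) / d) ->
  ~ (\forall x \near y, f x = 1).
Proof.
move=> d0 oD Dy bD aed fd f1.
have [r r0 Hr] : exists2 r, 0 < r & forall w : 'rV[R]_n,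
    (forall j, `|y ord0 j - w ord0 j| < r) -> D w /\ f w = 1.
  by apply/nbhs_rVP; apply: filterI => //; exact: open_nbhs_nbhs.
pose a i := y ord0 i - r / 2; pose b i := y ord0 i + r / 2.
have aby : obox a b y by move=> j; rewrite /a /b; apply/andP; split; lra.
have abr w : obox a b w -> forall j, `|y ord0 j - w ord0 j| < r / 2.
  by move=> abw j; have := abw j; rewrite /a /b distrC ltr_distl.
have [||x abx xd] := @ae_open_exists _ _ _ (fun w => dist_boundary D w <= d) (open_obox (a := a) (b := b)).
- by exists y.
- apply: filterS aed => w dw abw; apply: dw.
  have [] // := Hr w; move=> j; apply: (lt_trans (abr w abw j)); lra.
(* The two bounds on t make the displacement t (d + t d) at most 2 t d <= r / 4, so that [w] stays
   in the neighbourhood where f = 1. *)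
pose t := Num.min 2^-1 (r / (8 * d)).
have d8 : 0 < 8 * d by rewrite mulr_gt0.
have t0 : 0 < t by rewrite lt_min invr_gt0 ltr0n/= divr_gt0.
have [t2 tr] : t <= 2^-1 /\ t <= r / (8 * d) by rewrite /t !ge_min !lexx orbT.
have {}tr : t * (8 * d) <= r by rewrite -ler_pdivlMr.
have [z bz zx] : exists2 z, boundary D z & enorm (z - x) < d + t * d.
  by apply: dist_boundary_lt => //; apply: (le_lt_trans xd); rewrite ltrDl mulr_gt0.
pose w := x + t *: (z - x).
have [Dw fw] : D w /\ f w = 1.
  apply: Hr => j.
  have -> : y ord0 j - w ord0 j = (y ord0 j - x ord0 j) - t * (z - x) ord0 j.
    by rewrite /w !mxE; ring.
  apply: (le_lt_trans (ler_normB _ _)).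
  have h1 := abr x abx j.
  have h2 : `|t * (z - x) ord0 j| <= t * (d + t * d).
    rewrite normrM (gtr0_norm t0) ler_wpM2l ?(ltW t0)//.
    by apply: (le_trans (ler_coord_enorm _ j)); exact: ltW.
  have h3 : t * (d + t * d) <= t * (2 * d).
    rewrite ler_wpM2l ?(ltW t0)//.
    have : t * d <= 2^-1 * d by rewrite ler_wpM2r// ltW.
    lra.
  lra.
have := fd z w bz Dw; rewrite fw ler_pdivlMr// mul1r leNgt => /negP; apply.
have -> : z - w = (1 - t) *: (z - x).
  by rewrite /w scalerBl scale1r opprD addrA.
rewrite enormZ ger0_norm; last lra.
(* The product is d - t^2 d: the new point is at distance less than [d] from [z], although |z - x|
   itself may exceed d. *)
apply: (@lt_trans _ _ ((1 - t) * (d + t * d))); first by rewrite ltr_pM2l//; lra.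
have : 0 < t * (t * d) by rewrite !mulr_gt0.
lra.
Qed.

End distance.

Theorem theorem3p13 (R : realType) (N : nat) (Omega : set 'rV[R]_N)
  (u : R -> 'rV[R]_N -> R) (xmax : R -> 'rV[R]_N)
  (p : nat -> R) (xstar : 'rV[R]_N) (uoo : 'rV[R]_N -> R) :
  let rho := dist_boundary Omega in
  let norm_rho := norm_L Omega +oo%E rho in
  (2 <= N)%N ->
  bounded_smooth_domain Omega ->
  (forall q : R, N%:R < q ->
     positive_extremal Omega q (u q) /\
     unique_max_point Omega (u q) (xmax q)) ->
  (forall k, N%:R < p k) ->
  p k @[k --> \oo] --> +oo ->
  Omega xstar ->
  W10_oo Omega uoo ->
  (forall r : R, N%:R < r -> weak_cvg_W10 Omega r (fun k => u (p k)) uoo) ->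
  {uniform closure Omega, u (p k) @[k --> \oo] --> uoo} ->
  norm_grad Omega +oo%E uoo = (norm_rho^-1)%E ->
  {ae lebesgue_rV N, forall x, Omega x ->
     (0 <= (uoo x)%:E <= (rho x)%:E / norm_rho)%E} ->
  xmax (p k) @[k --> \oo] --> xstar ->
  uoo xstar = 1 ->
  norm_L Omega +oo%E uoo = 1%E ->
  (rho xstar)%:E = norm_rho ->
  (forall x, Omega x -> 0 < uoo x) /\
  uoo xstar = 1 /\ unique_max_point (closure Omega) uoo xstar.
Proof.
move=> rho norm_rho N2 [D0 oD cD bD _] Hu pN poo Dxs [[[muoo _] _ _] _] _ cvu _ aeu
  cxm uxs _ rhoxs.
have mD := measurable_open oD.
have muD := bounded_lebesgue_lty mD bD.
have N1 : 1 <= N%:R :> R by rewrite ler1n; exact: leq_trans N2.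
have p1 k : 1 <= p k by exact: le_trans (ltW (pN k)).
have pe k : positive_extremal Omega (p k) (u (p k)) by have [] := Hu _ (pN k).
have um k : unique_max_point Omega (u (p k)) (xmax (p k)) by have [] := Hu _ (pN k).
have Wu k : W10 Omega (p k) (u (p k)) by have [] := pe k.
have um1 k : u (p k) (xmax (p k)) = 1 by exact: extremal_max oD (pe k) (um k).
have Dxm k : Omega (xmax (p k)) by have [] := um k.
have u01 k x : Omega x -> 0 <= u (p k) x <= 1.
  move=> Dx; rewrite (extremal_le1 oD (pe k) Dx) andbT.
  by have [_ _ /(_ x Dx)/ltW] := pe k.
have cvD : {uniform Omega, u (p k) @[k --> \oo] --> uoo}.
  by apply: uniform_subset_cvg cvu; exact: subset_closure.
have cuoo : {within closure Omega, continuous uoo}.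
  apply: uniform_limit_continuous_subspace cvu.
  suff : \forall k \near \oo, continuous (u (p k) : subspace (closure Omega) -> R) by [].
  by apply: nearW => k; have [] := pe k.
have cD_uoo x : Omega x -> {for x, continuous uoo} by exact: open_within_continuous.
have uoo01 x : Omega x -> 0 <= uoo x <= 1.
  move=> Dx; apply/andP; split; apply/ler_addgt0Pr => e e0.
    have [k _ /(_ k (leqnn k) x Dx)] := uniform_cvgP cvD e0.
    by rewrite ltr_distl => /andP[h1 _]; have /andP[h2 _] := u01 k x Dx; lra.
  have [k _ /(_ k (leqnn k) x Dx)] := uniform_cvgP cvD e0.
  by rewrite ltr_distl => /andP[_ h1]; have /andP[_ h2] := u01 k x Dx; lra.
have pi1 : (1 : R) < pi by have := pi_ge2 R; lra.
have sin_eq0 (s : R) : 0 <= s <= 1 -> sin s = 0 -> s = 0.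
  move=> /andP[s0 s1] ss; apply/eqP; rewrite eq_le s0 andbT leNgt; apply/negP => sp.
  by have := sin_gt0_pi (x := s); rewrite ss ltxx sp (le_lt_trans s1 pi1) => /(_ isT).
have uoo_gt0 : forall x, Omega x -> 0 < uoo x.
  apply: (connected_gt0 oD cD cD_uoo _ _ Dxs); last by rewrite uxs.
    by move=> z /uoo01/andP[].
  move=> y Dy uy0.
  have [a [b [abD aby]]] := nbhs_cbox (open_nbhs_nbhs (conj oD Dy)).
  have h1 k x : Omega x -> 0 <= 0 + 1 * u (p k) x <= 1.
    by move=> Dx; rewrite add0r mul1r u01.
  have h2 x : Omega x -> 0 <= 0 + 1 * uoo x <= 1.
    by move=> Dx; rewrite add0r mul1r uoo01.
  have sg2 : 1 ^+ 2 = 1 :> R by rewrite expr1n.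
  have h : \forall z \near y, sin (0 + 1 * uoo z) = 0.
    apply: (vanish_near oD muD p1 poo Wu cvD muoo cD_uoo sg2 h1 h2 abD aby).
      (* A nonnegative perturbation keeps the value at the maximum point at least 1 wherever it is
         supported, so every k qualifies. *)
      apply: nearW => k phi tphi phi0 _.
      rewrite (_ : (fun x => enorm (_ + 1 *: _)) =
        fun x => enorm (weak_gradient Omega (u (p k)) x + grad phi x)); last first.
        by apply/funext => x; rewrite scale1r.
      by apply: (extremal_minimal oD muD (p1 k) (pe k) tphi (Dxm k)); rewrite um1 lerDl.
    by rewrite uy0 mulr0 addr0 sin0.
  near=> z; apply: sin_eq0; first by apply: uoo01; near: z; exact: open_nbhs_nbhs.
  by rewrite -[uoo z]mul1r -[1 * _]add0r; near: z.
split=> //; split=> //.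
(* If the maximal distance were 0, the bound by rho / norm_rho would force uoo <= 0 almost
   everywhere, hence at [xstar] by continuity. The inverse of [norm_rho] is harmless in that case,
   as 0 times any extended real is 0. *)
have d0 : 0 < rho xstar.
  rewrite lt_neqAle dist_boundary_ge0 andbT; apply/negP => /eqP r0.
  have rho0 : {ae lebesgue_rV N, forall x, Omega x -> `|rho x| <= 0}.
    by apply/norm_LyP => //; rewrite -/norm_rho -rhoxs -r0.
  have : uoo xstar <= 0.
    apply: (ae_le_continuous oD Dxs (cD_uoo _ Dxs)).
    apply: filterS2 rho0 aeu => x h1 h2 Dx; have := h2 Dx; have := h1 Dx.
    rewrite normr_le0 => /eqP ->; rewrite mul0e => /andP[].
    by rewrite !lee_fin => ? ?; rewrite ger0_norm.
  by rewrite uxs ler10.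
have aeu' : {ae lebesgue_rV N, forall x, Omega x -> uoo x <= dist_boundary Omega x / rho xstar}.
  apply: filterS aeu => x h /h /andP[_].
  by rewrite -rhoxs inver gt_eqF// -EFinM lee_fin.
have ud z x : boundary Omega z -> Omega x -> uoo x <= enorm (z - x) / rho xstar.
  by move=> bz Dx; exact: le_enorm_boundary aeu' bz Dx.
(* The infimum of the empty set is 0, so an empty boundary would contradict [d0]. *)
have bN0 : boundary Omega !=set0.
  apply/set0P/negP => /eqP b0; move: d0.
  by rewrite /rho /dist_boundary b0 image_set0 inf0 ltxx.
have aed : {ae lebesgue_rV N, forall x, Omega x -> dist_boundary Omega x <= rho xstar}.
  have := (@norm_LyP _ _ Omega rho (rho xstar) (ltW d0)).1.
  rewrite rhoxs => /(_ (lexx _)); apply: filterS => x h /h.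
  by rewrite ger0_norm// dist_boundary_ge0.
split; first exact: subset_closure.
move=> y cy yxs; have [Dy|nDy] := pselect (Omega y); last first.
  have by_ : boundary Omega y by split=> //; rewrite ((interior_id _).1 oD).
  rewrite uxs; apply: (@le_lt_trans _ _ 0) => //.
  by apply: (le0_boundary oD d0 cuoo _ by_) => x; exact: ud.
rewrite uxs lt_neqAle; have /andP[_ ->] := uoo01 y Dy; rewrite andbT.
apply/eqP => uy1; apply: (not_locally_max d0 oD Dy bN0 aed ud).
(* The balls of radius [e] about [y] and [xstar] are disjoint, so a box inside the former misses the
   maximum points for k large. *)
pose e := `|y - xstar| / 2.
have e0 : 0 < e by rewrite divr_gt0// normr_gt0 subr_eq0; exact/eqP.
have nA : nbhs y (Omega `&` ball y e).
  by apply: filterI; [exact: open_nbhs_nbhs|exact: nbhsx_ballx].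
have [a [b [abA aby]]] := nbhs_cbox nA.
have abD : cbox a b `<=` Omega by move=> w /abA[].
have nx : \forall k \near \oo, ~ obox a b (xmax (p k)).
  have /cvgrPdist_lt/(_ e e0) := cxm; apply: filterS => k kx /sub_obox_cbox/abA[_].
  rewrite -ball_normE /= => ky.
  have : `|y - xstar| < e + e.
    rewrite -(subrK (xmax (p k)) y) -addrA.
    by apply: (le_lt_trans (ler_normD _ _)); apply: ltrD => //; rewrite distrC.
  by rewrite /e -splitr ltxx.
have h1 k x : Omega x -> 0 <= 1 + -1 * u (p k) x <= 1.
  by move=> Dx; have /andP[? ?] := u01 k x Dx; apply/andP; split; lra.
have h2 x : Omega x -> 0 <= 1 + -1 * uoo x <= 1.
  by move=> Dx; have /andP[? ?] := uoo01 x Dx; apply/andP; split; lra.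
have sg2 : (-1) ^+ 2 = 1 :> R by rewrite sqrrN expr1n.
have h : \forall z \near y, sin (1 + -1 * uoo z) = 0.
  apply: (vanish_near oD muD p1 poo Wu cvD muoo cD_uoo sg2 h1 h2 abD aby).
    (* [phi] vanishes at the maximum point, so u - phi still takes the value 1 there, which is the
       one-point condition of [extremal_minimal]. *)
    apply: filterS nx => k nk phi tphi phi0 phiab.
    have [Cphi _ _] := tphi.
    have tN : test_function Omega (fun x => - phi x).
      by have := test_functionZ (-1) tphi; under eq_fun do rewrite mulN1r.
    rewrite (_ : (fun x => enorm (_ + -1 *: _)) = fun x =>
      enorm (weak_gradient Omega (u (p k)) x + grad (fun x => - phi x) x)); last first.
      by apply/funext => x; rewrite gradN.
    apply: (extremal_minimal oD muD (p1 k) (pe k) tN (Dxm k)).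
    by rewrite um1 phiab// oppr0 addr0.
  by rewrite uy1 mulN1r subrr sin0.
near=> z.
have Dz : Omega z by near: z; exact: open_nbhs_nbhs.
have : sin (1 + -1 * uoo z) = 0 by near: z.
by move/(sin_eq0 _ (h2 z Dz)); rewrite mulN1r => /eqP; rewrite subr_eq0 => /eqP.
Unshelve. all: by end_near. Qed.
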